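(* Let $E$ be a (non-random) subset of $[0,1]$. Almost surely, $$\dim Z(E)\le \alpha^*(E)\,\dim(E)$$ and $$\dim X(E)\le d^*(E).$$
   Context: Let $\alpha:[0,1]\to(0,2)$ be a $\mathcal C^1$ function taking values in $[\alpha_*,\alpha^*]\subset(0,2)$, where $0<\alpha_*\le\alpha^*<2$ are constants. For $E\subset[0,1]$ put $\alpha^*(E)=\sup_{t\in E}\alpha(t)$ and $d^*(E)=\max(1,\alpha^*(E))\dim(E)$, where $\dim$ is Hausdorff dimension. For $E=\varnothing$, $\dim(E)=0$ and any product of the form (quantity)$\cdot\dim(E)$ is read as $0$. Let $(\Gamma_i)_{i\ge1}$ be the arrival times of a Poisson process with unit rate, $(V_i)_{i\ge1}$ i.i.d. uniform on $[0,1]$ independent of $(\Gamma_i)$, and $(\gamma_i)_{i\ge1}$ i.i.d. with $P(\gamma_i=1)=P(\gamma_i=-1)=1/2$, independent of $(\Gamma_i)$ and $(V_i)$. For $a\in(0,2)$ let $C_a=\left(\int_0^\infty x^{-a}\sin x\,dx\right)^{-1/a}$ (improper integral). The two multistable Lévy motions are, for $t\in[0,1]$, $$X(t)=\sum_{i\ge1}\gamma_i C_{\alpha(t)}\Gamma_i^{-1/\alpha(t)}\mathbf 1_{[0,t]}(V_i),\qquad Z(t)=\sum_{i\ge1}\gamma_i C_{\alpha(V_i)}\Gamma_i^{-1/\alpha(V_i)}\mathbf 1_{[0,t]}(V_i).$$ They satisfy $\log E[e^{i\theta X(t)}]=-t|\theta|^{\alpha(t)}$, $\log E[e^{i\theta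 Z(t)}]=-\int_0^t|\theta|^{\alpha(x)}dx$, and are linked by $X(t)=Y(t)+Z(t)$ with $Y(t)=\int_0^t\sum_{i\ge1}\gamma_iK_i(u)\mathbf 1_{[0,u)}(V_i)\,du$, $K_i(u)=\frac{d}{ds}\bigl(C_{\alpha(s)}\Gamma_i^{-1/\alpha(s)}\bigr)\big|_{s=u}$. The process $Z$ is a semimartingale, taken with càdlàg paths, and $X=Y+Z$ as processes. For a process $W$, $W(E)=\{W(t):t\in E\}$ is its range on $E$. *)

(* Defs.v *)
From HB Require Import structures.
From mathcomp Require Export all_boot all_order all_algebra.
From mathcomp Require Export all_classical all_reals all_analysis.
Export numFieldNormedType.Exports.

Set Implicit Arguments.
Unset Strict Implicit.
Unset Printing Implicit Defensive.

Import Order.TTheory GRing.Theory Num.Theory.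

Local Open Scope classical_set_scope.
Local Open Scope ring_scope.

Section hausdorff.
Context {R : realType}.
Local Open Scope ereal_scope.

(* [diameter set0 = -oo]: the empty set is handled separately in [gauge]. *)
Definition diameter (U : set R) : \bar R :=
  ereal_sup [set (`|p.1 - p.2|)%:E | p in U `*` U].

(* The empty set has weight 0 also for s = 0, whereas a point then has weight
   0 `^ 0 = 1, so that the measure of exponent 0 is the counting measure. *)
Definition gauge (s : R) (U : set R) : \bar R :=
  if U == set0 then 0 else diameter U `^ s.

Definition hausdorff_content (s delta : R) (A : set R) : \bar R :=
  ereal_inf [set \sum_(0 <= i <oo) gauge s (U i) |
    U in [set U : nat -> set R |
      A `<=` \bigcup_i U i /\ forall i, diameter (U i) <= delta%:E]].

Definition hausdorff_measure (s : R) (A : set R) : \bar R :=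
  ereal_sup [set hausdorff_content s delta A |
    delta in [set delta : R | (0 < delta)%R]].

Definition hausdorff_dim (A : set R) : \bar R :=
  ereal_inf [set s%:E |
    s in [set s : R | (0 <= s)%R /\ hausdorff_measure s A = 0]].

End hausdorff.

Section calculus.
Context {R : realType}.

Definition diffquot01 (f : R -> R) (t : R) : set_system R :=
  (f s - f t) / (s - t) @[s --> within `[0, 1] t^'].

(* Derivative of a function on [0, 1], one-sided at the end points. *)
Definition derive01 (f : R -> R) (t : R) : R := lim (diffquot01 f t).

Definition C1_on01 (f : R -> R) : Prop :=
  (forall t, t \in `[0, 1] -> cvg (diffquot01 f t)) /\
  {within `[0, 1], continuous (derive01 f)}.

Definition cadlag01 (f : R -> R) : Prop :=
  (forall t, t \in `[0, 1[ -> f s @[s --> t^'+] --> f t) /\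
  (forall t, t \in `]0, 1] -> cvg (f s @[s --> t^'-])).

End calculus.

Section probability.
Context {R : realType} {d : measure_display} {Omega : measurableType d}.
Variable P : probability Omega R.

Definition has_law (X : Omega -> R) (mu : set R -> \bar R) : Prop :=
  forall B, measurable B -> P (X @^-1` B) = mu B.

Definition mutually_independent (X : nat -> Omega -> R) : Prop :=
  forall (s : seq nat) (B : nat -> set R), uniq s ->
    (forall i, measurable (B i)) ->
    P (\bigcap_(i in [set` s]) (X i @^-1` B i)) =
    (\prod_(i <- s) P (X i @^-1` B i))%E.

Definition iid_with_law (X : nat -> Omega -> R) (mu : set R -> \bar R) :=
  mutually_independent X /\ forall i, has_law (X i) mu.

Definition sigma_gen (X : nat -> Omega -> R) : set (set Omega) :=
  <<s [set A | exists i B, measurable B /\ A = X i @^-1` B] >>.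

Definition independent_sigma (F H : set (set Omega)) : Prop :=
  forall A B, F A -> H B -> P (A `&` B) = (P A * P B)%E.

Definition interarrival (G : nat -> Omega -> R) (n : nat) (w : Omega) : R :=
  if n is m.+1 then G m.+1 w - G m w else G 0%N w.

Definition poisson_arrivals (G : nat -> Omega -> R) : Prop :=
  iid_with_law (interarrival G) (exponential_prob 1).

Definition iid_uniform01 (V : nat -> Omega -> R) : Prop :=
  iid_with_law V (uniform_prob (@ltr01 R)).

Definition iid_signs (g : nat -> Omega -> R) : Prop :=
  mutually_independent g /\
  forall i, P (g i @^-1` [set 1]) = (2^-1)%:E /\
            P (g i @^-1` [set -1]) = (2^-1)%:E.

End probability.

Section multistable.
Context {R : realType}.

(* The integral is improper at infinity only: the integrand is absolutely
   integrable near 0, as a < 2. *)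
Definition stable_const (a : R) : R :=
  lim ((\int[lebesgue_measure]_(x in `[0, M]) (x `^ (- a) * sin x))%R
         @[M --> +oo]) `^ (- a^-1).

Variable alpha : R -> R.

Definition magnitude (s x : R) : R :=
  stable_const (alpha s) * x `^ (- (alpha s)^-1).

Definition sup_index (E : set R) : R := sup (alpha @` E).

Definition dstar (E : set R) : \bar R :=
  ((Num.max 1 (sup_index E))%:E * hausdorff_dim E)%E.

Context {Omega : Type}.
(* The sequences are indexed from 0 instead of 1. *)
Variables G V g : nat -> Omega -> R.

Definition X_term (t : R) (w : Omega) (i : nat) : R :=
  g i w * magnitude t (G i w) * \1_(`[0, t]%classic) (V i w).

Definition Z_term (t : R) (w : Omega) (i : nat) : R :=
  g i w * magnitude (V i w) (G i w) * \1_(`[0, t]%classic) (V i w).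

Definition K (i : nat) (u : R) (w : Omega) : R :=
  derive01 (magnitude^~ (G i w)) u.

Definition Y_term (u : R) (w : Omega) (i : nat) : R :=
  g i w * K i u w * \1_(`[0, u[%classic) (V i w).

(* For almost every w, the series converges for almost every u. *)
Definition Y (t : R) (w : Omega) : R :=
  (\int[lebesgue_measure]_(u in `[0, t]) lim (series (Y_term u w) @ \oo))%R.

End multistable.

(* Main.v *)
Require Import Defs.
From mathcomp Require Import measurable_realfun ring lra.

(** Let [A] be the supremum of the index on [E], replaced by [max 1 A] for the
   process [X]. Take exponents [s > dim E] and [beta > A], and cover [E] by cells of
   lengths [del_j] for which [\sum_j del_j `^ s] is small. On a cell of length [del]
   near [E] a path should oscillate by about [del `^ beta^-1], so that the images
   of the cells cover the range with a small sum of p-th powers of diameters,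
   for [p = s * beta]; then the dimension of the range is at most [p], which is
   as close to [A * dim E] as one likes.

   What has to be proved is that the p-th power of the oscillation over a cell has
   a mean at most [K * del `^ s] ([Z_cell], [Y_cell]). Then the sums attached to
   finer and finer covers tend to 0 in mean, their infimum is almost surely 0, and
   the range has p-dimensional measure 0 ([range_null]).

   For [Z], the points [G i] grow at least linearly ([ae_arrival_growth]), so that
   the i-th jump of the cell is at most [kap * (i + 1) `^ (- beta^-1)]
   ([jump_bounds], which rests on the Lipschitz dependence of the stable constant
   on the index, [stable_const_lipschitz]). The first [1 / del] jumps are added
   with their p-th powers, [p <= 1], each falling into the cell with probability [del]. Given
   the points, the other jumps form a Rademacher series, whose maximum over the
   times of a grid is controlled in mean square by Doob's inequality
   ([rademacher_maximal], [integral_sign_average], [signed_maximal]). Both parts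
   have the order [del `^ s]. For [X], the difference [Y = X - Z] is Lipschitz in
   mean square, so that its variation over a cell has a mean of order [del]: this
   suffices when [beta >= 1].

   The series are known to converge to the processes at one time at a time, hence
   at all dyadic times at once, almost surely. Right-continuity extends the
   estimates to all times: [Z] is cadlag, and [Y], an integral up to [t] of a
   function of which little is known, is right continuous except perhaps at one
   time, which contributes a single value ([right_continuous_Rintegral]).

   This proves the bounds when [dim E < 1] and [A * dim E < 1]. Since a subset of
   the line has dimension at most 1 ([hausdorff_dim_le1]), nothing is left to
   prove when [A * dim E >= 1]. The remaining case, [dim E = 1] and [A < 1],
   concerns [Z] alone. There the jumps are q-summable for every [q] between [A] and
   1, and after cutting the time interval at the first [N] jumps the q-th powers of
   the oscillations of one path add up to a remainder of a convergent series
   ([Z_range_null]). *)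

Set Implicit Arguments.
Unset Strict Implicit.
Unset Printing Implicit Defensive.

Import Order.TTheory GRing.Theory Num.Theory.

Local Open Scope classical_set_scope.
Local Open Scope ring_scope.

(** * Hausdorff measure and dimension *)

Section hausdorff_tools.
Context {R : realType}.
Implicit Types (A U : set R) (s p r : R).

Lemma diameter_le U r :
  (forall x y, U x -> U y -> `|x - y| <= r) -> (diameter U <= r%:E)%E.
Proof.
move=> H; apply: ge_ereal_sup => _ [[x y] [/= Ux Uy] <-].
by rewrite lee_fin; exact: H.
Qed.

Lemma le_diameter U x y : U x -> U y -> (`|x - y|%:E <= diameter U)%E.
Proof. by move=> Ux Uy; apply: ereal_sup_ubound; exists (x, y). Qed.

Lemma diameter_ge0 U : U !=set0 -> (0 <= diameter U)%E.
Proof.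
by case=> x Ux; apply: le_trans (le_diameter Ux Ux); rewrite subrr normr0.
Qed.

Lemma gauge_ge0 s U : (0 <= gauge s U)%E.
Proof. by rewrite /gauge; case: ifP => // _; exact: poweR_ge0. Qed.

Lemma gauge_le_powR s U r : 0 <= s -> 0 <= r ->
  (forall x y, U x -> U y -> `|x - y| <= r) -> (gauge s U <= (r `^ s)%:E)%E.
Proof.
move=> s0 r0 H; rewrite /gauge; case: ifPn => [_|/set0P U0].
  by rewrite lee_fin powR_ge0.
rewrite -poweR_EFin; apply: gt0_ler_poweR => //; last exact: diameter_le.
- by rewrite in_itv/= diameter_ge0//= leey.
- by rewrite in_itv/= lee_fin r0/= leey.
Qed.

Lemma hausdorff_dim_ge0 A : (0 <= hausdorff_dim A)%E.
Proof. by apply: le_ereal_inf_tmp => _ [s [s0 _] <-]; rewrite lee_fin. Qed.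

Lemma hausdorff_dim_le A p : 0 <= p -> hausdorff_measure p A = 0%E ->
  (hausdorff_dim A <= p%:E)%E.
Proof. by move=> p0 Hp; apply: ereal_inf_lbound; exists p. Qed.

Lemma hausdorff_content_ge0 s r A : (0 <= hausdorff_content s r A)%E.
Proof.
apply: le_ereal_inf_tmp => _ [U _ <-].
by apply: nneseries_ge0 => i _ _; exact: gauge_ge0.
Qed.

(** For a positive exponent the bound on the diameters comes for free: a
   member of a cover of small total weight is itself small. *)
Lemma hausdorff_measure_eq0 p A : 0 < p ->
  (forall e, 0 < e -> exists2 U : nat -> set R, A `<=` \bigcup_i U i &
     (\sum_(0 <= i <oo) gauge p (U i) <= e%:E)%E) ->
  hausdorff_measure p A = 0%E.
Proof.
move=> p0 H; apply/eqP; rewrite eq_le; apply/andP; split; last first.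
  apply: (le_trans (hausdorff_content_ge0 p 1 A)).
  by apply: ereal_sup_ubound; exists 1; rewrite //= ltr01.
apply: ge_ereal_sup => _ [r /= r0 <-].
apply/lee_addgt0Pr => e e0; rewrite add0e.
pose e' := Num.min e (r `^ p).
have e'0 : 0 < e' by rewrite lt_min e0 powR_gt0.
have [U AU HU] := H e' e'0.
apply: (@le_trans _ _ e'%:E); last by rewrite lee_fin ge_min lexx.
apply: (le_trans _ HU); apply: ereal_inf_lbound; exists U => //; split=> // i.
have [->|/set0P U0] := eqVneq (U i) set0.
  by apply: diameter_le => x y [].
have gi : (gauge p (U i) <= (r `^ p)%:E)%E.
  apply: (@le_trans _ _ e'%:E); last by rewrite lee_fin ge_min lexx orbT.
  apply: (le_trans _ HU).
  rewrite (@nneseriesD1 _ (fun i => gauge p (U i)) i xpredT)//; last first.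
    by move=> k _; exact: gauge_ge0.
  by rewrite leeDl//; apply: nneseries_ge0 => k _ _; exact: gauge_ge0.
move: gi; rewrite /gauge ifF; last by apply/negbTE/set0P.
have := diameter_ge0 U0; case: (diameter (U i)) => [x| |]//.
  rewrite poweR_EFin !lee_fin => x0; apply: contra_le => rx.
  by apply: gt0_ltr_powR; rewrite // nnegrE ltW.
by rewrite poweRyr ?gt_eqF// leye_eq.
Qed.

(** Sets of diameter at most 1 weigh less for the exponent [s] than for a smaller
   one, at which the measure of [A] is 0. *)
Lemma hausdorff_dim_lt_cover s A : (hausdorff_dim A < s%:E)%E ->
  forall r e, 0 < r <= 1 -> 0 < e -> exists U : nat -> set R,
  [/\ A `<=` \bigcup_i U i,
     (forall i, diameter (U i) <= r%:E)%E &
     (\sum_(0 <= i <oo) gauge s (U i) <= e%:E)%E].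
Proof.
move=> /ereal_inf_lt[_ [s' [s'0 Hs'] <-]]; rewrite lte_fin => s's r e.
move=> /andP[r0 r1] e0.
have : (hausdorff_content s' r A <= 0)%E.
  by rewrite -Hs'; apply: ereal_sup_ubound; exists r.
move=> /le_lt_trans => /(_ e%:E); rewrite lte_fin => /(_ e0).
move=> /ereal_inf_lt[_ [U [AU dU] <-]] HU.
exists U; split => //; apply: le_trans (ltW HU).
apply: lee_nneseries => i; first by move=> _ _; exact: gauge_ge0.
move=> _; rewrite /gauge; case: ifPn => // /set0P Ui0.
have := dU i; have := diameter_ge0 Ui0.
case: (diameter (U i)) => [x||]//.
rewrite !poweR_EFin !lee_fin => x0 xr.
have [->|xn0] := eqVneq x 0.
  rewrite powR0 ?powR_ge0// gt_eqF//; exact: le_lt_trans s's.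
by apply: ger_powR; rewrite ?(ltW s's)// lt_neqAle eq_sym xn0 x0 (le_trans xr).
Qed.

End hausdorff_tools.

(** * Inequalities for real powers *)

Section powers.
Context {R : realType}.
Implicit Types (x y p q r : R).

(** With [u / (x + y)] a proportion, [u / (x + y) <= (u / (x + y)) `^ p]; the two
   proportions add up to 1. *)
Lemma powR_subadditive p x y : 0 < p <= 1 -> 0 <= x -> 0 <= y ->
  (x + y) `^ p <= x `^ p + y `^ p.
Proof.
move=> /andP[p0 p1] x0 y0.
have [->|xn0] := eqVneq x 0; first by rewrite add0r lerDr powR_ge0.
have [->|yn0] := eqVneq y 0; first by rewrite addr0 lerDl powR_ge0.
have xp : 0 < x by rewrite lt_neqAle eq_sym xn0.
have yp : 0 < y by rewrite lt_neqAle eq_sym yn0.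
have s0 : 0 < x + y by rewrite addr_gt0.
have part u : 0 < u -> u <= x + y -> (x + y) `^ p * (u / (x + y)) <= u `^ p.
  move=> u0 us; have -> : u `^ p = (x + y) `^ p * (u / (x + y)) `^ p.
    rewrite -powRM ?(ltW s0)//; last by rewrite divr_ge0 ?ltW.
    by rewrite mulrCA divff ?mulr1// gt_eqF.
  rewrite ler_wpM2l ?powR_ge0// ger1_powR//.
  by rewrite divr_gt0//= ler_pdivrMr// mul1r.
have [xs ys] : x <= x + y /\ y <= x + y by rewrite lerDl lerDr.
apply: le_trans (lerD (part x xp xs) (part y yp ys)).
by rewrite -mulrDr -mulrDl divff ?mulr1// gt_eqF.
Qed.

Lemma powR_sum_le (I : Type) (s : seq I) (P : pred I) (F : I -> R) p :
  0 < p <= 1 -> (forall i, P i -> 0 <= F i) ->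
  (\sum_(i <- s | P i) F i) `^ p <= \sum_(i <- s | P i) F i `^ p.
Proof.
move=> p01 F0; elim: s => [|i s IH].
  by rewrite !big_nil powR0// gt_eqF//; case/andP: p01.
rewrite !big_cons; case: ifP => // Pi.
apply: le_trans (powR_subadditive p01 (F0 _ Pi) _) _.
  exact: sumr_ge0.
by rewrite lerD2l.
Qed.

(** A substitute for the concavity of [y `^ p] as a function of [y `^ m], which
   needs no integral inequality: compare [y] with the threshold [x]. *)
Lemma powR_le_threshold p m x y : 0 < p <= m -> 0 < x -> 0 <= y ->
  y `^ p <= x `^ p + x `^ (p - m) * y `^ m.
Proof.
move=> /andP[p0 pm] x0 y0; have [yx|xy] := leP y x.
  rewrite -[leLHS]addr0 lerD//; last by rewrite mulr_ge0// powR_ge0.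
  by apply: ge0_ler_powR; rewrite ?nnegrE// ltW.
rewrite -[leLHS]add0r lerD ?powR_ge0//.
have y1 : 0 < y by exact: lt_trans xy.
have -> : y `^ p = y `^ (p - m) * y `^ m.
  by rewrite -powRD ?subrK// gt_eqF ?implybT.
rewrite ler_wpM2r ?powR_ge0// -(opprB m p) !powRN lef_pV2 ?posrE ?powR_gt0//.
by apply: ge0_ler_powR; rewrite ?nnegrE ?subr_ge0// ltW.
Qed.

Lemma expRN_le (v : R) : 0 <= v <= 1 -> expR (- v) <= 1 - v / 2.
Proof.
move=> /andP[v0 v1]; rewrite expRN.
have e1 : 1 + v <= expR v by exact: expR_ge1Dx.
rewrite -[leRHS]invrK lef_pV2 ?posrE ?expR_gt0 ?invr_gt0 ?subr_gt0//; last by lra.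
apply: le_trans e1; rewrite -[leLHS]mul1r ler_pdivrMr; last by lra.
nra.
Qed.

(** The ratio of the powers of two consecutive integers is an exponential, to be
   compared with its tangent: this replaces integrals in the bounds on sums of
   powers. *)
Lemma powR_nat_pred (a : R) i : (0 < i)%N ->
  i%:R `^ a = i.+1%:R `^ a * expR (a * ln (1 - i.+1%:R^-1)).
Proof.
move=> i0; have -> : i%:R = i.+1%:R * (1 - i.+1%:R^-1) :> R.
  by rewrite mulrBr mulr1 mulfV ?pnatr_eq0// -addn1 natrD addrK.
have u0 : 0 < 1 - i.+1%:R^-1 :> R.
  by rewrite subr_gt0 invf_lt1// ltr1n.
by rewrite powRM// ?(ltW u0)//; congr (_ * _); rewrite /powR gt_eqF.
Qed.

Lemma ln1B_le (u : R) : u < 1 -> ln (1 - u) <= - u.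
Proof. by move=> u1; apply: le_ln1Dx; rewrite ltrN2. Qed.

Lemma sum_powR_lt1 (a : R) : 0 < a <= 1 -> forall N,
  \sum_(0 <= i < N) i.+1%:R `^ (a - 1) <= 2 / a * N%:R `^ a.
Proof.
move=> /andP[a0 a1]; elim=> [|N IH].
  by rewrite big_geq// mulr_ge0 ?powR_ge0 ?divr_ge0// ltW.
rewrite big_nat_recr//= -lerBrDr; apply: le_trans IH _.
rewrite lerBrDr -lerBrDl -mulrBr mulrAC ler_pdivlMr//.
have -> : N.+1%:R `^ (a - 1) = N.+1%:R `^ a / N.+1%:R :> R.
  by rewrite powRB ?powRr1// pnatr_eq0 implybT.
have P0 : 0 <= N.+1%:R `^ a :> R by exact: powR_ge0.
suff H : N%:R `^ a <= N.+1%:R `^ a * (1 - a / N.+1%:R / 2).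
  rewrite -subr_ge0 in H; rewrite -subr_ge0.
  rewrite (_ : _ - _ = 2 * (N.+1%:R `^ a * (1 - a / N.+1%:R / 2) - N%:R `^ a)).
    by rewrite mulr_ge0.
  by field; rewrite nat1r pnatr_eq0.
case: N P0 => [_|N P0].
  rewrite powR0 ?gt_eqF// powR1 divr1 mul1r; lra.
rewrite powR_nat_pred//= ler_wpM2l//.
have u01 : (0 < (N.+2%:R^-1 : R)) && ((N.+2%:R^-1 : R) <= 1).
  by apply/andP; split; [rewrite invr_gt0|rewrite invf_le1 ?ltr0n// ler1n].
apply: (@le_trans _ _ (expR (- (a / N.+2%:R)))).
  rewrite ler_expR -mulrN ler_wpM2l ?(ltW a0)//.
  by apply: ln1B_le; rewrite invf_lt1// ltr1n.
move: u01; set u := N.+2%:R^-1 => /andP[u0 u1].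
by apply: expRN_le; apply/andP; split; nra.
Qed.

Lemma sum_powR_gt1 (r : R) : 1 < r -> forall N n, (0 < N)%N ->
  \sum_(N <= i < n) i.+1%:R `^ (- r) <= (r - 1)^-1 * N%:R `^ (1 - r).
Proof.
move=> r1 N n N0; have b0 : 0 < r - 1 by rewrite subr_gt0.
have [nN|Nn] := leqP n N.
  by rewrite big_geq// mulr_ge0 ?powR_ge0 ?invr_ge0// ltW.
suff: \sum_(N <= i < n) i.+1%:R `^ (- r) <=
    (r - 1)^-1 * (N%:R `^ (1 - r) - n%:R `^ (1 - r)).
  move/le_trans; apply; rewrite ler_wpM2l ?invr_ge0 ?(ltW b0)//.
  by rewrite gerBl powR_ge0.
have -> : N%:R `^ (1 - r) - n%:R `^ (1 - r) =
    \sum_(N <= i < n) (i%:R `^ (1 - r) - i.+1%:R `^ (1 - r)) :> R.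
  rewrite -opprB -(telescope_sumr (fun i => i%:R `^ (1 - r)) (ltnW Nn)) -sumrN.
  by apply: eq_bigr => i _; rewrite opprB.
rewrite mulr_sumr.
rewrite big_nat_cond [leRHS]big_nat_cond; apply: ler_sum => i.
rewrite andbT => /andP[Ni _]; have i0 : (0 < i)%N by exact: leq_trans Ni.
rewrite mulrC ler_pdivlMr// (powR_nat_pred _ i0).
have -> : i.+1%:R `^ (- r) = i.+1%:R `^ (1 - r) / i.+1%:R :> R.
  rewrite -[X in _ / X]powRr1// -powRB ?pnatr_eq0 ?implybT//.
  by congr (_ `^ _); lra.
have := powR_ge0 i.+1%:R (1 - r); set A := _ `^ _ => A0.
rewrite -[X in _ <= _ - X](mulr1 A) -mulrBr -mulrA ler_wpM2l//.
have := expR_ge1Dx ((1 - r) * ln (1 - i.+1%:R^-1)).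
have : ln (1 - i.+1%:R^-1) <= - i.+1%:R^-1 :> R.
  by apply: ln1B_le; rewrite invf_lt1// ltr1n.
have : 0 < i.+1%:R^-1 :> R by rewrite invr_gt0.
set u := i.+1%:R^-1; set L := ln _ => u0 HL He.
rewrite lerBrDr; apply: le_trans He; nra.
Qed.

Lemma sum_powR_gt1_le (r : R) : 1 < r -> forall n,
  \sum_(0 <= i < n) i.+1%:R `^ (- r) <= 1 + (r - 1)^-1.
Proof.
move=> r1 [|n].
  by rewrite big_geq// addr_ge0// invr_ge0 subr_ge0 ltW.
rewrite big_nat_recl//= powR1 lerD2l.
have := sum_powR_gt1 r1 n.+1 (ltn0Sn 0); rewrite powR1 mulr1.
by rewrite big_add1/=.
Qed.

End powers.

(** * The dimension of the line is at most 1 *)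

Section dimension_of_the_line.
Context {R : realType}.

Lemma nneseries_le_bound (u : nat -> \bar R) (M : \bar R) :
  (forall i, 0 <= u i)%E -> (forall n, \sum_(0 <= i < n) u i <= M)%E ->
  (\sum_(0 <= i <oo) u i <= M)%E.
Proof.
move=> u0 H; apply: lime_le; last exact: nearW.
by apply: is_cvg_ereal_nneg_natsum.
Qed.

(** The line is covered by consecutive intervals of lengths [c / (j + 1)]: their
   lengths have an infinite sum, but a finite one once raised to a power
   greater than 1. *)
Lemma hausdorff_dim_le1 (A : set R) : (hausdorff_dim A <= 1%:E)%E.
Proof.
apply/lee_addgt0Pr => e e0; rewrite -EFinD; set s := 1 + e.
have s1 : 1 < s by rewrite /s ltrDl.
have s0 : 0 < s by exact: lt_trans s1.
apply: hausdorff_dim_le; first exact: ltW.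
apply: hausdorff_measure_eq0 => // e' e'0.
pose K := 1 + (s - 1)^-1.
have K0 : 0 < K by rewrite addr_gt0// invr_gt0 subr_gt0.
have [c c0 cE] : exists2 c : R, 0 < c & (2 * c) `^ s = e' / K.
  exists ((e' / K) `^ s^-1 / 2); first by rewrite divr_gt0// powR_gt0// divr_gt0.
  rewrite mulrC divfK// -powRrM mulVf ?gt_eqF// powRr1// divr_ge0// ltW//.
pose L j := \sum_(0 <= i < j) c / i.+1%:R.
have LS j : L j.+1 = L j + c / j.+1%:R by rewrite /L big_nat_recr.
have L_unbounded x : exists m, x < L m.
  have := @dvg_harmonic R; rewrite /series/= => dv.
  apply: contrapT => /forallNP H; apply: dv; apply: nondecreasing_is_cvgn.
    apply/nondecreasing_seqP => n; rewrite big_nat_recr//= lerDl.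
    by rewrite invr_ge0.
  exists (x / c) => _ [n _ <-]; rewrite ler_pdivlMr//.
  have /negP := H n; rewrite -leNgt; apply: le_trans.
  by rewrite /L mulr_suml; apply: ler_sum => i _; rewrite mulrC.
have cell x : 0 <= x -> exists j, L j <= x <= L j.+1.
  move=> x0; have /ex_minnP[m xm minm] := L_unbounded x.
  case: m xm minm => [|m] xm minm.
    by move: xm; rewrite /L big_geq// ltNge x0.
  exists m; rewrite (ltW xm) andbT leNgt; apply/negP => /minm.
  by rewrite ltnn.
pose U j := if odd j then [set x | L j./2 <= - x <= L j./2.+1]
            else [set x | L j./2 <= x <= L j./2.+1].
have gU j : (gauge s (U j) <= ((2 * c) `^ s * j.+1%:R `^ (- s))%:E)%E.
  have -> : (2 * c) `^ s * j.+1%:R `^ (- s) = (2 * c / j.+1%:R) `^ s.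
    rewrite [RHS]powRM ?invr_ge0 ?mulr_ge0 ?(ltW c0)//.
    by congr (_ * _); rewrite -powR_inv1// -powRrM mulN1r.
  apply: gauge_le_powR; [exact: ltW|by rewrite divr_ge0// mulr_ge0// ltW|].
  have step : L j./2.+1 - L j./2 <= 2 * c / j.+1%:R.
    have jj : j.+1%:R <= 2 * j./2.+1%:R :> R.
      rewrite -natrM ler_nat -[in leqLHS](odd_double_half j) mul2n doubleS.
      by case: (odd j).
    rewrite LS addrAC subrr add0r ler_pdivrMr// mulrAC ler_pdivlMr//; nra.
  rewrite /U; case: ifP => _ x y /= /andP[a1 a2] /andP[b1 b2];
    apply: le_trans step; rewrite ler_norml; apply/andP; split; lra.
exists U.
  move=> x _; have [x0|x0] := leP 0 x.
    have [j Hj] := cell x x0; exists j.*2 => //.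
    by rewrite /U odd_double doubleK.
  have [|j Hj] := cell (- x); first by rewrite oppr_ge0 ltW.
  by exists j.*2.+1 => //; rewrite /U/= odd_double/= uphalf_double.
apply: nneseries_le_bound => [i|n]; first exact: gauge_ge0.
apply: (@le_trans _ _ (\sum_(0 <= i < n) ((2 * c) `^ s * i.+1%:R `^ (- s))%:E)%E).
  by apply: lee_sum.
rewrite sumEFin lee_fin -mulr_sumr cE -mulrA ler_piMr// ?(ltW e'0)//.
rewrite mulrC ler_pdivrMr// mul1r; exact: sum_powR_gt1_le.
Qed.

End dimension_of_the_line.

(** * A maximal inequality for Rademacher sums *)

Section rademacher.
Context {R : realType} (n : nat).
Implicit Types (c : 'I_n -> R) (A B : {set 'I_n}) (e : {ffun 'I_n -> bool}).

Definition rademacher_sum c A e : R := \sum_(i in A) (-1) ^+ e i * c i.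

Definition flip B e : {ffun 'I_n -> bool} := [ffun i => e i (+) (i \in B)].

Lemma flipK B : involutive (flip B).
Proof. by move=> e; apply/ffunP => i; rewrite !ffunE addbK. Qed.

Lemma sum_flip B (f : {ffun 'I_n -> bool} -> R) :
  \sum_e f (flip B e) = \sum_e f e.
Proof. by rewrite [RHS](reindex_inj (inv_inj (flipK B))). Qed.

Lemma rademacher_sum_flip c A B e :
  rademacher_sum c A (flip B e) =
  rademacher_sum c (A :\: B) e - rademacher_sum c (A :&: B) e.
Proof.
rewrite /rademacher_sum (big_setID B)/= addrC; congr (_ + _).
  by apply: eq_bigr => i; rewrite inE ffunE => /andP[/negbTE -> _]; rewrite addbF.
rewrite -sumrN; apply: eq_bigr => i; rewrite inE ffunE => /andP[_ ->].
by rewrite addbT signrN mulNr.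
Qed.

Lemma rademacher_sum_flip_disjoint c A B e : A :&: B = finset.set0 ->
  rademacher_sum c A (flip B e) = rademacher_sum c A e.
Proof.
move=> AB; rewrite rademacher_sum_flip.
have -> : A :\: B = A.
  by apply/finset.setDidPl; rewrite -finset.setI_eq0 AB.
by rewrite AB /rademacher_sum finset.big_set0 subr0.
Qed.

Lemma rademacher_sum_sub c A B e : A \subset B ->
  rademacher_sum c B e = rademacher_sum c A e + rademacher_sum c (B :\: A) e.
Proof.
by move=> AB; rewrite /rademacher_sum (big_setID A)/= (finset.setIidPr AB).
Qed.

Lemma card_signs : \sum_(e : {ffun 'I_n -> bool}) (1 : R) = 2 ^+ n.
Proof. by rewrite sumr_const card_ffun card_bool card_ord natrX. Qed.

(** Flipping the sign of one index cancels the cross terms that involve it. *)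
Lemma rademacher_second_moment c A :
  \sum_e rademacher_sum c A e ^+ 2 = 2 ^+ n * \sum_(i in A) c i ^+ 2.
Proof.
move: {2}#|A| (erefl #|A|) => m; elim: m A => [|m IH] A.
  move/cards0_eq => ->; rewrite finset.big_set0 mulr0 big1// => e _.
  by rewrite /rademacher_sum finset.big_set0 expr0n.
move=> cA; have /card_gt0P[i iA] : (0 < #|A|)%N by rewrite cA.
have cA' : #|A :\ i| = m by move: cA; rewrite (cardsD1 i) iA => -[].
have sE e : rademacher_sum c A e =
    rademacher_sum c (A :\ i) e + (-1) ^+ e i * c i.
  rewrite {1}/rademacher_sum (big_setD1 i)//= addrC; congr (_ + _).
have flip1 e : rademacher_sum c A (flip [set i]%SET e) =
    rademacher_sum c (A :\ i) e - (-1) ^+ e i * c i.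
  rewrite sE rademacher_sum_flip_disjoint; last first.
    by apply/eqP; rewrite finset.setI_eq0 disjoint_sym disjoints1 !inE eqxx.
  by rewrite ffunE inE eqxx addbT signrN mulNr.
have half : \sum_e rademacher_sum c A e ^+ 2 =
    \sum_e (rademacher_sum c (A :\ i) e ^+ 2 + c i ^+ 2).
  apply: (@mulfI _ 2); first by rewrite pnatr_eq0.
  rewrite mulr_natl mulr2n -{1}(sum_flip [set i]%SET) -big_split/=.
  rewrite mulr_sumr; apply: eq_bigr => e _; rewrite flip1 sE.
  have : ((-1) ^+ e i : R) ^+ 2 = 1 by rewrite sqrr_sign.
  set s := (-1) ^+ e i; move=> s2.
  transitivity (2 * (rademacher_sum c (A :\ i) e ^+ 2 + s ^+ 2 * c i ^+ 2)).
    ring.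
  by rewrite s2 mul1r.
rewrite half big_split/= IH// (big_setD1 i iA)/= mulrDr addrC; congr (_ + _).
by rewrite -card_signs mulr_suml; apply: eq_bigr => e _; rewrite mul1r.
Qed.

(** The Bellman function of Doob's maximal inequality: it dominates
   [m ^+ 2 - 4 * s ^+ 2], and does not increase on average when the current
   value [s] makes a symmetric step and the running maximum [m] is updated. *)
Definition bellman (s m : R) := 2 * m ^+ 2 - 4 * m * `|s|.

Lemma bellman_ge (s m : R) : m ^+ 2 - 4 * s ^+ 2 <= bellman s m.
Proof.
rewrite /bellman -(real_normK (num_real s)) -subr_ge0.
by rewrite (_ : _ - _ = (m - 2 * `|s|) ^+ 2) ?sqr_ge0//; ring.
Qed.

(** Updating the maximum from [m] to [`|x|] lowers the Bellman function by
   [2 * (`|x| - m) ^+ 2]; what is left is the convexity of the absolute value. *)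
Lemma bellman_step (s d m : R) : 0 <= m ->
  bellman (s + d) (Num.max m `|s + d|) + bellman (s - d) (Num.max m `|s - d|)
  <= 2 * bellman s m.
Proof.
move=> m0; have V (x : R) : bellman x (Num.max m `|x|) <= 2 * m ^+ 2 - 4 * m * `|x|.
  have [xm|mx] := leP `|x| m; first by [].
  by rewrite /bellman; have := sqr_ge0 (m - `|x|); nra.
apply: le_trans (lerD (V _) (V _)) _.
have : 2 * `|s| <= `|s + d| + `|s - d|.
  rewrite -[2](@ger0_norm R)// -normrM; apply: le_trans (ler_normD _ _).
  by rewrite addrACA subrr addr0 mulr_natl mulr2n.
rewrite /bellman; nra.
Qed.

Fixpoint running_max (f : nat -> R) k : R :=
  if k is k'.+1 then Num.max (running_max f k') `|f k| else `|f 0%N|.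

Lemma running_max_ge f k j : (j <= k)%N -> `|f j| <= running_max f k.
Proof.
elim: k => [|k IH]; first by rewrite leqn0 => /eqP ->.
rewrite leq_eqVlt => /predU1P[->/=|]; first by rewrite le_max lexx orbT.
by rewrite ltnS => /IH /= H; rewrite le_max H.
Qed.

Lemma running_max_ge0 f k : 0 <= running_max f k.
Proof. by apply: le_trans (running_max_ge f (leq0n k)). Qed.

Lemma eq_running_max f g k : (forall j, (j <= k)%N -> f j = g j) ->
  running_max f k = running_max g k.
Proof.
elim: k => [|k IH] H /=; first by rewrite H.
by rewrite IH ?H// => j jk; rewrite H// (leq_trans jk).
Qed.

(** Doob's inequality for the partial sums of a Rademacher series along an
   increasing family of index sets: flipping the signs of one increment is a
   symmetry that leaves the past unchanged. *)
Lemma rademacher_maximal c (A : nat -> {set 'I_n}) k :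
  (forall j, A j \subset A j.+1) ->
  \sum_e running_max (fun j => rademacher_sum c (A j) e) k ^+ 2 <=
  4 * (2 ^+ n * \sum_(i in A k) c i ^+ 2).
Proof.
move=> Aincr; have Amono j l : (j <= l)%N -> A j \subset A l.
  elim: l => [|l IH]; first by rewrite leqn0 => /eqP ->.
  rewrite leq_eqVlt => /predU1P[->//|]; rewrite ltnS => /IH H.
  exact: fintype.subset_trans H (Aincr l).
pose S e j := rademacher_sum c (A j) e.
suff: \sum_e bellman (S e k) (running_max (S e) k) <= 0.
  move=> H; rewrite -rademacher_second_moment mulr_sumr -subr_le0 -sumrB.
  apply: le_trans H.
  by apply: ler_sum => e _; exact: bellman_ge.
elim: k => [|k IH].
  apply: sumr_le0 => e _; rewrite /bellman/= -mulrA -expr2 -mulrBl.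
  by rewrite mulr_le0_ge0 ?sqr_ge0// subr_le0 ler_nat.
apply: le_trans IH; pose B := A k.+1 :\: A k.
have SE e : S e k.+1 = S e k + rademacher_sum c B e.
  exact: rademacher_sum_sub.
have past e j : (j <= k)%N -> S (flip B e) j = S e j.
  move=> jk; apply: rademacher_sum_flip_disjoint; apply/eqP.
  rewrite finset.setI_eq0; apply/pred0P => i /=; rewrite !inE.
  by apply/negP => /and3P[ij + _]; rewrite (fintype.subsetP (Amono _ _ jk)).
have SF e : S (flip B e) k.+1 = S e k - rademacher_sum c B e.
  rewrite SE past// rademacher_sum_flip finset.setDv finset.setIid.
  by rewrite {1}/rademacher_sum finset.big_set0 sub0r.
rewrite -(ler_pM2l (@ltr0Sn R 1)) mulr_natl mulr2n.
rewrite -{1}(sum_flip B) -big_split/= mulr_sumr; apply: ler_sum => e _.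
rewrite SF SE addrC (eq_running_max (past e)).
exact/bellman_step/running_max_ge0.
Qed.

End rademacher.

(** * Integration over independent signs *)

Section independence.
Context {R : realType} {d : measure_display} {Omega : measurableType d}.
Variable P : probability Omega R.

(** Both sides are integrals of the identity, against the law of [F * \1_A] and
   against [P A] times the law of [F]; by independence these two measures agree
   away from 0. *)
Lemma integral_indep_event (A : set Omega) (F : Omega -> R) :
  measurable A -> measurable_fun setT F -> (forall w, 0 <= F w) ->
  (forall B, measurable B -> P (A `&` F @^-1` B) = (P A * P (F @^-1` B))%E) ->
  (\int[P]_(w in A) (F w)%:E = P A * \int[P]_w (F w)%:E)%E.
Proof.
move=> mA mF F0 ind.
pose D : set R := `]0, +oo[%classic.
have mD : measurable D by exact: measurable_itv.
(* Away from 0 the law of a nonnegative function determines its integral. *)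
have law (H : Omega -> R) : measurable_fun setT H -> (forall w, 0 <= H w) ->
    (\int[P]_w (H w)%:E = \int[pushforward P H]_(y in D) y%:E)%E.
  move=> mH H0; rewrite ge0_integral_pushforward//; last first.
    by move=> y; rewrite inE /D/= in_itv/= andbT lee_fin => /ltW.
  rewrite [RHS]integral_mkcond; apply: eq_integral => w _.
  rewrite patchE; case: ifPn => // /negP; rewrite inE/= /D/= in_itv/= andbT.
  by move=> /negP; rewrite -leNgt => Hw; congr EFin; apply/eqP; rewrite eq_le Hw H0.
pose F1 w := F w * \1_A w.
have mF1 : measurable_fun setT F1.
  by apply: measurable_funM => //; exact: measurable_indic.
have F10 w : 0 <= F1 w by rewrite mulr_ge0.
have -> : (\int[P]_(w in A) (F w)%:E = \int[P]_w (F1 w)%:E)%E.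
  rewrite [LHS]integral_mkcond; apply: eq_integral => w _.
  rewrite patchE /F1 indicE; case: ifPn => [|] _; first by rewrite mulr1.
  by rewrite mulr0.
have PAfin : P A \is a fin_num by exact: fin_num_measure.
have pA0 : 0 <= fine (P A) by rewrite fine_ge0.
pose pA : {nonneg R} := NngNum pA0.
rewrite (law F1)// (law F)// -[in RHS](fineK PAfin).
rewrite -[(fine (P A))]/(pA%:num) -ge0_integral_mscale//; last first.
  by move=> y; rewrite /D/= in_itv/= andbT lee_fin => /ltW.
apply: eq_measure_integral => B mB BD; rewrite /pushforward.
transitivity (P A * P (F @^-1` B))%E; last by rewrite -[in LHS](fineK PAfin).
rewrite -ind//; congr (P _); apply/seteqP; split=> w /=.
  rewrite /F1 indicE => Bw.
  have := BD _ Bw; rewrite /D/= in_itv/= andbT.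
  case: (boolP (w \in A)) Bw => [wA|wA]; last by rewrite mulr0 ltxx.
  by rewrite mulr1 => ? _; split => //; rewrite inE in wA.
by move=> [Aw Bw]; rewrite /F1 indicE mem_set//= mulr1.
Qed.

Lemma sigma_gen_bigcap (X : nat -> Omega -> R) (s : seq nat) (B : nat -> set R) :
  (forall i, measurable (B i)) ->
  sigma_gen X (\bigcap_(i in [set` s]) (X i @^-1` B i)).
Proof.
move=> mB.
have mXB i : sigma_gen X (X i @^-1` B i).
  by apply: sub_sigma_algebra; exists i, (B i).
elim: s => [|i s IH].
  rewrite (_ : \bigcap_(i in _) _ = setT); last first.
    by apply/seteqP; split => // w _ i.
  exact: (@measurableT _ (g_sigma_algebraType [set A | exists i B, measurable B /\ A = X i @^-1` B])).
have -> : \bigcap_(j in [set` i :: s]) (X j @^-1` B j) =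
    (X i @^-1` B i) `&` \bigcap_(j in [set` s]) (X j @^-1` B j).
  apply/seteqP; split=> [w H|w [Hi Hs] j].
    split; first by apply: H; rewrite /= inE eqxx.
    by move=> j js; apply: H; rewrite /= inE (_ : j \in s) ?orbT.
  by rewrite /= inE => /predU1P[->//|]; exact: Hs.
exact: (@measurableI _ (g_sigma_algebraType [set A | exists i B, measurable B /\ A = X i @^-1` B]) _ _ (mXB i) IH).
Qed.

End independence.

Section sign_average.
Context {R : realType} {d : measure_display} {Omega : measurableType d}.
Variable P : probability Omega R.
Variable g : nat -> {RV P >-> R}.
Hypothesis g_signs : iid_signs P g.

Definition sign_event n (e : {ffun 'I_n -> bool}) : set Omega :=
  [set w | forall i : 'I_n, g i w = (-1) ^+ e i].

Let pattern n (e : {ffun 'I_n -> bool}) (i : nat) : set R :=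
  if insub i is Some j then [set (-1) ^+ e j] else setT.

Let measurable_pattern n (e : {ffun 'I_n -> bool}) i : measurable (pattern e i).
Proof. by rewrite /pattern; case: insubP. Qed.

Lemma sign_eventE n (e : {ffun 'I_n -> bool}) :
  sign_event e = \bigcap_(i in [set` iota 0 n]) (g i @^-1` pattern e i).
Proof.
apply/seteqP; split=> [w H i /=|w H i].
  by rewrite mem_iota /pattern/= => _; case: insubP => //= j _ <-; exact: H.
have /= := H i; rewrite mem_iota/= add0n ltn_ord => /(_ isT).
by rewrite /pattern; case: insubP => //= [j _ /val_inj ->//|]; rewrite ltn_ord.
Qed.

Lemma sign_event_sigma_gen n (e : {ffun 'I_n -> bool}) :
  sigma_gen g (sign_event e).
Proof. by rewrite sign_eventE; exact: sigma_gen_bigcap. Qed.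

Lemma measurable_sign_event n (e : {ffun 'I_n -> bool}) :
  measurable (sign_event e).
Proof.
have -> : sign_event e = \bigcap_(i in [set: 'I_n]) (g i @^-1` [set (-1) ^+ e i]).
  by apply/seteqP; split=> w H i; [move=> _; exact: H|exact: (H i I)].
by apply: fin_bigcap_measurable => // i _; exact: measurable_funPTI.
Qed.

Lemma prob_sign_event n (e : {ffun 'I_n -> bool}) :
  P (sign_event e) = ((2 ^+ n)^-1)%:E.
Proof.
case: g_signs => ind law.
rewrite sign_eventE (ind (iota 0 n) (pattern e)) ?iota_uniq//.
rewrite (eq_big_seq (fun=> (2^-1)%:E)) => [|i]; last first.
  rewrite mem_iota/= add0n /pattern => ni; case: insubP => //= [j _ ji|]; last by rewrite ni.
  have [l1 l2] := law i.
  by case: (e j); rewrite ?expr0 ?expr1.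
rewrite prodEFin; congr EFin.
by rewrite big_const_seq count_predT size_iota iter_mulr_1 exprVn.
Qed.

Lemma ae_sign : {ae P, forall w i, g i w = 1 \/ g i w = -1}.
Proof.
apply/ae_foralln => i; case: g_signs => ind law; have [l1 l2] := law i.
have m1 (a : R) : measurable (g i @^-1` [set a]).
  by rewrite -[_ @^-1` _]setTI; exact: measurable_funP.
exists (~` (g i @^-1` [set 1] `|` g i @^-1` [set -1])); split.
- by apply: measurableC; exact: measurableU.
- have mU := measurableU _ _ (m1 1) (m1 (-1)).
  apply: (eq_trans (probability_setC P mU)).
  have := measureU P (m1 1) (m1 (-1)) => ->; last first.
    apply/seteqP; split=> // w /= [-> /eqP]; rewrite -subr_eq0 opprK.
    by rewrite -(natrD _ 1 1) pnatr_eq0.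
  have half2 : 2^-1 + 2^-1 = 1 :> R by lra.
  apply: (@eq_trans _ _ (1%:E - 1%:E)%E); last by rewrite subee.
  rewrite (f_equal2 (fun x y => x + y)%E l1 l2); congr (1 - _)%E.
  by rewrite -EFinD half2.
- move=> w /= H1 [H2|H2]; apply: H1; [by left|by right].
Qed.

(** Averaging out independent signs: a function of the signs and of
   an independent sigma-algebra [H] may be integrated first over the signs. *)
Lemma integral_sign_average (H : set (set Omega)) n
    (F : {ffun 'I_n -> bool} -> Omega -> R) (f : Omega -> R) :
  independent_sigma P (sigma_gen g) H ->
  (forall e w, 0 <= F e w) -> (forall w, 0 <= f w) ->
  (forall e, measurable_fun setT (F e)) -> measurable_fun setT f ->
  (forall e B, measurable B -> H (F e @^-1` B)) ->
  (forall e w, sign_event e w -> f w = F e w) ->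
  (\int[P]_w (f w)%:E =
   ((2 ^+ n)^-1)%:E * \int[P]_w (\sum_e F e w)%:E)%E.
Proof.
move=> indep F0 f0 mF mf HF fF.
have mE e := @measurable_sign_event n e.
transitivity (\int[P]_w (\sum_e (F e w * \1_(sign_event e) w))%:E)%E.
  apply: ge0_ae_eq_integral => //.
  - exact/measurable_EFinP.
  - apply/measurable_EFinP; apply: measurable_sum => e.
    by apply: measurable_funM => //; exact: measurable_indic.
  - by move=> w _; rewrite lee_fin.
  - by move=> w _; rewrite lee_fin sumr_ge0// => e _; rewrite mulr_ge0.
  apply: filterS ae_sign => w Hw _; congr EFin.
  pose e0 := [ffun i : 'I_n => g i w != 1].
  have e0w : sign_event e0 w.
    move=> i; rewrite ffunE; case: (Hw i) => ->; first by rewrite eqxx.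
    by rewrite (_ : (-1 != 1) = true)// -subr_eq0 -opprD oppr_eq0 -(natrD _ 1 1) pnatr_eq0.
  rewrite (bigD1 e0)//= indicE mem_set// mulr1 (fF e0)// big1 ?addr0// => e ee0.
  rewrite indicE memNset ?mulr0// => ew; move/eqP: ee0; apply.
  apply/ffunP => i; have := ew i; rewrite (e0w i).
  case: (e i); case: (e0 i) => //; rewrite ?expr0 ?expr1 => /eqP; last rewrite eq_sym.
    by rewrite -subr_eq0 opprK -(natrD _ 1 1) pnatr_eq0.
  by rewrite -subr_eq0 opprK -(natrD _ 1 1) pnatr_eq0.
under eq_integral do rewrite -sumEFin.
rewrite ge0_integral_sum//; last 2 first.
- by move=> e; apply/measurable_EFinP; apply: measurable_funM => //; exact: measurable_indic.
- by move=> e w _; rewrite lee_fin mulr_ge0.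
under [in RHS]eq_integral do rewrite -sumEFin.
rewrite ge0_integral_sum//; last 2 first.
- by move=> e; exact/measurable_EFinP.
- by move=> e w _; rewrite lee_fin.
rewrite ge0_sume_distrr; last by move=> e _; apply: integral_ge0 => w _; rewrite lee_fin.
apply: eq_bigr => e _; rewrite -(prob_sign_event e).
rewrite -integral_indep_event//; last first.
  by move=> B mB; apply: indep; [exact: sign_event_sigma_gen|exact: HF].
rewrite [RHS]integral_mkcond; apply: eq_integral => w _.
by rewrite patchE indicE; case: ifPn => _; rewrite ?mulr1 ?mulr0.
Qed.

End sign_average.

(** * Linear growth of the Poisson points *)

Lemma measure_bigsetU_le {R : realType} {d : measure_display}
    {T : measurableType d} (mu : measure T R) (I : Type) (s : seq I)
    (Q : pred I) (F : I -> set T) : (forall i, measurable (F i)) ->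
  (mu (\big[setU/set0]_(i <- s | Q i) F i) <= \sum_(i <- s | Q i) mu (F i))%E.
Proof.
move=> mF; elim: s => [|i s IH]; first by rewrite !big_nil measure0.
rewrite !big_cons; case: ifP => // _.
apply: le_trans (leeD2l _ IH); apply: measureU2 => //.
exact: bigsetU_measurable.
Qed.

Section arrivals.
Context {R : realType} {d : measure_display} {Omega : measurableType d}.
Variable P : probability Omega R.
Variable G : nat -> {RV P >-> R}.
Hypothesis G_poisson : poisson_arrivals P G.

Let xi := interarrival G.

Lemma measurable_interarrival n : measurable_fun setT (interarrival G n).
Proof.
by case: n => [|n]; rewrite /interarrival//; apply: measurable_funB.
Qed.

Let mxi n (B : set R) : measurable B -> measurable (xi n @^-1` B).
Proof.
by move=> mB; rewrite -[_ @^-1` _]setTI; exact: measurable_interarrival.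
Qed.

Lemma arrival_sum n w : G n w = \sum_(j < n.+1) interarrival G j w.
Proof.
elim: n => [|n IH]; first by rewrite big_ord1.
by rewrite big_ord_recr/= -IH addrC subrK.
Qed.

Let P_xi n x : 0 < x -> P (xi n @^-1` `[0, x]%classic) = (1 - expR (- x))%:E.
Proof.
move=> x0; case: G_poisson => _ law; rewrite law//.
by rewrite exponential_prob_itv0c// mulN1r EFinB.
Qed.

Let P_xiC n x : 0 < x -> P (~` (xi n @^-1` `[0, x]%classic)) = (expR (- x))%:E.
Proof.
move=> x0; apply: (eq_trans (probability_setC P (mxi n (measurable_itv _)))).
apply: (eq_trans (congr1 (fun y => 1 - y)%E (P_xi n x0))).
by rewrite -EFinB opprB addrC subrK.
Qed.

(** Values that are not positive lie outside [[0, x]] for a large [x] or inside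
   [[0, x]] for a small [x]; both events have small probabilities. *)
Lemma ae_interarrival_gt0 : {ae P, forall w n, 0 < interarrival G n w}.
Proof.
apply/ae_foralln => n; pose N := xi n @^-1` `]-oo, 0]%classic.
have mN : measurable N by exact: mxi.
exists N; split => //; last first.
  by move=> w /=; rewrite /N/= in_itv/= => /negP; rewrite -leNgt.
apply/eqP; rewrite eq_le measure_ge0 andbT; apply/lee_addgt0Pr => e e0.
rewrite add0e; pose t := Num.min (e / 2) 2^-1.
have t0 : 0 < t by rewrite lt_min divr_gt0//=.
have te : t <= e / 2 by rewrite ge_min lexx.
have t2 : t <= 2^-1 by rewrite ge_min lexx orbT.
have x0 : 0 < - ln (1 - t) by rewrite oppr_gt0 ln_lt0//; apply/andP; split; lra.
have M0 : 0 < - ln t by rewrite oppr_gt0 ln_lt0//; apply/andP; split; lra.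
have sub : N `<=` ~` (xi n @^-1` `[0, - ln t]%classic)
    `|` (xi n @^-1` `[0, - ln (1 - t)]%classic).
  move=> w; rewrite /N/= !in_itv/= => wN.
  case: (leP 0 (xi n w)) => w0; [right|by left].
  by rewrite (le_trans wN)// ltW.
have m1 := measurableC (mxi n (measurable_itv `[0, - ln t])).
have m2 := mxi n (measurable_itv `[0, - ln (1 - t)]).
apply: (@le_trans _ _ ((expR (- - ln t))%:E + (1 - expR (- - ln (1 - t)))%:E)%E).
  rewrite -(P_xiC n M0) -(P_xi n x0); apply: le_trans (measureU2 P m1 m2).
  by apply: le_measure => //; rewrite inE//; exact: measurableU.
rewrite !opprK lnK ?posrE// lnK ?posrE; last by lra.
by rewrite -EFinD lee_fin; lra.
Qed.

Let I01 (b : bool) : set R := if b then `[0, 1]%classic else ~` `[0, 1]%classic.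
Let mI01 b : measurable (I01 b).
Proof. by case: b => /=; [exact: measurable_itv|apply: measurableC; exact: measurable_itv]. Qed.

Let a : R := expR (- 1).
Let prob (b : bool) : R := if b then 1 - a else a.
Let weight (b : bool) : R := if b then 1 else a.
Let r : R := (1 - a) + a * a.

Let P_I01 n b : P (xi n @^-1` I01 b) = (prob b)%:E.
Proof. by case: b; [exact: P_xi|exact: P_xiC]. Qed.

Let a01 : 0 < a < 1.
Proof. by rewrite expR_gt0 -expR0 ltr_expR ltrN10. Qed.

Let r01 : 0 < r < 1.
Proof. by rewrite /r; have /andP[? ?] := a01; apply/andP; split; nra. Qed.

Let c : R := - ln r / 2.
Let c0 : 0 < c.
Proof. by rewrite divr_gt0// oppr_gt0 ln_lt0. Qed.

(** The set [cell f] prescribes which of the first [n] interarrival times are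
   at most 1, and [early n] asks that fewer than [c * n] exceed 1. Here [a] is
   the probability of exceeding 1, and [r] is the mean of the weight, which is
   [a] on this event and 1 off it. *)
Let cell n (f : {ffun 'I_n -> bool}) : set Omega :=
  \bigcap_(i in [set` iota 0 n])
     (xi i @^-1` (if insub i is Some j then I01 (f j) else setT)).

Let measurable_cell n (f : {ffun 'I_n -> bool}) : measurable (cell f).
Proof.
apply: fin_bigcap_measurable; first exact: finite_seq.
by move=> i _; apply: mxi; case: insubP => // j _ _; exact: mI01.
Qed.

Let P_cell n (f : {ffun 'I_n -> bool}) :
  P (cell f) = (\prod_(j < n) prob (f j))%:E.
Proof.
case: G_poisson => ind _.
rewrite /cell (ind (iota 0 n)
  (fun i => if insub i is Some j then I01 (f j) else setT)) ?iota_uniq//.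
  have -> : iota 0 n = index_iota 0 n by rewrite /index_iota subn0.
  rewrite big_mkord -prodEFin.
  by apply: eq_bigr => i _; rewrite valK; exact: P_I01.
by move=> i; case: insubP => // j _ _; exact: mI01.
Qed.

Let few n (f : {ffun 'I_n -> bool}) := \sum_(j < n) (~~ f j)%:R < c * n%:R.

Let early n : set Omega := \big[setU/set0]_(f : {ffun 'I_n -> bool} | few f) cell f.

Let measurable_early n : measurable (early n).
Proof. by apply: bigsetU_measurable => f _. Qed.

(** The exponential Markov inequality, summed over the cells: on [early n] the
   product of the weights is at least [expR (- c * n)], while its mean is
   [r ^+ n = expR (- 2 * c * n)]. *)
Let P_early n : (P (early n) <= (expR (- c) ^+ n)%:E)%E.
Proof.
apply: (@le_trans _ _ (\sum_(f : {ffun 'I_n -> bool} | few f) P (cell f))%E).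
  exact: measure_bigsetU_le.
apply: (@le_trans _ _ (\sum_(f : {ffun 'I_n -> bool})
    (expR (c * n%:R) * \prod_(j < n) (weight (f j) * prob (f j)))%:E)%E).
  rewrite big_mkcond/=; apply: lee_sum => f _.
  have p0 (h : bool -> R) : (forall b, 0 <= h b) -> 0 <= \prod_(j < n) h (f j).
    by move=> h0; apply: prodr_ge0.
  have /andP[a0 a1] := a01.
  case: ifPn => fewf; last first.
    rewrite lee_fin mulr_ge0 ?expR_ge0// prodr_ge0// => j _.
    by case: (f j); rewrite /weight/prob mulr_ge0// ?subr_ge0// ltW.
  rewrite P_cell lee_fin big_split/= mulrA ler_peMl//.
    by rewrite prodr_ge0// => j _; case: (f j); rewrite /prob ?subr_ge0 ltW.
  (* the weight [a] is [expR (- 1)] *)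
  have -> : \prod_(j < n) weight (f j) = expR (- \sum_(j < n) (~~ f j)%:R).
    rewrite -sumrN expR_sum; apply: eq_bigr => j _.
    by case: (f j); rewrite /= ?oppr0 ?expR0.
  by rewrite -expRD -[leLHS]expR0 ler_expR subr_ge0 ltW.
rewrite sumEFin lee_fin -mulr_sumr.
rewrite -(bigA_distr_bigA (fun _ b => weight b * prob b)).
under eq_bigr do rewrite big_bool/= mul1r -/r.
rewrite prodr_const card_ord expRM_natr -exprMn.
have /andP[r0 r1] := r01.
apply: lerXn2r; rewrite ?nnegrE ?mulr_ge0 ?expR_ge0 ?(ltW r0)//.
by rewrite -[X in _ * X](@lnK _ r) ?posrE// -expRD ler_expR /c; lra.
Qed.

(** The points of a Poisson process have at least linear growth. Each of the
   independent interarrival times exceeds 1 with a fixed positive probability;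
   that a small proportion of the first [n] does so is exponentially unlikely. *)
Lemma ae_arrival_growth :
  {ae P, forall w, exists2 c, 0 < c <= 1 & forall i, c * i.+1%:R <= G i w}.
Proof.
have rho01 : 0 < expR (- c) < 1 by rewrite expR_gt0 -expR0 ltr_expR oppr_lt0.
have /andP[rho0 rho1] := rho01.
have BC : P (lim_sup_set early) = 0.
  apply: lim_sup_set_cvg0 => //.
  apply: (@le_lt_trans _ _ ((1 - expR (- c))^-1)%:E); last by rewrite ltry.
  apply: nneseries_le_bound => // n.
  apply: (@le_trans _ _ (\sum_(0 <= i < n) (expR (- c) ^+ i)%:E)%E).
    by apply: lee_sum => i _; exact: P_early.
  rewrite sumEFin lee_fin -[leRHS]mul1r ler_pdivlMr ?subr_gt0// mulrC.
  rewrite big_mkord -opprB mulNr -subrX1 opprB gerBl.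
  by rewrite exprn_ge0// ltW.
have mL : measurable (lim_sup_set early).
  by apply: bigcapT_measurable => n; apply: bigcup_measurable.
have aeL : {ae P, forall w, ~ lim_sup_set early w}.
  by exists (lim_sup_set early); split=> // w /= /contrapT.
move: aeL ae_interarrival_gt0; apply: filterS2 => w Lw xi0.
have {Lw} [N HN] : exists N, forall n, (N <= n)%N -> ~ early n w.
  apply: contrapT => /forallNP H; apply: Lw => n _.
  by have /existsNP[m /not_implyP[nm /contrapT]] := H n; exists m.
have late n : (N <= n)%N -> c * n%:R <= \sum_(j < n) xi j w.
  move=> Nn; rewrite leNgt; apply/negP => lt; apply: (HN n Nn).
  pose f := [ffun j : 'I_n => xi j w <= 1].
  have few_f : few f.
    apply: le_lt_trans lt; apply: ler_sum => j _; rewrite ffunE.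
    by case: (leP (xi j w) 1) => [_|/ltW]//=; exact/ltW/xi0.
  rewrite /early (bigD1 f)//=; left => i /=; rewrite mem_iota/= => ni.
  case: insubP => //= j _ ji; rewrite ffunE ji /I01.
  by case: ifPn => H; rewrite /= in_itv/= ltW ?(negbTE H) //; exact: xi0.
have G0 i : G 0%N w <= G i w.
  rewrite !arrival_sum big_ord1 big_ord_recl lerDl sumr_ge0// => j _.
  exact/ltW/xi0.
have G00 : 0 < G 0%N w by rewrite arrival_sum big_ord1; exact: xi0.
have N1 : (0 : R) < N.+1%:R by [].
exists (Num.min 1 (Num.min c (G 0%N w / N.+1%:R))).
  by rewrite !lt_min ltr01 c0 divr_gt0//= ge_min lexx.
move=> i; have [Ni|iN] := leqP N i.+1.
  rewrite (arrival_sum i w); apply: (le_trans _ (late _ Ni)).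
  by rewrite ler_wpM2r// !ge_min lexx orbT.
apply: le_trans (G0 i); apply: (@le_trans _ _ (G 0%N w / N.+1%:R * i.+1%:R)).
  by rewrite ler_wpM2r// !ge_min lexx !orbT.
by rewrite mulrAC ler_pdivrMr// ler_wpM2l ?(ltW G00)// ler_nat ltnW// ltnS ltnW.
Qed.

End arrivals.

(** * Right-continuity of the integral of an arbitrary function *)

Section lower_simple_functions.
Context {R : realType} {d : measure_display} {T : measurableType d}.
Variable mu : {measure set T -> \bar R}.
Import HBNNSimple.
Implicit Types (q : T -> \bar R) (D : set T) (h : {nnsfun T >-> R}).

Lemma nnsfun_le_integral q D h : (forall x, D x -> 0 <= q x)%E ->
  (forall x, (h x)%:E <= (q \_ D) x)%E ->
  (\int[mu]_x (h x)%:E <= \int[mu]_(x in D) q x)%E.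
Proof.
move=> q0 hq; rewrite integralT_nnsfun ge0_integralE//.
by apply: ereal_sup_ubound; exists h.
Qed.

Lemma nnsfun_integral_adherent q D : (forall x, D x -> 0 <= q x)%E ->
  (\int[mu]_(x in D) q x < +oo)%E -> forall e : R, 0 < e ->
  exists2 h : {nnsfun T >-> R}, (forall x, (h x)%:E <= (q \_ D) x)%E &
    (\int[mu]_(x in D) q x < \int[mu]_x (h x)%:E + e%:E)%E.
Proof.
move=> q0 qoo e e0.
have : (\int[mu]_(x in D) q x)%E \is a fin_num.
  by rewrite ge0_fin_numE// integral_ge0.
rewrite ge0_integralE// => fin.
have [_ [h hq <-] H] := ub_ereal_sup_adherent e0 fin.
by exists h => //; rewrite integralT_nnsfun -lteBlDr.
Qed.

Lemma nnsfun_integral_le_sup q D : (forall x, D x -> 0 <= q x)%E -> forall M : \bar R,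
  (forall h, (forall x, (h x)%:E <= (q \_ D) x)%E -> (\int[mu]_x (h x)%:E <= M)%E) ->
  (\int[mu]_(x in D) q x <= M)%E.
Proof.
move=> q0 M H; rewrite ge0_integralE//; apply: ge_ereal_sup => _ [h hq <-].
by rewrite -integralT_nnsfun; exact: H.
Qed.

End lower_simple_functions.

Section integral_of_arbitrary_function.
Context {R : realType}.
Local Notation mu := (@lebesgue_measure R).
Local Notation T := (measurableTypeR R).
Import HBNNSimple.
Implicit Types (q : T -> \bar R).

Lemma integral_itv_le q (s t : R) : (forall x, 0 <= q x)%E -> s <= t ->
  (\int[mu]_(x in `[0%R, s]) q x <= \int[mu]_(x in `[0%R, t]) q x)%E.
Proof.
move=> q0 st; apply: nnsfun_integral_le_sup => // h hq.
apply: nnsfun_le_integral => // x; apply: le_trans (hq x) _.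
rewrite !patchE; case: ifPn => [|_]; last by case: ifP.
by rewrite inE/= in_itv/= => /andP[x0 xs]; rewrite mem_set//= in_itv/= x0 (le_trans xs).
Qed.

(** The integral of a nonnegative function over [[0, r]] is right continuous in
   [r] as long as it is finite. Let [h] be a simple function below [q] whose
   integral is within [e / 2] of that of [q], and let [g] be any simple function
   below [q]. The function equal to [g] on [[t, r]] and to [h] elsewhere lies
   below [q] too; hence the integral of [g] over [[t, r]] exceeds that of [h],
   which is bounded, by at most [e / 2]. *)
Lemma right_continuous_integral q (t b : R) : (forall x, 0 <= q x)%E ->
  0 <= t < b -> (\int[mu]_(x in `[0%R, b]) q x < +oo)%E ->
  forall e : R, 0 < e -> exists2 del : R, 0 < del & forall r, t < r < t + del -> r <= b ->
  (\int[mu]_(x in `[0%R, r]) q x <= \int[mu]_(x in `[0%R, t]) q x + e%:E)%E.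
Proof.
move=> q0 /andP[t0 tb] qoo e e0; have e20 : 0 < e / 2 by rewrite divr_gt0.
have [h hq Hh] := nnsfun_integral_adherent (fun x _ => q0 x) qoo e20.
have [M M0 hM] : exists2 M : R, 0 < M & forall x, h x <= M.
  have [M [Mr hM]] := simple_bounded h.
  exists (`|M| + 1) => [|x]; first by rewrite ltr_wpDl.
  apply: le_trans (ler_norm _) _; apply: (hM (`|M| + 1)) => //.
  by rewrite (le_lt_trans (ler_norm _))// ltrDl.
exists (e / 2 / M); first by rewrite divr_gt0.
move=> r /andP[tr rd] rb; apply: nnsfun_integral_le_sup => // g gq.
pose A : set R := `]t, r]%classic; have mA : measurable A by exact: measurable_itv.
have mAc : measurable (~` A) by exact: measurableC.
have mfh (k : {nnsfun T >-> R}) D : measurable_fun D (EFin \o k).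
  by apply/measurable_EFinP; exact: measurable_funP.
have k0 (k : {nnsfun T >-> R}) x : (0 <= (k x)%:E)%E by rewrite lee_fin.
have split_A (k : {nnsfun T >-> R}) :
    (\int[mu]_x (k x)%:E = \int[mu]_(x in A) (k x)%:E + \int[mu]_(x in ~` A) (k x)%:E)%E.
  rewrite -(setUCr A) ge0_integral_setU//; first exact: mfh.
  by apply/disj_setPCl.
have proj (k : {nnsfun T >-> R}) D (mD : measurable D) :
    (\int[mu]_x (proj_nnsfun k mD x)%:E = \int[mu]_(x in D) (k x)%:E)%E.
  by rewrite integralT_nnsfun integral_nnsfun// mrestrict.
have mix : (\int[mu]_(x in A) (g x)%:E + \int[mu]_(x in ~` A) (h x)%:E <=
            \int[mu]_(x in `[0%R, b]) q x)%E.
  rewrite -(proj g A mA) -(proj h _ mAc) -ge0_integralD//; last 2 first.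
  - exact: mfh.
  - exact: mfh.
  rewrite (eq_integral (fun x => ((add_nnsfun (proj_nnsfun g mA) (proj_nnsfun h mAc)) x)%:E))//.
  apply: nnsfun_le_integral => // x /=.
  rewrite !mindicE in_setC; case: (boolP (x \in A)) => xA /=.
    rewrite mulr1 mulr0 addr0; apply: le_trans (gq x) _.
    rewrite !patchE; case: ifPn => [|_]; last by case: ifP.
    rewrite inE/= in_itv/= => /andP[x0 xr].
    by rewrite mem_set//= in_itv/= x0 (le_trans xr).
  by rewrite mulr0 mulr1 add0r.
have hAfin : (\int[mu]_(x in A) (h x)%:E <= (e / 2)%:E)%E.
  apply: (@le_trans _ _ (\int[mu]_(x in A) M%:E)%E).
    apply: ge0_le_integral => //; first exact: mfh.
    by move=> x _; rewrite lee_fin.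
  rewrite integral_cst//= lebesgue_measure_itv/= lte_fin tr -EFinB -EFinM lee_fin.
  by rewrite mulrC -ler_pdivlMr// lerBlDl ltW.
have hCfin : (\int[mu]_(x in ~` A) (h x)%:E)%E \is a fin_num.
  rewrite ge0_fin_numE ?integral_ge0//.
  apply: le_lt_trans qoo.
  apply: (@le_trans _ _ (\int[mu]_x (h x)%:E)%E); last exact: nnsfun_le_integral.
  by rewrite split_A leeDr// integral_ge0.
have gA : (\int[mu]_(x in A) (g x)%:E <= e%:E)%E.
  rewrite -(@leeD2rE _ (\int[mu]_(x in ~` A) (h x)%:E)%E)//.
  apply: le_trans mix _; apply: le_trans (ltW Hh) _.
  rewrite split_A addeAC leeD2r// [in leRHS](splitr e) EFinD.
  exact: leeD2r.
have gC : (\int[mu]_(x in ~` A) (g x)%:E <= \int[mu]_(x in `[0%R, t]) q x)%E.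
  rewrite -(proj g _ mAc); apply: nnsfun_le_integral => // x /=.
  rewrite mindicE in_setC; case: (boolP (x \in A)) => xA /=.
    by rewrite mulr0 patchE; case: ifP.
  rewrite mulr1; apply: le_trans (gq x) _; rewrite !patchE; case: ifPn => [|_]; last by case: ifP.
  rewrite inE/= in_itv/= => /andP[x0 xr].
  rewrite ifT// inE/= in_itv/= x0 leNgt; apply/negP => tx.
  by move/negP: xA; apply; rewrite inE/A/= in_itv/= tx.
by rewrite split_A addeC leeD.
Qed.

(** Once the positive or the negative part of [f] has an infinite integral, the
   integral of [f] is 0 by convention. This sets in at most once, at [tau]. *)
Lemma right_continuous_Rintegral (f : R -> R) :
  exists tau, forall t, 0 <= t < 1 -> t <> tau -> forall e, 0 < e ->
  exists2 del, 0 < del & forall r, t < r < t + del -> r <= 1 ->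
  `| (\int[mu]_(x in `[0%R, r]) f x)%R - (\int[mu]_(x in `[0%R, t]) f x)%R | <= e.
Proof.
pose fp x := ((EFin \o f) ^\+ x)%E; pose fn x := ((EFin \o f) ^\- x)%E.
have fp0 x : (0 <= fp x)%E by exact: funepos_ge0.
have fn0 x : (0 <= fn x)%E by exact: funeneg_ge0.
pose Np t := (\int[mu]_(x in `[0%R, t]) fp x)%E.
pose Nn t := (\int[mu]_(x in `[0%R, t]) fn x)%E.
have RE t : (\int[mu]_(x in `[0%R, t]) f x)%R = fine (Np t - Nn t)%E.
  by rewrite /Rintegral integralE.
have Np0 t : (0 <= Np t)%E by exact: integral_ge0.
have Nn0 t : (0 <= Nn t)%E by exact: integral_ge0.
pose S := [set t : R | t <= 1 /\ (Np t < +oo)%E /\ (Nn t < +oo)%E].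
have Sdown s t : s <= t -> S t -> S s.
  move=> st [t1 [tp tn]]; split; first exact: le_trans t1.
  split; [apply: le_lt_trans tp|apply: le_lt_trans tn]; exact: integral_itv_le.
have RE0 t : t <= 1 -> ~ S t -> (\int[mu]_(x in `[0%R, t]) f x)%R = 0.
  move=> t1 Tt; rewrite RE; move: (Np0 t) (Nn0 t) Tt; rewrite /S/=.
  case: (Np t) => [x||]//; case: (Nn t) => [y||]// _ _ H; exfalso; apply: H.
  by rewrite !ltry.
exists (sup S) => t /andP[t0 t1] tT e e0.
have [[b [tb Sb]]|noT] := pselect (exists b, t < b /\ S b); last first.
  have Tt : ~ S t.
    move=> Tt; apply: tT; apply/eqP; rewrite eq_le; apply/andP; split.
      by apply: ub_le_sup => //; exists 1 => x [].
    apply: ge_sup; first by exists t.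
    by move=> x Tx; rewrite leNgt; apply/negP => tx; apply: noT; exists x.
  exists 1 => // r /andP[tr _] r1; rewrite !RE0 ?subrr ?normr0 ?(ltW e0) ?(ltW t1)//.
  by move=> Tr; apply: Tt; apply: Sdown Tr; exact: ltW.
have [b1 [bp bn]] := Sb.
have tb01 : 0 <= t < b by rewrite t0.
have [d1 d10 H1] := right_continuous_integral fp0 tb01 bp e0.
have [d2 d20 H2] := right_continuous_integral fn0 tb01 bn e0.
exists (Num.min (b - t) (Num.min d1 d2)); first by rewrite !lt_min subr_gt0 tb d10.
move=> r /andP[tr]; rewrite -ltrBlDl !lt_min !ltrBlDl => /and3P[rb r1 r2] _.
rewrite addrC subrK in rb.
have {}H1 := H1 r; rewrite tr r1 in H1; have {H1} := H1 isT (ltW rb).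
have {}H2 := H2 r; rewrite tr r2 in H2; have {H2} := H2 isT (ltW rb).
have [_ [tp tn]] := Sdown _ _ (ltW tb) Sb.
have [_ [rp rn]] := Sdown _ _ (ltW rb) Sb.
have := integral_itv_le fp0 (ltW tr); have := integral_itv_le fn0 (ltW tr).
rewrite !RE; rewrite -/(Np r) -/(Np t) -/(Nn r) -/(Nn t).
move: tp tn rp rn (Np0 t) (Nn0 t) (Np0 r) (Nn0 r).
case: (Np t) => [x1||]//; case: (Nn t) => [x2||]//.
case: (Np r) => [x3||]//; case: (Nn r) => [x4||]//.
move=> _ _ _ _ _ _ _ _; rewrite -!EFinD !lee_fin /= => a1 a2 a3 a4.
by rewrite ler_norml; apply/andP; split; lra.
Qed.

End integral_of_arbitrary_function.

(** * Regularity of the stable constant *)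

Section elementary.
Context {R : realType}.
Implicit Types (a b x y t m : R).

Lemma expR_lip x y m : expR x <= m -> expR y <= m ->
  `|expR x - expR y| <= m * `|x - y|.
Proof.
wlog xy : x y / y <= x.
  move=> H; have [yx|/ltW xy] := leP y x; first exact: H.
  by move=> mx my; rewrite distrC (distrC x); exact: H.
move=> xm ym; rewrite !ger0_norm ?subr_ge0 ?ler_expR//.
apply: (@le_trans _ _ (expR x * (x - y))); last by rewrite ler_wpM2r ?subr_ge0.
have := expR_ge1Dx (y - x); have := expR_gt0 x.
have -> : expR y = expR x * expR (y - x) by rewrite -expRD addrC subrK.
nra.
Qed.

Lemma powR_expR x a : 0 < x -> x `^ a = expR (a * ln x).
Proof. by move=> x0; rewrite /powR gt_eqF. Qed.

(** Lipschitz dependence on the exponent, at the price of a logarithm. *)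
Lemma powRN_lip x a b m : 0 < x -> x `^ (- a) <= m -> x `^ (- b) <= m ->
  `|x `^ (- a) - x `^ (- b)| <= `|a - b| * `|ln x| * m.
Proof.
move=> x0; rewrite !powR_expR// => am bm; apply: le_trans (expR_lip am bm) _.
rewrite (_ : _ - _ = - ((a - b) * ln x)); last by ring.
by rewrite normrN normrM mulrC.
Qed.

Lemma ln_le_powR x t : 1 <= x -> 0 < t -> ln x <= x `^ t / t.
Proof.
move=> x1 t0; have x0 : 0 < x by exact: lt_le_trans x1.
rewrite ler_pdivlMr// mulrC -ln_powR.
by apply/ltW/ln_sublinear; rewrite powR_gt0.
Qed.

Lemma norm_ln_le_powRN x t : 0 < x <= 1 -> 0 < t -> `|ln x| <= x `^ (- t) / t.
Proof.
move=> /andP[x0 x1] t0; have x10 : 1 <= x^-1 by rewrite invf_ge1.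
rewrite ler0_norm ?ln_le0// -lnV ?posrE//.
rewrite -mulN1r powRrM powR_inv1 ?(ltW x0)//.
exact: ln_le_powR.
Qed.

Lemma powRN_le1_mono x a b : 0 < x <= 1 -> a <= b -> x `^ (- a) <= x `^ (- b).
Proof. by move=> x01 ab; apply: ger_powR; rewrite // lerN2. Qed.

Lemma powRN_ge1_mono x a b : 1 <= x -> a <= b -> x `^ (- b) <= x `^ (- a).
Proof. by move=> x1 ab; apply: ler_powR; rewrite // lerN2. Qed.

Lemma continuous_powR a x : 0 < x -> {for x, continuous (fun y : R => y `^ a)}.
Proof.
move=> x0; apply: differentiable_continuous; apply/derivable1_diffP.
by apply: derivable_powR; rewrite in_itv/= x0.
Qed.

Lemma derivable_LRcontinuous (f : R -> R) a b : a < b ->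
  (forall x, a <= x <= b -> derivable f x 1) -> derivable_oo_LRcontinuous f a b.
Proof.
move=> ab H; split.
- by move=> x; rewrite in_itv/= => /andP[ax xb]; apply: H; rewrite !ltW.
- apply: cvg_at_right_filter; apply: differentiable_continuous.
  by apply/derivable1_diffP; apply: H; rewrite lexx ltW.
- apply: cvg_at_left_filter; apply: differentiable_continuous.
  by apply/derivable1_diffP; apply: H; rewrite lexx ltW.
Qed.

Lemma within_continuous_itv (f : R -> R) a b :
  (forall x, a <= x <= b -> {for x, continuous f}) ->
  {within `[a, b], continuous f}.
Proof.
by move=> H; apply: continuous_in_subspaceT => x; rewrite inE/= in_itv/=; exact: H.
Qed.

Lemma norm_sin_le x : 0 <= x -> `|sin x| <= x.
Proof.
rewrite le_eqVlt => /predU1P[<-|x0]; first by rewrite sin0 normr0.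
have [c _] : exists2 c, c \in `]0, x[%R & sin x - sin 0 = cos c * (x - 0).
  apply: MVT => //.
  by apply: continuous_subspaceT; exact: continuous_sin.
rewrite sin0 !subr0 => ->; rewrite normrM (gtr0_norm x0).
by rewrite ler_piMl ?(ltW x0) ?cos_max.
Qed.

Lemma cos_le_cos1 x : 1 <= x <= 2 -> cos x <= cos 1 :> R.
Proof.
case/andP; rewrite le_eqVlt => /predU1P[<-//|x1 x2].
have [c] : exists2 c, c \in `]1, x[%R & cos x - cos 1 = (- sin c) * (x - 1).
  apply: MVT => //.
  by apply: continuous_subspaceT; exact: continuous_cos.
rewrite in_itv/= => /andP[c1 cx] cosE; rewrite -subr_le0 cosE mulNr oppr_le0.
rewrite mulr_ge0 ?subr_ge0 ?(ltW x1)// sin_ge0_pi//.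
rewrite (le_trans _ (ltW c1))//=; apply: le_trans (ltW cx) _.
exact: le_trans x2 (pi_ge2 _).
Qed.

Lemma cos1_lt1 : cos 1 < 1 :> R.
Proof.
rewrite lt_neqAle cos_le1 andbT; apply/eqP => c1.
have := @sin_gt0_pi R 1; rewrite ltr01 (lt_le_trans _ (pi_ge2 _)) ?ltr1n// => /(_ isT).
have := cos2Dsin2 (1 : R); rewrite c1 expr1n => /eqP.
by rewrite addrC eq_sym -subr_eq subrr eq_sym sqrf_eq0 => /eqP ->; rewrite ltxx.
Qed.

Lemma mulNV_diff a b x y : a != 0 -> b != 0 ->
  - a^-1 * x - - b^-1 * y = - a^-1 * (x - y) + y * (- a^-1 * - b^-1 * (a - b)).
Proof. by move=> a0 b0; field; rewrite a0 b0. Qed.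

Lemma telescoped_difference (Aa Ab Ta Tb c Ha Hb a b : R) :
  (Aa + (Ta - c + a * Ha)) - (Ab + (Tb - c + b * Hb)) - (Ta - Tb) =
  (Aa - Ab) + ((a - b) * Ha + b * (Ha - Hb)).
Proof. by ring. Qed.

End elementary.

Section power_integrals.
Context {R : realType}.
Local Notation mu := (@lebesgue_measure R).
Local Notation T := (measurableTypeR R).

Lemma integral_powRN_itv (r e b : R) : r != 1 -> 0 < e < b ->
  (\int[mu]_(x in `[e, b]) (x `^ (- r))%:E =
   (b `^ (1 - r) / (1 - r) - e `^ (1 - r) / (1 - r))%:E)%E.
Proof.
move=> r1 /andP[e0 eb].
have r10 : 1 - r != 0 by rewrite subr_eq0 eq_sym.
have D (x : R) : 0 < x -> is_derive x (1 : R) (fun x : R => x `^ (1 - r) / (1 - r)) (x `^ (- r)).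
  move=> x0; have := @is_derive1_powR R (1 - r) x x0; rewrite addrAC subrr add0r => H.
  have -> : (fun x : R => x `^ (1 - r) / (1 - r)) =
      (1 - r)^-1 \*: (fun x : R => x `^ (1 - r)).
    by apply/funext => y; rewrite /= mulrC.
  apply: (is_derive_eq (is_deriveZ _ H)).
  by rewrite /GRing.scale/= mulrA mulVf// mul1r.
rewrite (@continuous_FTC2 _ _ (fun x : R => x `^ (1 - r) / (1 - r)))//.
- apply: within_continuous_itv => x /andP[ex _]; apply: continuous_powR.
  exact: lt_le_trans ex.
- apply: derivable_LRcontinuous => // x /andP[ex _].
  have x0 : 0 < x by exact: lt_le_trans ex.
  by have [] := D x x0.
- move=> x; rewrite in_itv/= => /andP[ex _]; rewrite derive1E.
  by have [_ ->] := D x (lt_trans e0 ex).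
Qed.

Lemma measurable_powRN (r : R) (D : set T) :
  measurable_fun D (fun x : T => x `^ (- r)).
Proof. by apply: measurable_funS (measurable_powR (- r)). Qed.

Lemma integrable_powRN_01 (r : R) : 0 < r < 1 ->
  mu.-integrable `[0%R, 1%R] (fun x => (x `^ (- r))%:E).
Proof.
move=> /andP[r0 r1]; apply/integrableP; split.
  by apply/measurable_EFinP; exact: measurable_powRN.
under eq_integral do rewrite gee0_abs ?lee_fin ?powR_ge0//.
rewrite -integral_itv_obnd_cbnd; last first.
  by apply/measurable_EFinP; exact: measurable_powRN.
pose F n : set T := `[n.+2%:R^-1, 1]%classic.
have -> : `]0, 1]%classic = \bigcup_n F n.
  apply/seteqP; split=> [x|x [n _]]; rewrite /F/= !in_itv/=.
    move=> /andP[x0 x1]; exists (Num.truncn x^-1) => //; rewrite /F/= in_itv/= x1 andbT.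
    rewrite -[leRHS]invrK lef_pV2 ?posrE ?invr_gt0//.
    apply: le_trans (ltW (truncnS_gt _)) _; rewrite ler_nat//.
  by move=> /andP[nx ->]; rewrite andbT (lt_le_trans _ nx)// invr_gt0.
have FI n : (\int[mu]_(x in F n) (x `^ (- r))%:E <= (1 - r)^-1%:E)%E.
  rewrite /F integral_powRN_itv ?lt_eqF//; last first.
    by rewrite invr_gt0 ltr0n/= invf_lt1// ltr1n.
  by rewrite lee_fin powR1 mul1r gerBl divr_ge0 ?powR_ge0// subr_ge0 ltW.
have cvgF : (\int[mu]_(x in F i) (x `^ (- r))%:E @[i --> \oo] -->
    \int[mu]_(x in \bigcup_i F i) (x `^ (- r))%:E)%E.
  apply: ge0_nondecreasing_set_cvg_integral => //.
  - move=> m n mn; rewrite subsetEset => x; rewrite /F/= !in_itv/= => /andP[mx ->].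
    by rewrite andbT (le_trans _ mx)// lef_pV2 ?posrE// ler_nat.
  - by move=> n; exact: measurable_itv.
  - by move=> n; apply/measurable_EFinP; exact: measurable_powRN.
  - by move=> n x _; rewrite lee_fin powR_ge0.
apply: (@le_lt_trans _ _ (1 - r)^-1%:E); last by rewrite ltry.
rewrite -(cvg_lim _ cvgF)//; apply: lime_le; first by apply: cvgP cvgF.
exact: nearW.
Qed.

Lemma integrable_continuous_itv (f : R -> R) (a b : R) :
  (forall x, a <= x <= b -> {for x, continuous f}) ->
  mu.-integrable `[a, b] (fun x => (f x)%:E).
Proof.
move=> H; apply: continuous_compact_integrable; first exact: segment_compact.
exact: within_continuous_itv.
Qed.

Lemma Rintegral_powRN_1M (r M : R) : 1 < r -> 1 < M ->
  (\int[mu]_(x in `[1%R, M]) (x `^ (- r)) <= (r - 1)^-1)%R.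
Proof.
move=> r1 M1; rewrite /Rintegral integral_powRN_itv ?gt_eqF ?ltr01//=.
rewrite powR1 -mulrBl -[leLHS]opprK -mulNr -[X in _ / X]opprB invrN mulrN opprK.
rewrite opprB ler_piMl ?invr_ge0 ?subr_ge0 ?(ltW r1)// gerBl.
exact: powR_ge0.
Qed.

End power_integrals.

Section stable_constant.
Context {R : realType}.
Local Notation mu := (@lebesgue_measure R).
Local Notation T := (measurableTypeR R).
Variables lo hi : R.
Hypothesis lo0 : 0 < lo.
Hypothesis lohi : lo <= hi.
Hypothesis hi2 : hi < 2.

Let f (a x : R) : R := x `^ (- a) * sin x.
Let h (a x : R) : R := x `^ (- (a + 1)) * (1 - cos x).

Let Rintegral_le (D : set T) (u v : T -> R) : measurable D ->
  mu.-integrable D (EFin \o u) -> mu.-integrable D (EFin \o v) ->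
  (forall x, D x -> `|u x| <= v x) ->
  `|\int[mu]_(x in D) u x| <= \int[mu]_(x in D) v x.
Proof.
move=> mD iu iv uv; apply: le_trans (le_normr_Rintegral mD iu) _.
by apply: le_Rintegral => //; exact: integrable_norm.
Qed.

Let integrableB_EFin (D : set T) (u v : T -> R) : measurable D ->
  mu.-integrable D (EFin \o u) -> mu.-integrable D (EFin \o v) ->
  mu.-integrable D (EFin \o (fun x => u x - v x)).
Proof.
move=> mD iu iv; exact: eq_integrable (integrableB mD iu iv).
Qed.

Let integrableZl_EFin (D : set T) (k : R) (u : T -> R) : measurable D ->
  mu.-integrable D (EFin \o u) -> mu.-integrable D (EFin \o (fun x => k * u x)).
Proof. by move=> mD iu; apply: eq_integrable (integrableZl mD k iu). Qed.

Let measurable_f a (D : set T) : measurable_fun D (f a).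
Proof.
apply: measurable_funM; first exact: measurable_powRN.
apply: measurable_funS (_ : measurable_fun setT sin) => //.
by apply: continuous_measurable_fun; exact: continuous_sin.
Qed.

Let hi2_itv : 0 < hi / 2 < 1.
Proof.
have := hi2; have := lt_le_trans lo0 lohi => h0 h2.
by apply/andP; split; lra.
Qed.

(** Near 0 the integrand is at most [x `^ (1 - a)], and [1 - a >= - (hi / 2)]. *)
Let f_bound a x : lo <= a <= hi -> 0 <= x <= 1 -> `|f a x| <= x `^ (- (hi / 2)).
Proof.
move=> /andP[la ah] /andP[]; rewrite le_eqVlt => /predU1P[<-|x0] x1.
  by rewrite /f sin0 mulr0 normr0 powR_ge0.
have x01 : 0 < x <= 1 by rewrite x0.
rewrite /f normrM ger0_norm ?powR_ge0//.
apply: (@le_trans _ _ (x `^ (- a) * x)).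
  by rewrite ler_wpM2l ?powR_ge0// norm_sin_le// ltW.
rewrite -{2}(powRr1 (ltW x0)) -powRD ?(gt_eqF x0) ?implybT//.
by have := hi2 => h2; apply: ger_powR => //; lra.
Qed.

Let integrable_f01 a : lo <= a <= hi -> mu.-integrable `[0%R, 1%R] (EFin \o f a).
Proof.
move=> ha; apply: le_integrable (integrable_powRN_01 hi2_itv) => //.
  by apply/measurable_EFinP; exact: measurable_f.
move=> x; rewrite /= in_itv/= => x01; rewrite lee_fin.
by rewrite (ger0_norm (powR_ge0 _ _)); exact: f_bound.
Qed.

Let continuous_f a x : 0 < x -> {for x, continuous (f a)}.
Proof.
by move=> x0; apply: continuousM; [exact: continuous_powR|exact: continuous_sin].
Qed.

Let continuous_h a x : 0 < x -> {for x, continuous (h a)}.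
Proof.
move=> x0; apply: continuousM; first exact: continuous_powR.
by apply: continuousB; [exact: cst_continuous|exact: continuous_cos].
Qed.

Let ge1_gt0 (x M : R) : 1 <= x <= M -> 0 < x.
Proof. by move=> /andP[x1 _]; exact: lt_le_trans x1. Qed.

Let integrable_h1M a M : mu.-integrable `[1%R, M] (EFin \o h a).
Proof. by apply: integrable_continuous_itv => x /ge1_gt0; exact: continuous_h. Qed.

Let integrable_f1M a M : mu.-integrable `[1%R, M] (EFin \o f a).
Proof. by apply: integrable_continuous_itv => x /ge1_gt0; exact: continuous_f. Qed.

Let A a := \int[mu]_(x in `[0%R, 1%R]) f a x.
Let H a M := \int[mu]_(x in `[1%R, M]) h a x.

(** The primitive [1 - cos] of [sin], rather than [- cos], keeps [h] nonnegative. *)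
Let parts a M : 1 < M ->
  \int[mu]_(x in `[1%R, M]) f a x =
  M `^ (- a) * (1 - cos M) - (1 - cos 1) + a * H a M.
Proof.
move=> M1.
rewrite (@Rintegration_by_parts R (fun x => x `^ (- a)) (fun x => 1 - cos x)
  (fun x => - a * x `^ (- a - 1)) sin 1 M)//; last 6 first.
- apply: within_continuous_itv => x /ge1_gt0 x0.
  by apply: continuousM; [exact: cst_continuous|exact: continuous_powR].
- apply: derivable_LRcontinuous => // x /ge1_gt0 x0.
  by apply: derivable_powR; rewrite in_itv/= x0.
- move=> x; rewrite in_itv/= => /andP[x1 _].
  by rewrite powR_derive1// in_itv/= andbT (lt_trans _ x1).
- by apply: within_continuous_itv => x _; exact: continuous_sin.
- exact: derivable_LRcontinuous.
- move=> x _; rewrite derive1E deriveB//.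
  by rewrite derive_cst derive_val sub0r opprK.
rewrite powR1 mul1r; congr (_ + _).
rewrite /H -RintegralZl//.
rewrite -[LHS]mulN1r -RintegralZl//; last first.
  apply: integrable_continuous_itv => x /ge1_gt0 x0.
  apply: continuousM; last by apply: continuousB; [exact: cst_continuous|exact: continuous_cos].
  by apply: continuousM; [exact: cst_continuous|exact: continuous_powR].
by apply: eq_Rintegral => x _; rewrite /h opprD; ring.
Qed.

Let h_ge0 a x : 0 <= h a x.
Proof. by rewrite mulr_ge0 ?powR_ge0// subr_ge0 cos_le1. Qed.

Let cos_le2 x : 1 - cos x <= 2 :> R.
Proof. by have := cos_geN1 x; lra. Qed.

Let itv1M_split a M N : 1 < M -> M <= N ->
  H a N = H a M + \int[mu]_(x in `]M, N]) h a x.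
Proof.
move=> M1 MN; rewrite /H -(@Rintegral_itvB R (h a) (BLeft 1) (BRight N) M)//; last first.
  by rewrite bnd_simp ltW.
by rewrite addrC subrK.
Qed.

Let H_mono a M N : 1 < M -> M <= N -> H a M <= H a N.
Proof.
move=> M1 MN; rewrite (itv1M_split a M1 MN) lerDl.
by apply: Rintegral_ge0 => x _; exact: h_ge0.
Qed.

Let H_ub a M : lo <= a <= hi -> 1 < M -> H a M <= 2 / lo.
Proof.
move=> /andP[la _] M1; apply: (@le_trans _ _ (\int[mu]_(x in `[1%R, M]) (2 * x `^ (- (lo + 1))))).
  apply: le_Rintegral => //.
    apply: integrable_continuous_itv => x /ge1_gt0 x0.
    by apply: continuousM; [exact: cst_continuous|exact: continuous_powR].
  move=> x; rewrite /= in_itv/= => /andP[x1 _]; rewrite /h mulrC.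
  by rewrite ler_pM ?powR_ge0 ?subr_ge0 ?cos_le1// powRN_ge1_mono// lerD2r.
rewrite RintegralZl//; last first.
  by apply: integrable_continuous_itv => x /ge1_gt0 x0; exact: continuous_powR.
rewrite ler_wpM2l//; apply: le_trans (Rintegral_powRN_1M _ M1) _.
  by rewrite ltrDr.
by rewrite addrK.
Qed.

Let c1 := 2 `^ (- (hi + 1)) * (1 - cos 1).

Let c1_gt0 : 0 < c1.
Proof. by rewrite mulr_gt0 ?powR_gt0// subr_gt0 cos1_lt1. Qed.

Let H_lb a M : lo <= a <= hi -> 2 <= M -> c1 <= H a M.
Proof.
move=> /andP[_ ah] M2; apply: le_trans (H_mono a _ M2) => //; last by rewrite ltr1n.
apply: (@le_trans _ _ (\int[mu]_(x in `[1%R, 2%R]) c1)).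
  rewrite Rintegral_cst//= lebesgue_measure_itv/= lte_fin ltr1n -EFinB/=.
  by rewrite (_ : 2 - 1 = 1) ?mulr1//; lra.
apply: le_Rintegral => //.
  by apply: integrable_continuous_itv => x _; exact: cst_continuous.
move=> x; rewrite /= in_itv/= => x12; have /andP[x1 x2] := x12.
rewrite /c1 /h ler_pM ?powR_ge0 ?subr_ge0 ?cos_le1//.
  apply: (@le_trans _ _ (x `^ (- (hi + 1)))).
    rewrite !powRN lef_pV2 ?posrE ?powR_gt0 ?(lt_le_trans _ x1)//.
    by apply: ge0_ler_powR; rewrite ?nnegrE ?(le_trans _ x1) ?addr_ge0// ltW// (lt_le_trans lo0).
  by rewrite powRN_ge1_mono// lerD2r.
by rewrite lerD2l lerN2 cos_le_cos1.
Qed.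

Let A_lb a : lo <= a <= hi -> 1 - cos 1 <= A a.
Proof.
move=> ha; have sinE : \int[mu]_(x in `[0%R, 1%R]) sin x = 1 - cos 1.
  rewrite /Rintegral (@continuous_FTC2 _ _ (fun x => - cos x))//=.
  - by rewrite cos0 opprK addrC.
  - by apply: continuous_subspaceT; exact: continuous_sin.
  - exact: derivable_LRcontinuous.
  - move=> x _; rewrite derive1E deriveN//.
    by rewrite derive_val opprK.
rewrite -sinE; apply: le_Rintegral => //; last 2 first.
- exact: integrable_f01.
- move=> x; rewrite /= in_itv/= => /andP[]; rewrite le_eqVlt => /predU1P[<- _|x0 x1].
    by rewrite /f sin0 mulr0.
  rewrite /f ler_peMl//.
    rewrite sin_ge0_pi// (ltW x0)/= (le_trans x1)// (le_trans _ (pi_ge2 _))//.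
    by rewrite ler1n.
  rewrite -(powRr0 x); apply: ger_powR; rewrite ?x0//.
  by rewrite oppr_le0; case/andP: ha => la _; rewrite (le_trans _ la)// ltW.
by apply: integrable_continuous_itv => x _; exact: continuous_sin.
Qed.

Let diff_bound01 a b x : lo <= a <= hi -> lo <= b <= hi -> 0 <= x <= 1 ->
  `|f a x - f b x| <= `|a - b| / (1 - hi / 2) * x `^ (- (hi / 2)).
Proof.
move=> ha hb /andP[x0 x1]; have /andP[_ h1] := hi2_itv.
have t0 : 0 < 1 - hi / 2 by rewrite subr_gt0.
move: x0; rewrite le_eqVlt => /predU1P[<-|x0].
  by rewrite /f sin0 !mulr0 subrr normr0 mulr_ge0 ?powR_ge0// divr_ge0// ltW.
have x01 : 0 < x <= 1 by rewrite x0.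
have [/andP[_ ah] /andP[_ bh]] := (ha, hb).
have := powRN_lip x0 (powRN_le1_mono x01 ah) (powRN_le1_mono x01 bh).
have := norm_ln_le_powRN x01 t0; have := norm_sin_le (ltW x0).
rewrite /f -mulrBl normrM => sx lx px.
have pE : x `^ (- (hi / 2)) = x `^ (- (1 - hi / 2)) * x `^ (- hi) * x.
  rewrite -[X in _ * _ * X](powRr1 (ltW x0)) -!powRD ?(gt_eqF x0) ?implybT//.
  by congr (_ `^ _); lra.
rewrite pE; apply: le_trans (ler_pM _ _ px sx) _ => //.
rewrite mulrA ler_wpM2r ?(ltW x0)// mulrA ler_wpM2r ?powR_ge0//.
by rewrite -mulrA ler_wpM2l// mulrC.
Qed.

Let K1 := (1 - hi / 2)^-1 * \int[mu]_(x in `[0%R, 1%R]) (x `^ (- (hi / 2))).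

Let A_lip a b : lo <= a <= hi -> lo <= b <= hi -> `|A a - A b| <= K1 * `|a - b|.
Proof.
move=> ha hb; rewrite /A -RintegralB//; last 2 first.
- exact: integrable_f01.
- exact: integrable_f01.
apply: le_trans (Rintegral_le _ _ _ (fun x xD => _ : _ <=
    `|a - b| / (1 - hi / 2) * x `^ (- (hi / 2)))) _ => //.
- by apply: integrableB_EFin => //; exact: integrable_f01.
- by apply: integrableZl_EFin => //; exact: integrable_powRN_01.
- by move=> x; rewrite /= in_itv/= => x01; exact: diff_bound01.
rewrite RintegralZl//; last exact: integrable_powRN_01.
by rewrite [leLHS](_ : _ = K1 * `|a - b|)// /K1; ring.
Qed.

(** The factor [ln x] is absorbed by the power [x `^ (lo / 2)]. *)
Let diff_bound1M a b x : lo <= a <= hi -> lo <= b <= hi -> 1 <= x ->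
  `|h a x - h b x| <= `|a - b| * (4 / lo) * x `^ (- (lo / 2 + 1)).
Proof.
move=> /andP[la _] /andP[lb _] x1; have x0 : 0 < x by exact: lt_le_trans x1.
have a1 : lo + 1 <= a + 1 by rewrite lerD2r.
have b1 : lo + 1 <= b + 1 by rewrite lerD2r.
have := powRN_lip x0 (powRN_ge1_mono x1 a1) (powRN_ge1_mono x1 b1).
have l2 : 0 < lo / 2 by rewrite divr_gt0.
have := ln_le_powR x1 l2; have cx := cos_le2 x.
have c0 : 0 <= 1 - cos x by rewrite subr_ge0 cos_le1.
rewrite /h -mulrBl normrM (ger0_norm c0) (@ger0_norm _ (ln x)) ?ln_ge0//.
rewrite (_ : a + 1 - (b + 1) = a - b); last by ring.
move=> lx px; apply: le_trans (ler_pM _ c0 px cx) _ => //.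
have pE : x `^ (- (lo / 2 + 1)) = x `^ (lo / 2) * x `^ (- (lo + 1)).
  rewrite -!powRD ?(gt_eqF x0) ?implybT//; congr (_ `^ _); lra.
rewrite pE [leRHS](_ : _ = `|a - b| * (x `^ (lo / 2) / (lo / 2)) * x `^ (- (lo + 1)) * 2).
  by rewrite ler_wpM2r// ler_wpM2r ?powR_ge0// ler_wpM2l.
by field; rewrite gt_eqF.
Qed.

Let K2 := (4 / lo) * (lo / 2)^-1.

Let H_lip a b M : lo <= a <= hi -> lo <= b <= hi -> 1 < M ->
  `|H a M - H b M| <= K2 * `|a - b|.
Proof.
move=> ha hb M1; rewrite /H -RintegralB//.
have ip : mu.-integrable `[1%R, M] (fun x => (x `^ (- (lo / 2 + 1)))%:E).
  by apply: integrable_continuous_itv => x /ge1_gt0 x0; exact: continuous_powR.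
apply: le_trans (Rintegral_le _ _ _ (fun x xD => _ : _ <=
    `|a - b| * (4 / lo) * x `^ (- (lo / 2 + 1)))) _ => //.
- exact: integrableB_EFin.
- exact: integrableZl_EFin.
- by move=> x; rewrite /= in_itv/= => /andP[x1 _]; exact: diff_bound1M.
rewrite RintegralZl//.
have l2 : 1 < lo / 2 + 1 by rewrite ltrDr divr_gt0.
have I := Rintegral_powRN_1M l2 M1; rewrite addrK in I.
apply: (@le_trans _ _ (`|a - b| * (4 / lo) * (lo / 2)^-1)).
  by rewrite ler_wpM2l// mulr_ge0// divr_ge0// ltW.
by rewrite [leLHS](_ : _ = K2 * `|a - b|)// /K2; ring.
Qed.

Let J a M := \int[mu]_(x in `[0%R, M]) f a x.

Let JE a M : lo <= a <= hi -> 1 < M ->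
  J a M = A a + (M `^ (- a) * (1 - cos M) - (1 - cos 1) + a * H a M).
Proof.
move=> ha M1; rewrite -parts// /J /A.
have if1M' : mu.-integrable `]1%R, M] (EFin \o f a).
  apply: integrableS (integrable_f1M a M) => //.
  by apply: subset_itvr; rewrite bnd_simp.
have itvE : `[0%R, M]%classic = `[0%R, 1%R] `|` `]1%R, M] :> set R.
  by rewrite -itv_bndbnd_setU// bnd_simp ltW.
have if0M : mu.-integrable `[0%R, M] (EFin \o f a).
  apply/integrableP; split.
    by apply/measurable_EFinP; exact: measurable_f.
  rewrite itvE ge0_integral_setU//=; last first.
  - by apply/disj_setPRL => x; rewrite /= !in_itv/= => /andP[x1 _] /andP[_]; rewrite leNgt x1.
  - by apply/measurable_EFinP; apply: measurableT_comp => //; exact: measurable_f.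
  have /integrableP[_ i1] := integrable_f01 ha.
  have /integrableP[_ i2] := if1M'.
  exact: lte_add_pinfty.
apply/eqP; rewrite addrC -subr_eq; apply/eqP.
rewrite (@Rintegral_itvB R (f a) (BLeft 0) (BRight M) 1) ?bnd_simp ?(ltW M1)//.
by rewrite Rintegral_itv_obnd_cbnd.
Qed.

Let J_lb a M : lo <= a <= hi -> 2 <= M -> lo * c1 <= J a M.
Proof.
move=> ha M2; have M1 : 1 < M by rewrite (lt_le_trans _ M2)// ltr1n.
rewrite JE//; have := A_lb ha; have := H_lb ha M2.
have T0 : 0 <= M `^ (- a) * (1 - cos M) by rewrite mulr_ge0 ?powR_ge0 ?subr_ge0 ?cos_le1.
have /andP[la _] := ha; have := lo0; have := c1_gt0; nra.
Qed.

Let powRN_small a : lo <= a <= hi ->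
  M `^ (- a) * (1 - cos M) @[M --> +oo] --> (0 : R).
Proof.
move=> /andP[la _]; have a0 : 0 < a by exact: lt_le_trans la.
apply/cvgrPdist_le => e e0; near=> M.
have M0 : 0 < M by near: M; exact: nbhs_pinfty_gt.
have e20 : 0 < e / 2 by rewrite divr_gt0.
rewrite sub0r normrN ger0_norm; last by rewrite mulr_ge0 ?powR_ge0// subr_ge0 cos_le1.
apply: (@le_trans _ _ (e / 2 * 2)); last by rewrite divfK.
apply: ler_pM; rewrite ?powR_ge0 ?subr_ge0 ?cos_le1 ?cos_le2//.
pose c := (e / 2) `^ (- a^-1); have c0 : 0 < c by exact: powR_gt0.
have -> : e / 2 = c `^ (- a).
  by rewrite -powRrM mulrNN mulVf ?gt_eqF// powRr1// ltW.
rewrite !powRN lef_pV2 ?posrE ?powR_gt0//.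
by apply: ge0_ler_powR; rewrite ?nnegrE ?(ltW M0) ?(ltW a0) ?(ltW c0)//.
Unshelve. all: by end_near. Qed.

Let cvg_H a : lo <= a <= hi -> cvg (H a M @[M --> +oo]).
Proof.
move=> ha; pose H' M := H a (Num.max 2 M).
have max1 (M : R) : 1 < Num.max 2 M by rewrite lt_max ltr1n.
have [l cH'] : exists l : R, H' M @[M --> +oo] --> l.
  eexists; apply: nondecreasing_cvgr.
    by move=> x y xy; apply: H_mono => //; rewrite ge_max !le_max lexx/= xy orbT.
  by exists (2 / lo) => _ [x _ <-]; exact: H_ub.
apply/cvg_ex; exists l; apply: cvg_trans cH'; apply: near_eq_cvg; near=> M.
by rewrite /H' max_r//; near: M; apply: nbhs_pinfty_ge; exact: num_real.
Unshelve. all: by end_near. Qed.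

Let cvg_J a : lo <= a <= hi -> cvg (J a M @[M --> +oo]).
Proof.
move=> ha; have /cvg_ex[l Hl] := cvg_H ha.
apply/cvg_ex; exists (A a + (0 - (1 - cos 1) + a * l)).
apply: (@cvg_trans _ ((fun M => A a + (M `^ (- a) * (1 - cos M) -
    (1 - cos 1) + a * H a M)) M @[M --> +oo])).
  apply: near_eq_cvg; near=> M; rewrite JE//.
apply: cvgD; first exact: cvg_cst.
apply: cvgD; last by apply: cvgM; [exact: cvg_cst|exact: Hl].
by apply: cvgB; [exact: powRN_small|exact: cvg_cst].
Unshelve. all: by end_near. Qed.

Let I a := lim (J a M @[M --> +oo]).

Let I_lb a : lo <= a <= hi -> lo * c1 <= I a.
Proof.
move=> ha; apply: limr_ge; first exact: cvg_J.
near=> M; exact: J_lb.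
Unshelve. all: by end_near. Qed.

Let L1 := K1 + (2 / lo + 2 * K2).

(** The boundary terms of the integration by parts vanish at infinity, and the
   terms [1 - cos 1] cancel. *)
Let I_lip a b : lo <= a <= hi -> lo <= b <= hi -> `|I a - I b| <= L1 * `|a - b|.
Proof.
move=> ha hb.
pose u M := (J a M - J b M) - (M `^ (- a) * (1 - cos M) - M `^ (- b) * (1 - cos M)).
have cu : u M @[M --> +oo] --> (I a - I b) - (0 - 0).
  apply: cvgB; apply: cvgB; [exact: cvg_J|exact: cvg_J|exact: powRN_small|exact: powRN_small].
have <- : I a - I b - (0 - 0) = I a - I b by rewrite !subr0.
have cnu : `|u M| @[M --> +oo] --> `|I a - I b - (0 - 0)| by exact: cvg_norm.
rewrite -(cvg_lim _ cnu)//.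
apply: limr_le; first by apply: cvgP cnu.
near=> M; have M1 : 1 < M by [].
have -> : u M = (A a - A b) + ((a - b) * H a M + b * (H a M - H b M)).
  by rewrite /u !JE//; exact: telescoped_difference.
rewrite /L1 [leRHS]mulrDl; apply: le_trans (ler_normD _ _) _.
apply: lerD; first exact: A_lip.
rewrite [leRHS]mulrDl; apply: le_trans (ler_normD _ _) _; apply: lerD.
  rewrite normrM mulrC ler_wpM2r// ger0_norm ?H_ub//.
  by apply: Rintegral_ge0 => x _; exact: h_ge0.
have /andP[lb bh] := hb; have b0 : 0 <= b by apply: le_trans lb; exact: ltW.
rewrite normrM (ger0_norm b0) -mulrA ler_pM ?H_lip//.
by apply: le_trans bh _; exact: ltW.
Unshelve. all: by end_near. Qed.

Let ln_lip (c x y : R) : 0 < c -> c <= x -> c <= y -> `|ln x - ln y| <= `|x - y| / c.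
Proof.
move=> c0; wlog xy : x y / y <= x.
  move=> HW cx cy; have [yx|/ltW xy] := leP y x; first exact: HW.
  by rewrite distrC (distrC x); exact: HW.
move=> cx cy; have y0 : 0 < y by exact: lt_le_trans cy.
have x0 : 0 < x by exact: lt_le_trans cx.
rewrite !ger0_norm ?subr_ge0 ?ler_ln ?posrE//.
rewrite -ln_div ?posrE//; apply: (@le_trans _ _ ((x - y) / y)).
  have -> : x / y = 1 + (x - y) / y by field; rewrite gt_eqF.
  apply: le_ln1Dx; apply: lt_le_trans (_ : 0 <= _); first by rewrite ltrN10.
  by rewrite divr_ge0 ?subr_ge0// ltW.
by rewrite ler_wpM2l ?subr_ge0// lef_pV2.
Qed.

(** Splitting the improper integral at 1 and integrating by parts beyond 1 gives
   [I a = A a - (1 - cos 1) + a * H a], where both integrals [A] and [H] converge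
   absolutely; this makes [I] Lipschitz and bounded away from 0. *)
Lemma stable_const_lipschitz : exists kappa L : R, [/\ 0 < kappa, 0 < L,
  (forall a, lo <= a <= hi -> `|stable_const a| <= kappa) &
  (forall a b, lo <= a <= hi -> lo <= b <= hi ->
     `|stable_const a - stable_const b| <= L * `|a - b|)].
Proof.
have m0 : 0 < lo * c1 by rewrite mulr_gt0.
have I0 a : lo <= a <= hi -> 0 < I a by move=> ha; exact: lt_le_trans (I_lb ha).
pose w a := - a^-1 * ln (I a).
have CE a : lo <= a <= hi -> stable_const a = expR (w a).
  by move=> ha; rewrite /stable_const -/(f a) -/(J a) -/(I a) powR_expR ?I0.
have lolo : lo <= lo <= hi by rewrite lexx.
have L10 : 0 <= L1.
  have : 0 <= K1.
    rewrite mulr_ge0// ?invr_ge0 ?subr_ge0; first by have /andP[_ /ltW] := hi2_itv.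
    by apply: Rintegral_ge0 => x _; exact: powR_ge0.
  have : 0 <= K2 by rewrite mulr_ge0 ?invr_ge0 ?divr_ge0 ?ltW.
  have : 0 <= 2 / lo by rewrite divr_ge0 ?ltW.
  by rewrite /L1; lra.
pose Lv := L1 / (lo * c1).
have Lv0 : 0 <= Lv by rewrite divr_ge0// ltW.
have v_lip a b : lo <= a <= hi -> lo <= b <= hi ->
    `|ln (I a) - ln (I b)| <= Lv * `|a - b|.
  move=> ha hb; apply: le_trans (ln_lip m0 (I_lb ha) (I_lb hb)) _.
  by rewrite /Lv mulrAC ler_wpM2r ?invr_ge0 ?(ltW m0)// I_lip.
pose V := `|ln (I lo)| + Lv * (hi - lo).
have V0 : 0 <= V by rewrite addr_ge0// mulr_ge0// subr_ge0.
have v_bd a : lo <= a <= hi -> `|ln (I a)| <= V.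
  move=> ha; rewrite -[ln (I a)](subrK (ln (I lo))) addrC.
  apply: le_trans (ler_normD _ _) _; rewrite lerD2l.
  apply: le_trans (v_lip _ _ ha lolo) _; have /andP[la ah] := ha.
  by rewrite ler_wpM2l// ger0_norm ?subr_ge0// lerD2r.
have inv_bd a : lo <= a <= hi -> a != 0 /\ `|- a^-1| <= lo^-1.
  move=> /andP[la _]; have a0 : 0 < a by exact: lt_le_trans la.
  by rewrite gt_eqF// normrN gtr0_norm ?invr_gt0// lef_pV2.
have w_lip a b : lo <= a <= hi -> lo <= b <= hi ->
    `|w a - w b| <= (lo^-1 * Lv + V * (lo^-1 * lo^-1)) * `|a - b|.
  move=> ha hb; have [[a0 ia] [b0 ib]] := (inv_bd _ ha, inv_bd _ hb).
  have -> : w a - w b = - a^-1 * (ln (I a) - ln (I b))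
      + ln (I b) * (- a^-1 * - b^-1 * (a - b)).
    exact: mulNV_diff.
  apply: le_trans (ler_normD _ _) _; rewrite mulrDl; apply: lerD.
    by rewrite normrM -mulrA ler_pM// v_lip.
  rewrite !normrM -[leRHS]mulrA; apply: ler_pM => //; [exact: v_bd|].
  by apply: ler_pM => //; apply: ler_pM.
have w_bd a : lo <= a <= hi -> expR (w a) <= expR (lo^-1 * V).
  move=> ha; rewrite ler_expR; apply: le_trans (ler_norm _) _.
  by rewrite normrM ler_pM ?v_bd//; have [] := inv_bd _ ha.
have lo10 : 0 <= lo^-1 by rewrite invr_ge0 ltW.
have Lw0 : 0 <= lo^-1 * Lv + V * (lo^-1 * lo^-1).
  by apply: addr_ge0; apply: mulr_ge0 => //; exact: mulr_ge0.
exists (expR (lo^-1 * V)), (expR (lo^-1 * V) * (lo^-1 * Lv + V * (lo^-1 * lo^-1)) + 1).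
split.
- exact: expR_gt0.
- by rewrite ltr_wpDl// mulr_ge0 ?expR_ge0.
- by move=> a ha; rewrite CE// ger0_norm ?expR_ge0// w_bd.
- move=> a b ha hb; rewrite !CE//.
  apply: le_trans (expR_lip (w_bd _ ha) (w_bd _ hb)) _.
  apply: (@le_trans _ _ (expR (lo^-1 * V) * ((lo^-1 * Lv + V * (lo^-1 * lo^-1)) * `|a - b|))).
    by rewrite ler_wpM2l ?expR_ge0// w_lip.
  by rewrite mulrA ler_wpM2r// lerDl.
Qed.

End stable_constant.

(** * Regularity of the jumps *)

Section lipschitz_of_C1.
Context {R : realType}.

(** The supremum of the points up to which the bound holds satisfies the bound,
   and the local estimate would let the bound go past it. *)
Lemma local_lipschitz_global (f : R -> R) (K : R) : 0 <= K ->
  (forall t, 0 <= t <= 1 -> exists2 del, 0 < del &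
     forall s, 0 <= s <= 1 -> `|s - t| < del -> `|f s - f t| <= K * `|s - t|) ->
  forall s t, 0 <= s <= 1 -> 0 <= t <= 1 -> `|f s - f t| <= K * `|s - t|.
Proof.
move=> K0 loc s t; wlog st : s t / s <= t.
  move=> H hs ht; have [st|/ltW ts] := leP s t; first exact: H.
  by rewrite distrC (distrC s); exact: H.
move=> /andP[s0 s1] /andP[t0 t1].
pose S := [set u : R | s <= u <= t /\ `|f u - f s| <= K * (u - s)].
have Ss : S s by split; rewrite ?lexx ?st// !subrr normr0 mulr0.
have hS : has_sup S by split; [exists s|exists t => u [/andP[]]].
pose c := sup S.
have sc : s <= c by apply: ub_le_sup => //; case: hS.
have ct : c <= t by apply: ge_sup; [exists s|move=> u [/andP[]]].
have c01 : 0 <= c <= 1 by rewrite (le_trans s0)// (le_trans ct).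
have [del del0 Hdel] := loc c c01.
have Sc : S c.
  split; first by rewrite sc.
  have [u Su uc] : exists2 u, S u & c - del < u by exact: sup_adherent.
  have uleC : u <= c by apply: ub_le_sup => //; case: hS.
  have [/andP[su ut] fu] := Su.
  have := Hdel u; rewrite (le_trans s0)//= (le_trans ut)// => /(_ isT).
  rewrite distrC ger0_norm ?subr_ge0// ltrBlDl -ltrBlDr uc => /(_ isT) fc.
  rewrite -(subrK (f u) (f c)) -addrA; apply: le_trans (ler_normD _ _) _.
  have -> : K * (c - s) = K * (c - u) + K * (u - s) by ring.
  by rewrite lerD// distrC.
rewrite distrC (distrC s) (ger0_norm (_ : 0 <= t - s)) ?subr_ge0//.
have [ctE|] := eqVneq c t; first by case: Sc => _; rewrite ctE.
move=> cnt; have {cnt} ct' : c < t by rewrite lt_neqAle cnt.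
exfalso; pose u := Num.min t (c + del / 2).
have cu : c < u by rewrite lt_min ct' ltrDl divr_gt0.
have ut : u <= t by rewrite ge_min lexx.
have ud : u < c + del.
  by rewrite gt_min ltrD2l ltr_pdivrMr// ltr_pMr// ltr1n orbT.
have Su : S u.
  split; first by rewrite ut (le_trans sc)// ltW.
  have := Hdel u; rewrite (le_trans s0 (le_trans sc (ltW cu)))/= (le_trans ut)// => /(_ isT).
  rewrite ger0_norm ?subr_ge0 ?(ltW cu)// ltrBlDl ud => /(_ isT) fc.
  rewrite -(subrK (f c) (f u)) -addrA; apply: le_trans (ler_normD _ _) _.
  have -> : K * (u - s) = K * (u - c) + K * (c - s) by ring.
  by rewrite lerD//; case: Sc.
by have := ub_le_sup hS.2 Su; rewrite leNgt cu.
Qed.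

(** A derivative bounded by [M] gives the constant [M + 1] near each point. *)
Lemma C1_lipschitz (f : R -> R) : C1_on01 f -> exists2 K, 0 < K &
  forall s t, 0 <= s <= 1 -> 0 <= t <= 1 -> `|f s - f t| <= K * `|s - t|.
Proof.
case=> cvf cdf.
have [M M0 HM] : exists2 M : R, 0 <= M & forall t, 0 <= t <= 1 -> `|derive01 f t| <= M.
  have [u _ Hu] := EVT_max (@ler01 R) cdf.
  have [v _ Hv] := EVT_min (@ler01 R) cdf.
  exists (Num.max `|derive01 f u| `|derive01 f v|); first by rewrite le_max normr_ge0.
  move=> t t01; have t01' : t \in `[0, 1] by rewrite in_itv.
  have := Hu t t01'; have := Hv t t01'; rewrite le_max.
  have [d0|d0] := leP 0 (derive01 f t).
    by move=> _ H; rewrite (ger0_norm d0) (le_trans H (ler_norm _)).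
  move=> H _; apply/orP; right; rewrite ltr0_norm//.
  by rewrite -normrN; apply: le_trans (ler_norm _); rewrite lerN2.
exists (M + 1); first by rewrite ltr_wpDl.
apply: local_lipschitz_global; first by rewrite addr_ge0.
move=> t t01; have t01' : t \in `[0, 1] by rewrite in_itv.
have /cvgrPdist_lt/(_ 1 ltr01) := cvf t t01'.
rewrite -/(derive01 f t) near_withinE => -[del /= del0 H].
exists del => // s s01 st.
have [->|snt] := eqVneq s t; first by rewrite !subrr normr0 mulr0.
have {}H := H s; rewrite /= distrC in H.
have := H st snt; rewrite in_itv/= => /(_ s01) q.
have st0 : 0 < `|s - t| by rewrite normr_gt0 subr_eq0.
rewrite -ler_pdivrMr// -normf_div.
have -> : (f s - f t) / (s - t) =
    derive01 f t - (derive01 f t - (f s - f t) / (s - t)) by ring.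
apply: le_trans (ler_normB _ _) _; apply: lerD; [exact: HM|exact: ltW].
Qed.

End lipschitz_of_C1.

Section magnitudes.
Context {R : realType}.

Lemma mul_diff_split (a b x y : R) : a * x - b * y = (a - b) * x + b * (x - y).
Proof. by ring. Qed.

Lemma inv_diff (a b : R) : a != 0 -> b != 0 ->
  a^-1 - b^-1 = a^-1 * b^-1 * (b - a).
Proof. by move=> a0 b0; field; rewrite a0 b0. Qed.

Lemma regroup_bound (l L e K z : R) :
  l * l * (L * e) * (K * z) = l * (l * (L * (K * (z * e)))).
Proof. by ring. Qed.

Definition clamp01 (v : R) : R := Num.min 1 (Num.max 0 v).

Lemma clamp01_itv v : 0 <= clamp01 v <= 1.
Proof. by rewrite /clamp01 le_min ler01 le_max lexx/= ge_min lexx. Qed.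

Lemma clamp01_id v : 0 <= v <= 1 -> clamp01 v = v.
Proof. by move=> /andP[v0 v1]; rewrite /clamp01 max_r// min_r. Qed.

Lemma clamp01_lip u v : `|clamp01 u - clamp01 v| <= `|u - v|.
Proof.
wlog uv : u v / u <= v.
  move=> H; have [uv|/ltW vu] := leP u v; first exact: H.
  by rewrite distrC (distrC u); exact: H.
have m : clamp01 u <= clamp01 v.
  rewrite /clamp01 le_min ge_min lexx/= ge_min; apply/orP; right.
  by rewrite ge_max !le_max lexx uv orbT.
rewrite distrC (distrC u) !ger0_norm ?subr_ge0//.
rewrite /clamp01; case: (leP 0 u) => u0; case: (leP 0 v) => v0;
  rewrite ?(min_r (@ler01 R)).
- by case: (leP 1 u) => u1; case: (leP 1 v) => v1; lra.
- by case: (leP 1 u) => u1; lra.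
- by case: (leP 1 v) => v1; lra.
- by lra.
Qed.

Variables (alpha : R -> R) (lo hi : R).

Definition stable_index (v : R) : R := alpha (clamp01 v).
Definition scale (v : R) : R := stable_const (stable_index v).

(** The magnitude of the jumps, extended from [[0, 1]] to the whole line so that
   it is a continuous function of [v]. *)
Definition jump (v x : R) : R := scale v * expR (- (stable_index v)^-1 * ln x).

Lemma jumpE v x : 0 <= v <= 1 -> 0 < x -> jump v x = magnitude alpha v x.
Proof.
by move=> v01 x0; rewrite /jump /scale /stable_index clamp01_id// /magnitude powR_expR.
Qed.

Hypothesis alphaC1 : C1_on01 alpha.
Hypothesis lo0 : 0 < lo.
Hypothesis lohi : lo <= hi.
Hypothesis hi2 : hi < 2.
Hypothesis alpha_bnd : forall t, t \in `[0, 1] -> lo <= alpha t <= hi.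

Lemma index_bnd v : lo <= stable_index v <= hi.
Proof. by apply: alpha_bnd; rewrite in_itv/= clamp01_itv. Qed.

Lemma index_lip : exists2 K, 0 < K & forall u v, `|stable_index u - stable_index v| <= K * `|u - v|.
Proof.
have [K K0 HK] := C1_lipschitz alphaC1; exists K => // u v.
apply: le_trans (HK _ _ (clamp01_itv u) (clamp01_itv v)) _.
by rewrite ler_wpM2l ?(ltW K0)// clamp01_lip.
Qed.

Let index_gt0 v : 0 < stable_index v.
Proof. by have /andP[+ _] := index_bnd v; exact: lt_le_trans. Qed.

Lemma lipschitz_continuous (f : R -> R) (K : R) :
  (forall u v, `|f u - f v| <= K * `|u - v|) -> continuous f.
Proof.
move=> H x; apply/cvgrPdist_lt => e e0.
have K0 : 0 < `|K| + 1 by rewrite ltr_wpDl.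
exists (e / (`|K| + 1)) => [|y /= xy]; first by rewrite /= divr_gt0.
apply: le_lt_trans (H x y) _; move: xy; rewrite ltr_pdivlMr// mulrC; apply: le_lt_trans.
by rewrite ler_wpM2r// (le_trans (ler_norm K))// lerDl.
Qed.

Lemma continuous_index : continuous stable_index.
Proof. by have [K _ HK] := index_lip; exact: lipschitz_continuous HK. Qed.

Lemma scale_bounds : exists kappa K : R, [/\ 0 < kappa, 0 < K,
  (forall v, `|scale v| <= kappa) &
  (forall u v, `|scale u - scale v| <= K * `|u - v|)].
Proof.
have [kap [L [kap0 L0 Hkap HL]]] := stable_const_lipschitz lo0 lohi hi2.
have [K K0 HK] := index_lip.
exists kap, (L * K); split => //; first exact: mulr_gt0.
- by move=> v; apply: Hkap; exact: index_bnd.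
- move=> u v; apply: le_trans (HL _ _ (index_bnd u) (index_bnd v)) _.
  by rewrite -mulrA ler_wpM2l// ltW.
Qed.

Lemma continuous_scale : continuous scale.
Proof.
by have [kap [K [_ _ _ HK]]] := scale_bounds; exact: lipschitz_continuous HK.
Qed.

Variable c : R.
Hypothesis c01 : 0 < c <= 1.

(** An exponent strictly between [hi] and 2: squares of [i.+1 `^ (- rho^-1)] are
   summable. *)
Definition rho : R := (hi + 2) / 2.

Let rho_hi : hi < rho < 2.
Proof. by have := hi2; rewrite /rho => ?; apply/andP; split; lra. Qed.

Let natr_ge1 i : 1 <= i.+1%:R :> R.
Proof. by rewrite ler1n. Qed.

Let power_bound v beta x i : stable_index v <= beta -> c * i.+1%:R <= x ->
  x `^ (- (stable_index v)^-1) <= c `^ (- lo^-1) * i.+1%:R `^ (- beta^-1).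
Proof.
move=> vb cx; have /andP[c0 c1] := c01; have /andP[lv vh] := index_bnd v.
have ci0 : 0 < c * i.+1%:R by rewrite mulr_gt0.
apply: (@le_trans _ _ ((c * i.+1%:R) `^ (- (stable_index v)^-1))).
  rewrite !powRN lef_pV2 ?posrE ?powR_gt0 ?(lt_le_trans ci0)//.
  have x0 := lt_le_trans ci0 cx.
  by apply: ge0_ler_powR; rewrite ?nnegrE ?invr_ge0 ?(ltW ci0) ?(ltW x0) ?(ltW (index_gt0 v)).
rewrite powRM ?(ltW c0)//; apply: ler_pM; rewrite ?powR_ge0//.
  by apply: powRN_le1_mono => //; rewrite lef_pV2 ?posrE ?index_gt0.
by apply: powRN_ge1_mono => //; rewrite lef_pV2 ?posrE ?(lt_le_trans _ vb) ?index_gt0.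
Qed.

(** The logarithm costs an arbitrarily small power, whence [rho] instead of [hi]. *)
Let log_power_bound : exists2 K, 0 < K & forall v x i, c * i.+1%:R <= x ->
  `|ln x| * x `^ (- (stable_index v)^-1) <= K * i.+1%:R `^ (- rho^-1).
Proof.
have /andP[c0 c1] := c01; have /andP[hr r2] := rho_hi.
have h0 : 0 < hi by exact: lt_le_trans lohi.
have r0 : 0 < rho by exact: lt_trans hr.
pose t := hi^-1 - rho^-1; have t0 : 0 < t by rewrite subr_gt0 ltf_pV2.
exists (c `^ (- rho^-1) / t + c `^ (- (1 + lo^-1 + rho^-1))).
  by rewrite addr_gt0 ?divr_gt0 ?powR_gt0.
move=> v x i cx; have ci0 : 0 < c * i.+1%:R by rewrite mulr_gt0.
have x0 : 0 < x by exact: lt_le_trans cx.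
have /andP[lv vh] := index_bnd v.
rewrite mulrDl; have [x1|x1] := leP 1 x.
  rewrite -[leLHS]addr0; apply: lerD; last by rewrite mulr_ge0 ?powR_ge0.
  rewrite ger0_norm ?ln_ge0//.
  apply: (@le_trans _ _ (x `^ t / t * x `^ (- hi^-1))).
    apply: ler_pM; rewrite ?ln_ge0 ?powR_ge0 ?ln_le_powR//.
    by apply: powRN_ge1_mono => //; rewrite lef_pV2 ?posrE ?index_gt0.
  rewrite mulrAC -powRD ?(gt_eqF x0) ?implybT// mulrAC ler_wpM2r ?invr_ge0 ?(ltW t0)//.
  rewrite (_ : t - hi^-1 = - rho^-1); last by rewrite /t; ring.
  rewrite -powRM ?(ltW c0)// !powRN lef_pV2 ?posrE ?powR_gt0//.
  by apply: ge0_ler_powR; rewrite ?nnegrE ?invr_ge0 ?(ltW r0) ?(ltW ci0) ?(ltW x0).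
rewrite -[leLHS]add0r; apply: lerD; first by rewrite mulr_ge0 ?divr_ge0 ?powR_ge0 ?(ltW t0).
have x01 : 0 < x <= 1 by rewrite x0 ltW.
have cx1 : c <= x by apply: le_trans cx; rewrite ler_peMr// ltW.
have ci1 : c * i.+1%:R <= 1 by rewrite ltW// (le_lt_trans cx).
apply: (@le_trans _ _ (x `^ (- 1) / 1 * x `^ (- lo^-1))).
  apply: ler_pM; rewrite ?powR_ge0 ?norm_ln_le_powRN//.
  by apply: powRN_le1_mono => //; rewrite lef_pV2 ?posrE ?index_gt0.
rewrite divr1 -powRD ?(gt_eqF x0) ?implybT// -opprD.
apply: (@le_trans _ _ (c `^ (- (1 + lo^-1)))).
  rewrite !powRN lef_pV2 ?posrE ?powR_gt0//.
  by apply: ge0_ler_powR; rewrite ?nnegrE ?addr_ge0 ?invr_ge0 ?(ltW lo0) ?(ltW c0) ?(ltW x0).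
rewrite [in leRHS]opprD powRD ?(gt_eqF c0) ?implybT// -mulrA.
rewrite ler_peMr ?powR_ge0// -powRM ?(ltW c0)// powRN invf_ge1 ?powR_gt0//.
apply: (@le_trans _ _ ((c * i.+1%:R) `^ 0)); last by rewrite powRr0.
by apply: ger_powR; rewrite ?ci0 ?ci1// invr_ge0 ltW.
Qed.

(** Size of the jump caused by the i-th point [x] of a configuration of linear
   growth, and its Lipschitz dependence on the place. The constant depends
   neither on [beta] nor on the point. *)
Lemma jump_bounds : exists kappa : R, [/\ 0 < kappa,
  (forall beta v x i, stable_index v <= beta -> c * i.+1%:R <= x ->
     `|jump v x| <= kappa * i.+1%:R `^ (- beta^-1)) &
  (forall u v x i, c * i.+1%:R <= x ->
     `|jump u x - jump v x| <= kappa * i.+1%:R `^ (- rho^-1) * `|u - v|)].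
Proof.
have /andP[c0 c1] := c01; have /andP[hr r2] := rho_hi.
have h0 : 0 < hi by exact: lt_le_trans lohi.
have [kap [K [kap0 K0 Hkap HK]]] := scale_bounds.
have [L L0 HL] := index_lip; have [Kl Kl0 HKl] := log_power_bound.
pose cl := c `^ (- lo^-1); have cl0 : 0 < cl by exact: powR_gt0.
pose k1 := kap * cl; have k10 : 0 < k1 by exact: mulr_gt0.
pose k2 := K * cl + kap * (lo^-1 * lo^-1 * L * (Kl + Kl)).
have k20 : 0 < k2.
  by rewrite addr_gt0 ?mulr_gt0// ?invr_gt0// addr_gt0.
exists (k1 + k2); split; first exact: addr_gt0.
- move=> beta v x i vb cx; have ci0 : 0 < c * i.+1%:R by rewrite mulr_gt0.
  have x0 : 0 < x by exact: lt_le_trans cx.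
  rewrite mulrDl ler_wpDr// ?mulr_ge0 ?powR_ge0 ?(ltW k20)//.
  rewrite /jump normrM (ger0_norm (expR_ge0 _)) -powR_expR// /k1 -mulrA.
  by apply: ler_pM; rewrite ?powR_ge0 ?Hkap// power_bound.
move=> u v x i cx; have ci0 : 0 < c * i.+1%:R by rewrite mulr_gt0.
have x0 : 0 < x by exact: lt_le_trans cx.
apply: (@le_trans _ _ (k2 * i.+1%:R `^ (- rho^-1) * `|u - v|)); last first.
  by rewrite ler_wpM2r// ler_wpM2r ?powR_ge0// lerDr ltW.
rewrite /jump -!powR_expR//.
have -> : scale u * x `^ (- (stable_index u)^-1) - scale v * x `^ (- (stable_index v)^-1) =
    (scale u - scale v) * x `^ (- (stable_index u)^-1) +
    scale v * (x `^ (- (stable_index u)^-1) - x `^ (- (stable_index v)^-1)).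
  exact: mul_diff_split.
have k2E z d : k2 * z * d =
    K * cl * z * d + kap * (lo^-1 * lo^-1 * L * (Kl + Kl)) * z * d.
  by rewrite /k2 !mulrDl.
rewrite k2E; apply: le_trans (ler_normD _ _) _; apply: lerD.
  rewrite normrM (ger0_norm (powR_ge0 _ _)) -(mulrA K) mulrAC.
  apply: ler_pM; rewrite ?powR_ge0// power_bound//.
  by have /andP[_ /le_trans] := index_bnd u; apply; exact: ltW.
rewrite normrM -!mulrA; apply: ler_pM => //.
pose m := x `^ (- (stable_index u)^-1) + x `^ (- (stable_index v)^-1).
have mu_ : x `^ (- (stable_index u)^-1) <= m by rewrite lerDl powR_ge0.
have mv_ : x `^ (- (stable_index v)^-1) <= m by rewrite lerDr powR_ge0.
apply: le_trans (powRN_lip x0 mu_ mv_) _.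
have iuv : `|(stable_index u)^-1 - (stable_index v)^-1| <= lo^-1 * lo^-1 * (L * `|u - v|).
  have -> : (stable_index u)^-1 - (stable_index v)^-1 =
      (stable_index u)^-1 * (stable_index v)^-1 * (stable_index v - stable_index u).
    by apply: inv_diff; rewrite gt_eqF.
  rewrite normrM distrC; apply: ler_pM => //.
  have inv_le w : `|(stable_index w)^-1| <= lo^-1.
    by rewrite gtr0_norm ?invr_gt0// lef_pV2 ?posrE ?index_gt0//; case/andP: (index_bnd w).
  by rewrite normrM; apply: ler_pM.
have lm : `|ln x| * m <= (Kl + Kl) * i.+1%:R `^ (- rho^-1).
  by rewrite mulrDr mulrDl lerD// HKl.
rewrite -mulrA; apply: le_trans (ler_pM _ _ iuv lm) _ => //.
  by rewrite mulr_ge0// addr_ge0 ?powR_ge0.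
by rewrite le_eqVlt regroup_bound eqxx.
Qed.

End magnitudes.

(** * Maximal inequality for sums over the Poisson points *)

Section fatou_majorant.
Context {R : realType} {d : measure_display} {T : measurableType d}.
Variable mu : {measure set T -> \bar R}.

(** A majorant in mean for the limits of sequences that are eventually below
   [f n]: the limit inferior of [f]. *)
Lemma fatou_majorant (f : nat -> T -> R) (C : R) :
  (forall n, measurable_fun setT (f n)) -> (forall n w, 0 <= f n w) ->
  (\forall n \near \oo, (\int[mu]_w (f n w)%:E <= C%:E)%E) ->
  exists B : T -> \bar R, [/\ measurable_fun setT B, (forall w, (0 <= B w)%E),
    (\int[mu]_w B w <= C%:E)%E &
    forall w (u : nat -> R) (l : R), u @ \oo --> l ->
      (\forall n \near \oo, u n <= f n w) -> (l%:E <= B w)%E].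
Proof.
move=> mf f0 fC; pose h n w := (f n w)%:E.
have mh n : measurable_fun setT (h n) by exact/measurable_EFinP.
have Bge w (u : nat -> R) (l : R) : u @ \oo --> l ->
    (\forall n \near \oo, u n <= f n w) -> (l%:E <= limn_einf (h ^~ w))%E.
  move=> ul uf; rewrite limn_einf_lim.
  have /cvg_lim <- // : einfs (EFin \o u) @ \oo --> l%:E.
    by apply: cvg_einfs; apply: cvg_EFin => //; exact: nearW.
  apply: lee_lim; [exact: is_cvg_einfs|exact: is_cvg_einfs|].
  case: uf => N _ HN; exists N => // n /= Nn.
  apply: le_ereal_inf_tmp => _ [m /= nm <-].
  apply: (@le_trans _ _ (u m)%:E); last first.
    by rewrite lee_fin; apply: HN => /=; exact: leq_trans nm.
  by apply: ereal_inf_lbound; exists m.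
exists (fun w => limn_einf (h ^~ w)); split => //.
- rewrite /limn_einf; apply: measurableT_comp => //.
  apply: measurable_fun_limn_esup => n.
  by apply: measurableT_comp.
- move=> w; apply: (Bge w (fun=> 0)); first exact: cvg_cst.
  by apply: nearW => n; exact: f0.
- apply: le_trans (fatou _ _ _ _) _ => //; first by move=> n x _; rewrite lee_fin.
  rewrite limn_einf_lim; apply: lime_le; first exact: is_cvg_einfs.
  case: fC => N _ HN; exists N => // n /= Nn.
  by apply: (le_trans _ (HN n Nn)); apply: ereal_inf_lbound; exists n => /=.
Qed.

End fatou_majorant.

Section signed_maximal.
Context {R : realType}.

Lemma measurable_running_max (d : measure_display) (T : measurableType d)
    (f : nat -> T -> R) k : (forall j, measurable_fun setT (f j)) ->
  measurable_fun setT (fun w => running_max (f ^~ w) k).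
Proof.
move=> mf; elim: k => [|k IH] /=; first exact: measurableT_comp.
by apply: measurable_maxr => //; exact: measurableT_comp.
Qed.

(** The signs and the type [T] are parameters: the same sum serves for the random
   signs and for prescribed ones, and for the two sigma-algebras with respect to
   which it has to be measurable. *)
Definition signed_sum {T : Type} (n : nat) (s : nat -> T -> R) (G V : nat -> T -> R)
  (co : nat -> R * R -> R) (A : set R) (w : T) : R :=
  \sum_(i < n) s i w * co i (G i w, V i w) * \1_A (V i w).

Lemma measurable_signed_sum (d : measure_display) (T : measurableType d) n
    (s G V : nat -> T -> R) (co : nat -> R * R -> R) (A : set R) :
  (forall i, measurable_fun setT (s i)) -> (forall i, measurable_fun setT (G i)) ->
  (forall i, measurable_fun setT (V i)) -> (forall i, measurable_fun setT (co i)) ->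
  measurable A -> measurable_fun setT (signed_sum n s G V co A).
Proof.
move=> ms mG mV mco mA; apply: measurable_sum => i.
apply: measurable_funM; last by apply: measurableT_comp => //; exact: measurable_indic.
apply: measurable_funM => //; apply: measurableT_comp => //.
exact: measurable_fun_pair.
Qed.

Context {d : measure_display} {Omega : measurableType d}.
Variable P : probability Omega R.
Variables G V g : nat -> {RV P >-> R}.
Hypothesis g_signs : iid_signs P g.
Let GV := <<s sigma_gen G `|` sigma_gen V >>.
Hypothesis indep_g_GV : independent_sigma P (sigma_gen g) GV.

(** Doob's inequality along an increasing family of sets [A j]: given the points,
   the sums are Rademacher sums, so that one first averages over the signs. *)
Lemma signed_maximal (co : nat -> R * R -> R) (A : nat -> set R) n k (m : nat -> R) (q : R) :
  (forall i, measurable_fun setT (co i)) -> (forall j, measurable (A j)) ->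
  (forall j, A j `<=` A j.+1) ->
  (forall i p, A k p.2 -> `|co i p| <= m i) -> (forall i, (P (V i @^-1` A k) <= q%:E)%E) ->
  (\int[P]_w ((running_max (fun j => signed_sum n g G V co (A j) w) k) ^+ 2)%:E <=
   (4 * ((\sum_(i < n) m i ^+ 2) * q))%:E)%E.
Proof.
move=> mco mA Aincr com Pq.
(* The same functions are measurable for the sigma-algebra of [G] and [V]. *)
pose T' := g_sigma_algebraType (sigma_gen G `|` sigma_gen V).
have mG' i : measurable_fun setT (G i : T' -> R).
  move=> _ B mB; rewrite setTI; apply: sub_sigma_algebra; left.
  by apply: sub_sigma_algebra; exists i, B.
have mV' i : measurable_fun setT (V i : T' -> R).
  move=> _ B mB; rewrite setTI; apply: sub_sigma_algebra; right.
  by apply: sub_sigma_algebra; exists i, B.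
pose F (e : {ffun 'I_n -> bool}) w :=
  running_max (fun j => rademacher_sum (fun i : 'I_n => co i (G i w, V i w))
    [set i : 'I_n | V i w \in A j]%SET e) k ^+ 2.
pose s (e : {ffun 'I_n -> bool}) (i : nat) (w : Omega) : R :=
  if insub i is Some j then (-1) ^+ e j else 0.
have FE e w : F e w = running_max (fun j => signed_sum n (s e) G V co (A j) w) k ^+ 2.
  rewrite /F; congr (_ ^+ 2); apply: eq_running_max => j _.
  rewrite /rademacher_sum /signed_sum big_mkcond/=; apply: eq_bigr => i _.
  rewrite inE indicE /s valK; case: (V i w \in A j); first by rewrite mulr1.
  by rewrite mulr0.
have mF e : measurable_fun setT (F e).
  rewrite (_ : F e = fun w => running_max (fun j => signed_sum n (s e) G V co (A j) w) k ^+ 2).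
    apply: measurable_funX; apply: measurable_running_max => j.
    by apply: measurable_signed_sum => // i; exact: measurable_cst.
  by apply/funext.
have mF' e : measurable_fun setT (F e : T' -> R).
  rewrite (_ : F e = fun w => running_max (fun j => signed_sum n (s e) G V co (A j) w) k ^+ 2).
    apply: measurable_funX; apply: measurable_running_max => j.
    by apply: measurable_signed_sum => // i; exact: measurable_cst.
  by apply/funext.
rewrite (integral_sign_average g_signs (F := F) indep_g_GV) //; last first.
- move=> e w Hw; rewrite FE; congr (_ ^+ 2); apply: eq_running_max => j _.
  apply: eq_bigr => i _; rewrite (Hw i) /s.
  by rewrite valK.
- by move=> e B mB; have := mF' e measurableT _ mB; rewrite setTI.
- apply: measurable_funX; apply: measurable_running_max => j.
  by apply: measurable_signed_sum.
- by move=> w; exact: sqr_ge0.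
- by move=> e w; exact: sqr_ge0.
have m4 i : 0 <= 4 * 2 ^+ n * m i ^+ 2.
  by apply: mulr_ge0; [rewrite mulr_ge0 ?exprn_ge0|exact: sqr_ge0].
have mP i : measurable (V i @^-1` A k) by exact: measurable_funPTI.
apply: (@le_trans _ _ (((2 ^+ n)^-1)%:E * \int[P]_w
    (\sum_(i < n) ((4 * 2 ^+ n * m i ^+ 2)%:E * (\1_(V i @^-1` A k) w)%:E))))%E.
  apply: lee_wpmul2l; first by rewrite lee_fin invr_ge0 exprn_ge0.
  apply: ge0_le_integral => //.
  - by move=> w _; rewrite lee_fin sumr_ge0// => e _; exact: sqr_ge0.
  - by apply/measurable_EFinP; apply: measurable_sum => e.
  - apply: emeasurable_sum => i.
    apply: measurable_funeM; apply/measurable_EFinP; exact: measurable_indic.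
  - move=> w _; rewrite sumEFin lee_fin.
    apply: le_trans (rademacher_maximal _ _ _) _.
      by move=> j; apply/fintype.subsetP => i; rewrite !inE => H; exact: Aincr.
    rewrite mulrA mulr_sumr big_mkcond/=; apply: ler_sum => i _.
    rewrite inE; case: ifPn => VA.
      2: by apply: mulr_ge0; rewrite ?indicE.
    rewrite indicE mem_set; last exact: (set_mem VA).
    rewrite mulr1 ler_wpM2l ?mulr_ge0 ?exprn_ge0//.
    have H := com i (G i w, V i w) (set_mem VA).
    by rewrite -(real_normK (num_real _)) lerXn2r ?nnegrE// (le_trans _ H).
rewrite ge0_integral_sum//; last 2 first.
- move=> i; apply: measurable_funeM; apply/measurable_EFinP; exact: measurable_indic.
- by move=> i w _; apply: mule_ge0; rewrite lee_fin// indicE.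
apply: (@le_trans _ _ (((2 ^+ n)^-1)%:E * \sum_(i < n) (4 * 2 ^+ n * m i ^+ 2 * q)%:E)%E).
  apply: lee_wpmul2l; first by rewrite lee_fin invr_ge0 exprn_ge0.
  apply: lee_sum => i _; rewrite ge0_integralZl_EFin//=.
    2: by apply/measurable_EFinP; exact: measurable_indic.
  rewrite integral_indic// setIT [leRHS]EFinM; apply: lee_wpmul2l; rewrite ?lee_fin//; exact: (Pq i).
rewrite sumEFin -EFinM lee_fin -!mulr_suml -mulr_sumr.
by rewrite -!mulrA (mulrCA 4) mulKf ?expf_neq0 ?pnatr_eq0.
Qed.

End signed_maximal.

(** * Mean oscillation over a cell *)

Section grid.
Context {R : realType}.
Implicit Types a b r : R.

(** All cells use the same dyadic points, moved into the cell when they are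
   outside, so that the times where the series converge can be chosen once. *)
Definition grid a b n j : R := Num.min b (Num.max a (j%:R / 2 ^+ n)).

Definition dyadic n r := exists k : nat, r = k%:R / 2 ^+ n.

Lemma dyadicS n m r : (n <= m)%N -> dyadic n r -> dyadic m r.
Proof.
move=> nm [k ->]; exists (k * 2 ^ (m - n))%N; rewrite natrM natrX.
rewrite -{2}(subnKC nm) exprD invfM mulrACA mulrAC.
by rewrite mulfV ?mulr1// expf_neq0// pnatr_eq0.
Qed.

Lemma grid_bnd a b n j : a <= b -> a <= grid a b n j <= b.
Proof. by move=> ab; rewrite /grid le_min ge_min lexx ab le_max lexx. Qed.

Lemma grid_mono a b n i j : (i <= j)%N -> grid a b n i <= grid a b n j.
Proof.
move=> ij; have H : i%:R / 2 ^+ n <= j%:R / 2 ^+ n :> R.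
  by rewrite ler_wpM2r ?invr_ge0 ?exprn_ge0// ler_nat.
rewrite /grid le_min !ge_min lexx/= ge_max !le_max lexx/= H !orbT//.
Qed.

Lemma grid0 a b n : 0 <= a -> a <= b -> grid a b n 0 = a.
Proof. by move=> a0 ab; rewrite /grid mul0r max_l// min_r. Qed.

Lemma grid_last a b n : a <= b -> b <= 1 -> grid a b n (2 ^ n) = b.
Proof.
move=> ab b1; rewrite /grid natrX mulfV ?expf_neq0 ?pnatr_eq0//.
by rewrite max_r ?min_l// (le_trans ab).
Qed.

Lemma grid_dyadic a b n r : dyadic n r -> a <= r <= b -> b <= 1 ->
  exists2 j, (j <= 2 ^ n)%N & grid a b n j = r.
Proof.
move=> [k rk] /andP[ar rb] b1; exists k; last by rewrite /grid -rk max_r// min_r.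
have : r <= 1 by exact: le_trans b1.
by rewrite rk ler_pdivrMr ?exprn_gt0// mul1r -natrX ler_nat.
Qed.

End grid.

Section series_bounds.
Context {R : realType}.

Lemma powR_invl (x r : R) : 0 <= x -> x^-1 `^ r = x `^ (- r).
Proof. by move=> x0; rewrite -(powR_inv1 x0) -powRrM mulN1r. Qed.

Lemma powRS (x r : R) : 0 < x -> x `^ (r - 1) * x = x `^ r.
Proof.
by move=> x0; rewrite -{2}(powRr1 (ltW x0)) -powRD ?subrK// (gt_eqF x0) implybT.
Qed.

(** The first [N] terms, and those beyond [N], for [N] of the order of [1 / del]:
   the same power of [del] comes out. *)
Lemma head_bound (s del : R) N : 0 < s < 1 -> 0 < del -> N%:R <= 2 / del ->
  \sum_(0 <= i < N) i.+1%:R `^ (- s) * del <= 2 / (1 - s) * 2 `^ (1 - s) * del `^ s.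
Proof.
move=> /andP[s0 s1] d0 Nd; have a0 : 0 < 1 - s by rewrite subr_gt0.
rewrite -mulr_suml.
have H := @sum_powR_lt1 R (1 - s).
rewrite a0 gerBl (ltW s0) in H; have {}H := H isT N.
rewrite (_ : 1 - s - 1 = - s) in H; last by ring.
have HN : N%:R `^ (1 - s) <= 2 `^ (1 - s) * del `^ (s - 1).
  rewrite -(opprB 1 s) -(powR_invl _ (ltW d0)) -powRM ?invr_ge0 ?(ltW d0)//.
  by apply: ge0_ler_powR; rewrite ?nnegrE ?(ltW a0) ?divr_ge0 ?(ltW d0).
rewrite -mulrA -(powRS s d0) !mulrA ler_wpM2r ?(ltW d0)// -mulrA.
by apply: le_trans H _; rewrite ler_wpM2l// divr_ge0// ltW.
Qed.

Lemma tail_bound (r del : R) N n : 1 < r -> 0 < del -> del^-1 <= N%:R ->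
  \sum_(N <= i < n) i.+1%:R `^ (- r) * del <= (r - 1)^-1 * del `^ r.
Proof.
move=> r1 d0 dN; have N0 : 0 < N%:R :> R by apply: lt_le_trans dN; rewrite invr_gt0.
rewrite -mulr_suml -(powRS r d0) mulrA ler_wpM2r ?(ltW d0)//.
apply: le_trans (sum_powR_gt1 r1 n _) _; first by rewrite ltr0n in N0.
rewrite ler_wpM2l ?invr_ge0 ?subr_ge0 ?(ltW r1)//.
rewrite -(opprB 1 r) -(powR_invl _ (ltW d0)) -(opprB r 1) !powRN.
rewrite lef_pV2 ?posrE ?powR_gt0 ?invr_gt0//.
by apply: ge0_ler_powR; rewrite ?nnegrE ?subr_ge0 ?invr_ge0 ?(ltW r1) ?(ltW d0) ?ler0n.
Qed.

Lemma norm_powR_cvg (u : nat -> R) (l p : R) : l != 0 -> u @ \oo --> l ->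
  (`|u n| `^ p) @[n --> \oo] --> `|l| `^ p.
Proof.
move=> l0 ul; have H : `|u n| @[n --> \oo] --> `|l| by exact: cvg_norm.
have l1 : 0 < `|l| by rewrite normr_gt0.
have C : {for `|l|, continuous (fun y : R => y `^ p)} by exact: continuous_powR.
exact: (@continuous_cvg _ _ _ _ _ (fun n => `|u n|) _ _ C H).
Qed.

(** Bounding a first moment by a second one; [h] is the expected size of [y]. *)
Lemma norm_le_sqr (h y : R) : 0 <= h -> (h = 0 -> y = 0) -> `|y| <= h + h^-1 * y ^+ 2.
Proof.
rewrite le_eqVlt => /predU1P[<- /(_ erefl) ->|h0 _].
  by rewrite normr0 expr0n mulr0 addr0.
rewrite -(real_normK (num_real y)); have [yh|/ltW hy] := leP `|y| h.
  by rewrite ler_wpDr// mulr_ge0 ?invr_ge0 ?sqr_ge0// ltW.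
rewrite ler_wpDl ?(ltW h0)// expr2 mulrA ler_peMl//.
by rewrite mulrC ler_pdivlMr// mul1r.
Qed.

Lemma variation_step (h k S : R) : h + h^-1 * (4 * (h ^+ 2 * (k * S) * 1)) = h + 4 * (k * S) * h.
Proof.
have [->|h0] := eqVneq h 0; first by rewrite !mulr0 invr0 mul0r.
by rewrite mulr1; congr (_ + _); field.
Qed.

Lemma moment_collect (A e C1 C2 : R) : C1 * (A * e) + (A * e + A * 4 * (4 * (C2 * e))) =
  (C1 + (1 + 4 * (4 * C2))) * (A * e).
Proof. by ring. Qed.

End series_bounds.

Section moments.
Context {R : realType} {d : measure_display} {T : measurableType d}.
Variable P : probability T R.

Lemma integral_affine_le (S M : T -> R) (s m c0 c1 : R) :
  measurable_fun setT S -> measurable_fun setT M ->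
  (forall w, 0 <= S w) -> (forall w, 0 <= M w) -> 0 <= c0 -> 0 <= c1 ->
  (\int[P]_w (S w)%:E <= s%:E)%E -> (\int[P]_w (M w)%:E <= m%:E)%E ->
  (\int[P]_w (S w + (c0 + c1 * M w))%:E <= (s + (c0 + c1 * m))%:E)%E.
Proof.
move=> mS mM S0 M0 c00 c10 Ss Mm.
have mcM : measurable_fun setT (fun w => (c1%:E * (M w)%:E)%E).
  by apply: measurable_funeM; exact/measurable_EFinP.
under eq_integral do rewrite !EFinD EFinM.
rewrite ge0_integralD//=; last 4 first.
- by move=> w _; rewrite lee_fin.
- exact/measurable_EFinP.
- by move=> w _; rewrite adde_ge0 ?mule_ge0 ?lee_fin.
- by apply: emeasurable_funD.
rewrite ge0_integralD//=; last by move=> w _; rewrite mule_ge0 ?lee_fin.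
rewrite integral_cst// ge0_integralZl_EFin//; last 2 first.
- by move=> w _; rewrite lee_fin.
- exact/measurable_EFinP.
rewrite !EFinD EFinM; apply: leeD => //; apply: leeD.
  rewrite -[leRHS]mule1; apply: lee_wpmul2l; first by rewrite lee_fin.
  exact: probability_le1.
by apply: lee_wpmul2l; rewrite ?lee_fin.
Qed.

Lemma integral_affine_le0 (M : T -> R) (m c0 c1 : R) :
  measurable_fun setT M -> (forall w, 0 <= M w) -> 0 <= c0 -> 0 <= c1 ->
  (\int[P]_w (M w)%:E <= m%:E)%E ->
  (\int[P]_w (c0 + c1 * M w)%:E <= (c0 + c1 * m)%:E)%E.
Proof.
move=> mM M0 c00 c10 Mm.
have := @integral_affine_le (cst 0) M 0 m c0 c1 (measurable_cst _) mM (fun=> lexx _) M0 c00 c10.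
rewrite integral0 lexx => /(_ isT Mm).
by rewrite add0r; under eq_integral do rewrite /= add0r.
Qed.

Lemma integral_sum_le (I : finType) (F : I -> T -> R) (m : I -> R) :
  (forall i, measurable_fun setT (F i)) -> (forall i w, 0 <= F i w) ->
  (forall i, (\int[P]_w (F i w)%:E <= (m i)%:E)%E) ->
  (\int[P]_w (\sum_i F i w)%:E <= (\sum_i m i)%:E)%E.
Proof.
move=> mF F0 Fm; under eq_integral do rewrite -sumEFin.
rewrite ge0_integral_sum//; last 2 first.
- by move=> i; exact/measurable_EFinP.
- by move=> i w _; rewrite lee_fin.
by rewrite -sumEFin; apply: lee_sum.
Qed.

Lemma integral_scale_le (F : T -> R) (k m : R) : 0 <= k ->
  measurable_fun setT F -> (forall w, 0 <= F w) ->
  (\int[P]_w (F w)%:E <= m%:E)%E -> (\int[P]_w (k * F w)%:E <= (k * m)%:E)%E.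
Proof.
move=> k0 mF F0 Fm; under eq_integral do rewrite EFinM.
rewrite ge0_integralZl_EFin//; last 2 first.
- by move=> w _; rewrite lee_fin.
- exact/measurable_EFinP.
by rewrite EFinM lee_wpmul2l// lee_fin.
Qed.

End moments.

Section cell.
Context {R : realType} {d : measure_display} {Omega : measurableType d}.
Variable P : probability Omega R.
Variables (alpha : R -> R) (lo hi c : R).
Variables G V g : nat -> {RV P >-> R}.
Hypothesis alphaC1 : C1_on01 alpha.
Hypothesis lo0 : 0 < lo.
Hypothesis lohi : lo <= hi.
Hypothesis hi2 : hi < 2.
Hypothesis alpha_bnd : forall t, t \in `[0, 1] -> lo <= alpha t <= hi.
Hypothesis V_uniform : iid_uniform01 P V.
Hypothesis g_signs : iid_signs P g.
Hypothesis indep_g_GV : independent_sigma P (sigma_gen g)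
  <<s sigma_gen G `|` sigma_gen V >>.
Hypothesis c01 : 0 < c <= 1.

(** Jumps of the i-th point are discarded when it is less than [c * i.+1]. This
   makes the bounds on the coefficients deterministic, and it changes nothing
   on the event where all the points are large enough. *)
Definition trunc i (x : R) : R := \1_(`[c * i.+1%:R, +oo[%classic) x.

Definition z_coef i (p : R * R) : R := trunc i p.1 * jump alpha p.2 p.1.

Definition y_coef t i (p : R * R) : R :=
  trunc i p.1 * (jump alpha t p.1 - jump alpha p.2 p.1).

Definition Z_partial n t w := signed_sum n g G V z_coef `[0, t]%classic w.
Definition Y_partial n t w := signed_sum n g G V (y_coef t) `[0, t]%classic w.

Lemma trunc_norm i x m y : (c * i.+1%:R <= x -> `|y| <= m) -> 0 <= m ->
  `|trunc i x * y| <= m.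
Proof.
move=> H m0; rewrite /trunc indicE; case: (boolP (_ \in _)) => [/set_mem/=|_].
  by rewrite in_itv/= andbT mul1r.
by rewrite mul0r normr0.
Qed.

Lemma measurable_trunc i : measurable_fun setT (fun p : R * R => trunc i p.1).
Proof. by apply: measurableT_comp => //; exact: measurable_indic. Qed.

Lemma measurable_jump2 (f : R * R -> R) : measurable_fun setT f ->
  measurable_fun setT (fun p : R * R => jump alpha (f p) p.1).
Proof.
move=> mf; have iv v : stable_index alpha v != 0.
  have /andP[l _] := index_bnd alpha_bnd v.
  by rewrite gt_eqF// (lt_le_trans lo0 l).
rewrite /jump; apply: measurable_funM.
  apply: measurableT_comp => //; apply: continuous_measurable_fun.
  exact: continuous_scale alphaC1 lo0 lohi hi2 alpha_bnd.
apply: measurableT_comp; first exact: measurable_expR.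
apply: measurable_funM; last by apply: measurableT_comp => //; exact: measurable_ln.
have mi : measurable_fun setT (fun v => - (stable_index alpha v)^-1).
  apply: continuous_measurable_fun => v; apply: cvgN; apply: cvgV; first exact: iv.
  exact: continuous_index alphaC1 _.
exact: (measurableT_comp mi mf).
Qed.

Lemma measurable_z_coef i : measurable_fun setT (z_coef i).
Proof.
by apply: measurable_funM; [exact: measurable_trunc|exact: measurable_jump2].
Qed.

Lemma measurable_y_coef t i : measurable_fun setT (y_coef t i).
Proof.
apply: measurable_funM; first exact: measurable_trunc.
by apply: measurable_funB; apply: measurable_jump2.
Qed.

Lemma prob_V_itv i a b : a <= b -> (P (V i @^-1` `]a, b]%classic) <= (b - a)%:E)%E.
Proof.
move=> ab; rewrite V_uniform.2//.
rewrite /= /uniform_prob.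
apply: (@le_trans _ _ (\int[lebesgue_measure]_(x in `]a, b]) 1%:E)%E).
  apply: ge0_le_integral => //.
  - by move=> x _; rewrite lee_fin uniform_pdf_ge0.
  - apply/measurable_EFinP; apply: measurable_funTS.
    exact: measurable_uniform_pdf.
  - move=> x _; rewrite lee_fin /uniform_pdf; case: ifP => // _.
    by rewrite subr0 invr1.
rewrite integral_cst// mul1e.
suff H : (lebesgue_measure `]a, b]%classic = (b - a)%:E)%E.
  by have := lexx (b - a)%:E; rewrite -{1}H.
rewrite lebesgue_measure_itv/= lte_fin; move: ab.
by rewrite le_eqVlt => /predU1P[->|->]; rewrite ?ltxx ?subrr.
Qed.

Lemma signed_sum_nat n (co : nat -> R * R -> R) A w : signed_sum n g G V co A w =
  \sum_(0 <= i < n) g i w * co i (G i w, V i w) * \1_A (V i w).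
Proof. by rewrite big_mkord. Qed.

Lemma indic_itv_diff (a r r' v : R) : 0 <= a -> a <= r -> r <= r' ->
  \1_(`[0, r']%classic) v - \1_(`[0, r]%classic) v =
  \1_(`]a, r']%classic) v - \1_(`]a, r]%classic) v :> R.
Proof.
move=> a0 ar rr; rewrite !indicE !mem_setE !in_itv/=.
have [v0|v0] := leP 0 v; last by rewrite ltNge (le_trans (ltW v0) a0)/= !subr0.
have [av|va] := ltP a v; first by [].
by rewrite !(le_trans va)// ?(le_trans ar)//= !subrr.
Qed.

Lemma measurable_S_term (k : R) i a b :
  measurable_fun setT (fun w => k * \1_(`]a, b]%classic) (V i w)).
Proof.
apply: measurable_funM => //; apply: measurableT_comp => //; exact: measurable_indic.
Qed.

Lemma norm_half_open (a r r' b v : R) : r' <= b -> a <= r -> r <= r' ->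
  `|\1_(`]a, r']%classic) v - \1_(`]a, r]%classic) v| <= \1_(`]a, b]%classic) v :> R.
Proof.
move=> rb ar rr; rewrite !indicE !mem_setE !in_itv/=.
have [av|va] := ltP a v; last by rewrite subr0 normr0.
have [vr|vr] := leP v r.
  by rewrite (le_trans vr rr) (le_trans (le_trans vr rr) rb) subrr normr0.
have [vr'|vr'] := leP v r'; last by rewrite subr0 normr0.
by rewrite (le_trans vr' rb) subr0 normr1.
Qed.

(** The oscillation of [Z] over a cell, at the resolution given by its length [del]:
   the first [1 / del] jumps are added with their p-th powers, the others are
   compared with [del `^ beta^-1] in mean square. *)
Lemma Z_cell (beta p : R) : 0 < p <= 1 -> p < beta -> beta < 2 ->
  exists2 K, 0 <= K & forall a b, 0 <= a -> a < b -> b <= 1 ->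
  (forall v, a <= v <= b -> stable_index alpha v <= beta) ->
  exists B : Omega -> \bar R, [/\ measurable_fun setT B, (forall w, (0 <= B w)%E),
    (\int[P]_w B w <= (K * (b - a) `^ (p / beta))%:E)%E &
    forall w, (forall i, `|g i w| <= 1) ->
    forall n r r' l l', dyadic n r -> dyadic n r' -> a <= r -> r <= r' -> r' <= b ->
      Z_partial ^~ r ^~ w @ \oo --> l -> Z_partial ^~ r' ^~ w @ \oo --> l' ->
      ((`|l' - l| `^ p)%:E <= B w)%E].
Proof.
move=> p01 pbeta beta2; have /andP[p0 p1] := p01.
have beta0 : 0 < beta by exact: lt_trans pbeta.
have [kap [kap0 Hkap _]] := jump_bounds alphaC1 lo0 lohi hi2 alpha_bnd c01.
pose s := p / beta; have s01 : 0 < s < 1.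
  by rewrite divr_gt0//= ltr_pdivrMr// mul1r.
have s0 : 0 < s by case/andP: s01.
pose rr := 2 / beta; have rr1 : 1 < rr by rewrite ltr_pdivlMr// mul1r.
pose K1 := 2 / (1 - s) * 2 `^ (1 - s).
have K10 : 0 <= K1.
  by rewrite mulr_ge0 ?powR_ge0// divr_ge0// subr_ge0; case/andP: s01 => _ /ltW.
pose K2 := (rr - 1)^-1; have K20 : 0 <= K2 by rewrite invr_ge0 subr_ge0 ltW.
exists (kap `^ p * K1 + (1 + 4 * (4 * (kap ^+ 2 * K2)))).
  have H1 := mulr_ge0 (powR_ge0 kap p) K10; have H2 := mulr_ge0 (sqr_ge0 kap) K20.
  by apply: addr_ge0 => //; apply: addr_ge0 => //; apply: mulr_ge0 => //; exact: mulr_ge0.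
move=> a b a0 ab b1 Hidx; pose del := b - a.
have d0 : 0 < del by rewrite subr_gt0.
have d1 : del <= 1 by rewrite lerBlDl (le_trans b1)// lerDr.
(* [1 / del <= N <= 2 / del] *)
pose N := (Num.truncn del^-1).+1.
have Nlo : del^-1 <= N%:R by apply: ltW; exact: truncnS_gt.
have Nhi : N%:R <= 2 / del.
  rewrite /N -addn1 natrD mulrDl mul1r; apply: lerD; last by rewrite invf_ge1.
  by rewrite truncn_le// invr_ge0 ltW.
pose x := del `^ beta^-1; have x0 : 0 < x by exact: powR_gt0.
pose S w := \sum_(i < N) (kap `^ p * i.+1%:R `^ (- s)) * \1_(`]a, b]%classic) (V i w) : R.
pose A n j := `]a, grid a b n j]%classic.
pose small i p := if (N <= i)%N then z_coef i p else 0.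
pose M n w := running_max (fun j => signed_sum n g G V small (A n j) w) (2 ^ n) ^+ 2.
(* [S] bounds the big jumps; two values of the small part differ by at most
   twice the running maximum, whence the factor 4. *)
pose f n w := S w + (x `^ p + (x `^ (p - 2) * 4) * M n w).
have mS : measurable_fun setT S.
  by apply: measurable_sum => i; exact: measurable_S_term.
have S0 w : 0 <= S w.
  by apply: sumr_ge0 => i _; rewrite !mulr_ge0 ?powR_ge0// indicE.
have msmall i : measurable_fun setT (small i).
  by rewrite /small; case: (N <= i)%N; [exact: measurable_z_coef|exact: measurable_cst].
have mM n : measurable_fun setT (M n).
  apply: measurable_funX; apply: measurable_running_max => j.
  by apply: measurable_signed_sum => //; exact: measurable_itv.
have M0 n w : 0 <= M n w by exact: sqr_ge0.
have AE n : A n (2 ^ n)%N = `]a, b]%classic by rewrite /A grid_last ?(ltW ab).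
have jumpb i q : q.2 \in `]a, b] -> `|z_coef i q| <= kap * i.+1%:R `^ (- beta^-1).
  rewrite in_itv/= => /andP[aq qb]; apply: trunc_norm; last first.
    by rewrite mulr_ge0 ?powR_ge0// ltW.
  by move=> H; apply: Hkap => //; apply: Hidx; rewrite (ltW aq).
have IS : (\int[P]_w (S w)%:E <= (kap `^ p * K1 * del `^ s)%:E)%E.
  apply: (@le_trans _ _ (\sum_(i < N) (kap `^ p * i.+1%:R `^ (- s)) * del)%:E).
    apply: integral_sum_le => [i|i w|i].
    - exact: measurable_S_term.
    - by rewrite !mulr_ge0 ?powR_ge0// indicE.
    - apply: integral_scale_le => //; first by rewrite mulr_ge0 ?powR_ge0.
        by apply: measurableT_comp => //; exact: measurable_indic.
      have -> : (fun w => (\1_(`]a, b]%classic) (V i w))%:E) =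
        (fun w => (\1_(V i @^-1` `]a, b]%classic) w)%:E) by [].
      rewrite integral_indic ?setIT//; first by exact: prob_V_itv (ltW ab).
      exact: measurable_funPTI.
  rewrite lee_fin -mulrA; under eq_bigr do rewrite -mulrA.
  rewrite -mulr_sumr ler_wpM2l ?powR_ge0//.
  by have := head_bound s01 d0 Nhi; rewrite big_mkord.
have IM n : (\int[P]_w (M n w)%:E <= (4 * (kap ^+ 2 * (K2 * del `^ rr)))%:E)%E.
  have H := @signed_maximal R d Omega P G V g g_signs indep_g_GV small (A n) n (2 ^ n)%N
    (fun i => if (N <= i)%N then kap * i.+1%:R `^ (- beta^-1) else 0) del msmall.
  apply: le_trans (H _ _ _ _) _.
  - by move=> j; exact: measurable_itv.
  - move=> j v; rewrite /A/= !in_itv/= => /andP[-> /=] /le_trans; apply.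
    exact: grid_mono.
  - move=> i q; rewrite AE => qab; rewrite /small; case: ifP => _; last by rewrite normr0.
    exact: jumpb.
  - by move=> i; rewrite AE; exact: prob_V_itv (ltW ab).
  rewrite lee_fin ler_pM2l//.
  rewrite -(big_mkord xpredT (fun i => (if (N <= i)%N then kap * i.+1%:R `^ (- beta^-1) else 0) ^+ 2)).
  have [nN|Nn] := leqP n N.
    rewrite big_nat big1 ?mul0r; first exact: mulr_ge0 (sqr_ge0 _) (mulr_ge0 K20 (powR_ge0 _ _)).
    by move=> i /andP[_ iN]; rewrite leqNgt (leq_trans iN nN)/= expr0n.
  rewrite (big_cat_nat (n := N))//=; last exact: ltnW.
  rewrite big_nat big1 ?add0r; last first.
    by move=> i /andP[_ iN]; rewrite leqNgt iN expr0n.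
  rewrite big_nat; under eq_bigr => i /andP[Ni _].
    rewrite Ni exprMn.
    rewrite (_ : (i.+1%:R `^ (- beta^-1)) ^+ 2 = i.+1%:R `^ (- rr)); last first.
      by rewrite -powR_mulrn ?powR_ge0// -powRrM mulNr mulrC.
    over.
  rewrite -big_nat -mulr_sumr -mulrA ler_wpM2l ?sqr_ge0// mulr_suml.
  exact: tail_bound.
have If n : (\int[P]_w (f n w)%:E <=
    ((kap `^ p * K1 + (1 + 4 * (4 * (kap ^+ 2 * K2)))) * del `^ s)%:E)%E.
  apply: (@le_trans _ _ (kap `^ p * K1 * del `^ s +
    (x `^ p + x `^ (p - 2) * 4 * (4 * (kap ^+ 2 * (K2 * del `^ rr)))))%:E).
    by apply: integral_affine_le; rewrite ?powR_ge0// mulr_ge0 ?powR_ge0.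
  rewrite lee_fin.
  have -> : x `^ p = del `^ s by rewrite -powRrM mulrC.
  have -> : x `^ (p - 2) = del `^ (s - rr) by rewrite -powRrM mulrC mulrBl.
  have -> : del `^ s = del `^ (s - rr) * del `^ rr.
    by rewrite -powRD ?subrK// (gt_eqF d0) implybT.
  by rewrite (mulrA (kap ^+ 2)) moment_collect.
have [B [mB B0 IB HB]] := @fatou_majorant R d Omega P f _ (fun n => measurable_funD mS
  (measurable_funD (measurable_cst _) (measurable_funM (measurable_cst _) (mM n))))
  (fun n w => addr_ge0 (S0 w) (addr_ge0 (powR_ge0 _ _) (mulr_ge0 (mulr_ge0 (powR_ge0 _ _) (ler0n _ _)) (M0 n w))))
  (nearW _ If).
exists B; split => // w gw n0 r r' l l' dr dr' ar rr' rb Zl Zl'.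
have [->|ll] := eqVneq (l' - l) 0; first by rewrite normr0 powR0 ?gt_eqF.
apply: (HB w (fun n => `|Z_partial n r' w - Z_partial n r w| `^ p)).
  by apply: norm_powR_cvg => //; exact: cvgB.
near=> n.
have [j jn jE] : exists2 j, (j <= 2 ^ n)%N & grid a b n j = r.
  apply: grid_dyadic => //; last by rewrite ar (le_trans rr').
  apply: dyadicS dr; near: n; exact: nbhs_infty_ge.
have [j' jn' jE'] : exists2 j, (j <= 2 ^ n)%N & grid a b n j = r'.
  apply: grid_dyadic => //; last by rewrite rb (le_trans ar).
  apply: dyadicS dr'; near: n; exact: nbhs_infty_ge.
have Nn : (N <= n)%N by near: n; exact: nbhs_infty_ge.
pose D i : R := \1_(`]a, r']%classic) (V i w) - \1_(`]a, r]%classic) (V i w).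
pose u i := g i w * z_coef i (G i w, V i w) * D i.
have incr : Z_partial n r' w - Z_partial n r w = \sum_(0 <= i < N) u i +
    (signed_sum n g G V small (A n j') w - signed_sum n g G V small (A n j) w).
  rewrite /Z_partial !signed_sum_nat -!sumrB.
  rewrite [LHS](big_cat_nat (n := N))//= [X in _ = _ + X](big_cat_nat (n := N))//=; congr (_ + _).
    apply: eq_bigr => i _; rewrite -mulrBr.
    by rewrite (indic_itv_diff _ a0 ar rr').
  rewrite [X in _ = X + _]big_nat [X in _ = X + _]big1 ?add0r; last first.
    by move=> i /andP[_ iN]; rewrite /small leqNgt iN/= mulr0 !mul0r subr0.
  rewrite [LHS]big_nat [RHS]big_nat; apply: eq_bigr => i /andP[Ni _].
  by rewrite /small Ni /A jE jE' -!mulrBr (indic_itv_diff _ a0 ar rr').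
rewrite incr /f; apply: le_trans (ge0_ler_powR (ltW p0) _ _ (ler_normD _ _)) _.
- by rewrite nnegrE.
- by rewrite nnegrE addr_ge0.
apply: le_trans (powR_subadditive p01 _ _) _ => //; apply: lerD.
  apply: le_trans (ge0_ler_powR (ltW p0) _ _ (ler_norm_sum _ _ _)) _.
  - by rewrite nnegrE.
  - by rewrite nnegrE sumr_ge0.
  apply: (@le_trans _ _ (\sum_(0 <= i < N) `|u i| `^ p)); first exact: powR_sum_le.
  rewrite /S -(big_mkord xpredT (fun i => kap `^ p * i.+1%:R `^ (- s) * \1_(`]a, b]%classic) (V i w))).
  apply: ler_sum => i _; rewrite /u.
  have HD : `|D i| <= \1_(`]a, b]%classic) (V i w) by exact: norm_half_open.
  move: HD; rewrite indicE; case: (boolP (_ \in _)) => [/set_mem/= vab|_] HD; last first.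
    by move: HD; rewrite normr_le0 => /eqP ->; rewrite !mulr0 normr0 powR0 ?gt_eqF.
  rewrite mulr1; have -> : kap `^ p * i.+1%:R `^ (- s) = (kap * i.+1%:R `^ (- beta^-1)) `^ p.
    by rewrite powRM ?powR_ge0 ?(ltW kap0)// -powRrM mulNr mulrC mulrC /s (mulrC beta^-1).
  apply: ge0_ler_powR; rewrite ?nnegrE ?(ltW p0) ?mulr_ge0 ?powR_ge0 ?(ltW kap0)//.
  rewrite normrM (normrM (g i w)) -[leRHS]mulr1 -[leRHS](mul1r (_ * 1)) -mulrA.
  apply: ler_pM => //; apply: ler_pM => //.
  exact: jumpb.
have p2 : 0 < p <= 2 by rewrite p0 (le_trans p1)// ler1n.
apply: le_trans (powR_le_threshold p2 x0 (normr_ge0 _)) _.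
rewrite lerD2l -mulrA ler_wpM2l ?powR_ge0// powR_mulrn//.
have Hj q : (q <= 2 ^ n)%N -> `|signed_sum n g G V small (A n q) w| <=
    running_max (fun j => signed_sum n g G V small (A n j) w) (2 ^ n).
  by move=> qn; exact: (running_max_ge (fun j => signed_sum n g G V small (A n j) w)).
have -> : 4 * M n w = (2 * running_max (fun j => signed_sum n g G V small (A n j) w) (2 ^ n)) ^+ 2.
  by rewrite /M exprMn -natrX.
rewrite lerXn2r ?nnegrE ?mulr_ge0 ?running_max_ge0//.
by apply: le_trans (ler_normB _ _) _; rewrite mulr_natl mulr2n lerD// Hj.
Unshelve. all: end_near. Qed.

Definition y_inc t t' i (q : R * R) : R :=
  y_coef t' i q * \1_(`[0, t']%classic) q.2 - y_coef t i q * \1_(`[0, t]%classic) q.2.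

Lemma measurable_y_inc t t' i : measurable_fun setT (y_inc t t' i).
Proof.
by apply: measurable_funB; apply: measurable_funM;
  [exact: measurable_y_coef|apply: measurableT_comp => //; exact: measurable_indic
  |exact: measurable_y_coef|apply: measurableT_comp => //; exact: measurable_indic].
Qed.

Lemma Y_partial_diff n t t' w : Y_partial n t' w - Y_partial n t w =
  signed_sum n g G V (y_inc t t') setT w.
Proof.
rewrite /Y_partial !signed_sum_nat -sumrB; apply: eq_bigr => i _.
by rewrite indicT mulr1 /y_inc mulrBr !mulrA.
Qed.

(** The difference [Y = X - Z] is Lipschitz in mean square, so that its mean
   variation over a cell is of the order of the length of the cell. The
   variation is measured along the grids, by the mean squares of the steps. *)
Lemma Y_cell (p : R) : 0 < p <= 1 ->
  exists2 K, 0 <= K & forall a b, 0 <= a -> a < b -> b <= 1 ->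
  exists B : Omega -> \bar R, [/\ measurable_fun setT B, (forall w, (0 <= B w)%E),
    (\int[P]_w B w <= (K * (b - a) `^ p)%:E)%E &
    forall w,
    forall n r r' l l', dyadic n r -> dyadic n r' -> a <= r -> r <= r' -> r' <= b ->
      Y_partial ^~ r ^~ w @ \oo --> l -> Y_partial ^~ r' ^~ w @ \oo --> l' ->
      ((`|l' - l| `^ p)%:E <= B w)%E].
Proof.
move=> p01; have /andP[p0 p1] := p01.
have [kap [kap0 _ Hkap]] := jump_bounds alphaC1 lo0 lohi hi2 alpha_bnd c01.
have rho0 : 0 < rho hi.
  by rewrite /rho divr_gt0// addr_gt0// (lt_le_trans lo0).
pose rr := 2 / rho hi; have rr1 : 1 < rr.
  by rewrite ltr_pdivlMr// mul1r /rho ltr_pdivrMr//; have := hi2; lra.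
pose K2 := 1 + (rr - 1)^-1; have K20 : 0 <= K2.
  by rewrite addr_ge0// invr_ge0 subr_ge0 ltW.
exists (1 + (1 + 4 * (kap ^+ 2 * K2))).
  by apply: addr_ge0 => //; apply: addr_ge0 => //; apply: mulr_ge0 => //;
    exact: mulr_ge0 (sqr_ge0 _) K20.
move=> a b a0 ab b1; pose del := b - a.
have d0 : 0 < del by rewrite subr_gt0.
pose t n j := grid a b n j; pose h n j := t n j.+1 - t n j.
have h0 n j : 0 <= h n j by rewrite subr_ge0 grid_mono.
have tb n j : a <= t n j <= b by exact: grid_bnd (ltW ab).
pose Inc n j w := running_max (fun=> signed_sum n g G V (y_inc (t n j) (t n j.+1)) setT w) 0 ^+ 2.
pose Var n w := \sum_(j < 2 ^ n) (h n j + (h n j)^-1 * Inc n j w).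
pose f n w := del `^ p + del `^ (p - 1) * Var n w.
have mInc n j : measurable_fun setT (Inc n j).
  apply: measurable_funX; apply: measurable_running_max => _.
  by apply: measurable_signed_sum => //; exact: measurable_y_inc.
have Inc0 n j w : 0 <= Inc n j w by exact: sqr_ge0.
have mstep n j : measurable_fun setT (fun w => h n j + (h n j)^-1 * Inc n j w).
  by apply: measurable_funD => //; apply: measurable_funM.
have step0 n j w : 0 <= h n j + (h n j)^-1 * Inc n j w.
  by rewrite addr_ge0 ?h0// mulr_ge0// invr_ge0.
have mVar n : measurable_fun setT (Var n) by exact: measurable_sum.
have Var0 n w : 0 <= Var n w by exact: sumr_ge0.
have incb s s' i q : a <= s <= b -> a <= s' <= b -> s <= s' ->
    `|y_inc s s' i q| <= (s' - s) * (kap * i.+1%:R `^ (- (rho hi)^-1)).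
  move=> /andP[as_ sb] /andP[as' sb'] ss; set m := (X in _ <= X).
  have m0 : 0 <= m by rewrite mulr_ge0 ?subr_ge0// mulr_ge0 ?powR_ge0 ?(ltW kap0).
  rewrite /y_inc !indicE !mem_setE !in_itv/=.
  have [v0|v0] := leP 0 q.2; last by rewrite !mulr0 subrr normr0.
  have [vs|sv] := leP q.2 s.
    rewrite (le_trans vs ss)/= !mulr1 /y_coef -mulrBr; apply: trunc_norm => // cx.
    rewrite opprB addrA subrK.
    apply: le_trans (Hkap s' s q.1 i cx) _.
    by rewrite /m mulrC ger0_norm ?subr_ge0.
  rewrite mulr0 subr0; have [vs'|sv'] := leP q.2 s'; last by rewrite mulr0 normr0.
  rewrite mulr1 /y_coef; apply: trunc_norm => // cx.
  apply: le_trans (Hkap s' q.2 q.1 i cx) _.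
  rewrite /m mulrC; apply: ler_wpM2r; first by rewrite mulr_ge0 ?powR_ge0 ?(ltW kap0).
  by rewrite ger0_norm ?subr_ge0// lerD2l lerN2 ltW.
have IInc n j : (\int[P]_w (Inc n j w)%:E <= (4 * (h n j ^+ 2 * (kap ^+ 2 * K2) * 1))%:E)%E.
  have H := @signed_maximal R d Omega P G V g g_signs indep_g_GV (y_inc (t n j) (t n j.+1))
    (fun=> setT) n 0 (fun i => h n j * (kap * i.+1%:R `^ (- (rho hi)^-1))) 1
    (@measurable_y_inc _ _).
  apply: le_trans (H _ _ _ _) _ => //.
  - by move=> i q _; apply: incb => //; exact: grid_mono.
  - by move=> i; apply: probability_le1; exact: measurable_funPTI.
  rewrite lee_fin !mulr1 ler_pM2l//.
  under eq_bigr do rewrite 2!exprMn.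
  rewrite -!mulr_sumr ler_wpM2l ?sqr_ge0// ler_wpM2l ?sqr_ge0//.
  rewrite -(big_mkord xpredT (fun i => (i.+1%:R `^ (- (rho hi)^-1)) ^+ 2)).
  under eq_bigr => i _.
    rewrite (_ : (i.+1%:R `^ (- (rho hi)^-1)) ^+ 2 = i.+1%:R `^ (- rr)); last first.
      by rewrite -powR_mulrn ?powR_ge0// -powRrM mulNr mulrC.
    over.
  exact: sum_powR_gt1_le.
have IVar n : (\int[P]_w (Var n w)%:E <= ((1 + 4 * (kap ^+ 2 * K2)) * del)%:E)%E.
  apply: (@le_trans _ _ (\sum_(j < 2 ^ n) ((1 + 4 * (kap ^+ 2 * K2)) * h n j))%:E).
    apply: integral_sum_le => // j.
    rewrite mulrDl mul1r -variation_step.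
    by apply: integral_affine_le0; rewrite // invr_ge0.
  rewrite -mulr_sumr -(big_mkord xpredT (h n)) telescope_sumr//.
  by rewrite /t grid0 ?(ltW ab)// grid_last ?(ltW ab).
have If n : (\int[P]_w (f n w)%:E <=
    ((1 + (1 + 4 * (kap ^+ 2 * K2))) * del `^ p)%:E)%E.
  apply: (@le_trans _ _ (del `^ p + del `^ (p - 1) * ((1 + 4 * (kap ^+ 2 * K2)) * del))%:E).
    by apply: integral_affine_le0; rewrite ?powR_ge0.
  by rewrite mulrCA powRS// [in leRHS]mulrDl mul1r.
have [B [mB B0 IB HB]] := @fatou_majorant R d Omega P f _
  (fun n => measurable_funD (measurable_cst _) (measurable_funM (measurable_cst _) (mVar n)))
  (fun n w => addr_ge0 (powR_ge0 _ _) (mulr_ge0 (powR_ge0 _ _) (Var0 n w)))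
  (nearW _ If).
exists B; split => // w n0 r r' l l' dr dr' ar rr' rb Yl Yl'.
have [->|ll] := eqVneq (l' - l) 0; first by rewrite normr0 powR0 ?gt_eqF.
apply: (HB w (fun n => `|Y_partial n r' w - Y_partial n r w| `^ p)).
  by apply: norm_powR_cvg => //; exact: cvgB.
near=> n.
have [j jn jE] : exists2 j, (j <= 2 ^ n)%N & grid a b n j = r.
  apply: grid_dyadic => //; last by rewrite ar (le_trans rr').
  apply: dyadicS dr; near: n; exact: nbhs_infty_ge.
have [j' jn' jE'] : exists2 j, (j <= 2 ^ n)%N & grid a b n j = r'.
  apply: grid_dyadic => //; last by rewrite rb (le_trans ar).
  apply: dyadicS dr'; near: n; exact: nbhs_infty_ge.
have p01' : 0 < p <= 1 by [].
apply: le_trans (powR_le_threshold p01' d0 (normr_ge0 _)) _.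
rewrite /f lerD2l ler_wpM2l ?powR_ge0// powRr1//.
have [jj|jj] := leqP j j'; last first.
  have -> : r' = r.
    by apply/eqP; rewrite eq_le rr' -jE -jE' grid_mono// ltnW.
  by rewrite subrr normr0.
pose y k := Y_partial n (t n k) w.
have -> : Y_partial n r' w - Y_partial n r w = \sum_(j <= k < j') (y k.+1 - y k).
  by rewrite telescope_sumr// /y /t jE jE'.
apply: (@le_trans _ _ (\sum_(0 <= k < 2 ^ n) `|y k.+1 - y k|)).
  apply: le_trans (ler_norm_sum _ _ _) _.
  rewrite [leRHS](big_cat_nat (n := j))//= [X in _ + X](big_cat_nat (n := j'))//=.
  by rewrite ler_wpDl ?sumr_ge0// lerDl sumr_ge0.
rewrite /Var -(big_mkord xpredT (fun k => h n k + (h n k)^-1 * Inc n k w)).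
apply: ler_sum => k _; rewrite /Inc /= -Y_partial_diff real_normK ?num_real//.
apply: norm_le_sqr => // /eqP; rewrite subr_eq0 => /eqP E.
by rewrite /y E subrr.
Unshelve. all: end_near. Qed.

End cell.

(** * Covers by cells and the measure of the range *)

Section cell_cover.
Context {R : realType}.
Implicit Types (E U : set R) (a b s x : R).

(** Covers by small sets are turned into covers by cells of the same order of
   length. A cell contains the dyadic points that lie just to the right of
   every point that it is used for; the last point 1 is itself dyadic. *)
Lemma cell_cover E s eta e : E `<=` `[0, 1]%classic -> (hausdorff_dim E < s%:E)%E ->
  s <= 1 -> 0 < eta -> 0 < e ->
  exists U : nat -> set R, exists a b : nat -> R, [/\ E `<=` \bigcup_j U j,
    forall j x, U j x -> E x /\ a j <= x /\ (x < b j \/ x = 1 /\ b j = 1),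
    forall j, U j !=set0 -> [/\ 0 <= a j, a j < b j, b j <= 1 & b j - a j <= eta] &
    (\sum_(0 <= j <oo) (if U j == set0 then 0 else ((b j - a j) `^ s)%:E) <= e%:E)%E].
Proof.
move=> E01 dimE s1 eta0 e0.
have s0 : 0 < s by rewrite -lte_fin (le_lt_trans (hausdorff_dim_ge0 E)).
pose r := Num.min (eta / 4) 1.
have eta4 : 0 < eta / 4 by rewrite divr_gt0.
have r01 : 0 < r <= 1 by rewrite /r lt_min eta4 ltr01/= ge_min lexx orbT.
pose e1 := Num.min (e / (2 `^ s * 2)) ((eta / 4) `^ s).
have e10 : 0 < e1.
  by rewrite /e1 lt_min powR_gt0// divr_gt0// mulr_gt0// powR_gt0.
have [U [EU Ur Ue]] := hausdorff_dim_lt_cover dimE r01 e10.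
(* Enlarging the j-th set by [eps j] makes the cell nondegenerate. *)
pose eps j := (e1 / (2 ^ j.+1)%:R) `^ s^-1.
have eps0 j : 0 < eps j by rewrite powR_gt0// divr_gt0// ltr0n expn_gt0.
have epsE j : eps j `^ s = e1 / (2 ^ j.+1)%:R.
  by rewrite -powRrM mulVf ?gt_eqF// powRr1// divr_ge0// ltW.
have eps_le j : eps j <= eta / 4.
  have H : eps j `^ s <= (eta / 4) `^ s.
    rewrite epsE; apply: (@le_trans _ _ e1); last by rewrite /e1 ge_min lexx orbT.
    by rewrite ler_pdivrMr ?ltr0n ?expn_gt0// ler_peMr ?(ltW e10)// ler1n expn_gt0.
  rewrite leNgt; apply/negP => /(gt0_ltr_powR s0) K.
  by move: H; rewrite leNgt K// nnegrE ltW.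
pose V j := U j `&` E.
pose t0 j := xget 0 (V j).
have Vt0 j : V j !=set0 -> V j (t0 j) by case=> x Vx; rewrite /t0; exact: xgetI Vx.
pose D j := fine (diameter (U j)).
have DE j : V j !=set0 -> diameter (U j) = (D j)%:E.
  move=> [x [Ux _]]; rewrite /D fineK// ge0_fin_numE ?diameter_ge0//; last by exists x.
  exact: le_lt_trans (Ur j) (ltry _).
have D0 j : V j !=set0 -> 0 <= D j.
  by move=> Vj; rewrite -lee_fin -DE// diameter_ge0//; case: Vj => x [Ux _]; exists x.
pose el j := D j + eps j.
exists V, (fun j => Num.max 0 (t0 j - el j)), (fun j => Num.min 1 (t0 j + el j)).
have el0 j : V j !=set0 -> 0 < el j by move=> /D0 H; rewrite ltr_wpDl.
have t01 j : V j !=set0 -> 0 <= t0 j <= 1.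
  by move=> /Vt0[_ /E01] /=; rewrite in_itv.
have len j : V j !=set0 ->
    Num.min 1 (t0 j + el j) - Num.max 0 (t0 j - el j) <= 2 * el j.
  move=> Vj; have -> : 2 * el j = (t0 j + el j) - (t0 j - el j) by ring.
  by apply: lerB; rewrite ?ge_min ?le_max lexx orbT.
split.
- by move=> x Ex; have [j _ Ux] := EU x Ex; exists j.
- move=> j x [Ux Ex]; split=> //.
  have Vj : V j !=set0 by exists x.
  have /andP[x0 x1] : 0 <= x <= 1 by have := E01 _ Ex; rewrite /= in_itv.
  have : `|x - t0 j| <= D j.
    by rewrite -lee_fin -DE//; apply: le_diameter => //; case: (Vt0 j Vj).
  rewrite ler_norml => /andP[xl xr]; have ep := eps0 j; split.
    by rewrite ge_max x0/= /el; lra.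
  have xe : x < t0 j + el j by rewrite /el; lra.
  have [x1'|x1'] := ltP x 1; first by left; rewrite lt_min x1'.
  have {}x1 : x = 1 by apply/eqP; rewrite eq_le x1.
  by right; split => //; rewrite min_l// -x1 ltW.
- move=> j Vj; have /andP[t0j t1j] := t01 j Vj; have elj := el0 j Vj.
  split; first by rewrite le_max lexx.
  + by rewrite lt_min !gt_max ltr01/=; apply/andP; split; [lra|apply/andP; split; lra].
  + by rewrite ge_min lexx.
  + apply: le_trans (len j Vj) _.
    have Dr : D j <= eta / 4.
      rewrite -lee_fin -DE//; apply: le_trans (Ur j) _.
      by rewrite lee_fin /r ge_min lexx.
    by have := eps_le j; rewrite /el; lra.
have step j : ((if V j == set0 then 0 else
    ((Num.min 1 (t0 j + el j) - Num.max 0 (t0 j - el j)) `^ s)%:E) <=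
    (2 `^ s)%:E * (gauge s (U j) + (e1 / (2 ^ j.+1)%:R)%:E))%E.
  have [_|/set0P Vj] := eqVneq (V j) set0.
    apply: mule_ge0; first by rewrite lee_fin powR_ge0.
    by rewrite adde_ge0 ?gauge_ge0// lee_fin divr_ge0// ltW.
  have -> : gauge s (U j) = (D j `^ s)%:E.
    rewrite /gauge DE// poweR_EFin; case: eqP => // U0.
    by case: Vj => x []; rewrite U0.
  rewrite -EFinD -EFinM lee_fin -epsE.
  apply: (@le_trans _ _ ((2 * el j) `^ s)).
    apply: ge0_ler_powR; rewrite ?nnegrE ?(ltW s0) ?len// ?mulr_ge0 ?(ltW (el0 j Vj))//.
    rewrite subr_ge0 le_min !ge_max ler01/=.
    have /andP[t0j t1j] := t01 j Vj; have elj := el0 j Vj.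
    by apply/andP; split; [lra|apply/andP; split; lra].
  rewrite powRM ?(ltW (el0 j Vj))// ler_wpM2l ?powR_ge0//.
  by apply: powR_subadditive; rewrite ?s0 ?D0// ltW.
have s_ge0 j : (0 <= (if V j == set0 then 0 else
    ((Num.min 1 (t0 j + el j) - Num.max 0 (t0 j - el j)) `^ s)%:E))%E.
  by case: ifP => // _; rewrite lee_fin powR_ge0.
apply: le_trans (lee_nneseries (fun j _ _ => s_ge0 j) (fun j _ => step j)) _.
rewrite nneseriesZl; last first.
  by move=> j _; rewrite adde_ge0 ?gauge_ge0// lee_fin divr_ge0// ltW.
apply: (@le_trans _ _ ((2 `^ s)%:E * (e1%:E + e1%:E))%E).
  apply: lee_wpmul2l; first by rewrite lee_fin powR_ge0.
  apply: le_trans (epsilon_trick _ (fun j => gauge_ge0 _ _) (ltW e10)) _.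
  exact: leeD.
rewrite -EFinD -EFinM lee_fin.
apply: (@le_trans _ _ (2 `^ s * (2 * (e / (2 `^ s * 2))))).
  rewrite ler_wpM2l ?powR_ge0// mulr_natl mulr2n.
  by apply: lerD; rewrite /e1 ge_min lexx.
by rewrite (mulrA (2 `^ s) 2) mulrC divfK// mulf_neq0// gt_eqF// powR_gt0.
Qed.

End cell_cover.

Section dyadic_density.
Context {R : realType}.

Lemma dyadic_dense (t u : R) : 0 <= t -> t < u -> exists n r, dyadic n r /\ t < r < u.
Proof.
move=> t0 tu; have ut : 0 < u - t by rewrite subr_gt0.
pose n := (Num.truncn (u - t)^-1).+1.
have p0 : 0 < 2 ^+ n :> R by rewrite exprn_gt0.
have n2 : (2 ^+ n)^-1 < u - t.
  rewrite invf_plt ?posrE//; apply: (@lt_trans _ _ n%:R); first exact: truncnS_gt.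
  by rewrite -natrX ltr_nat ltn_expl.
exists n, ((Num.truncn (t * 2 ^+ n)).+1%:R / 2 ^+ n); split; first by eexists.
rewrite ltr_pdivlMr// truncnS_gt/=.
apply: (@le_lt_trans _ _ (t + (2 ^+ n)^-1)); last by rewrite addrC -ltrBrDr.
rewrite ler_pdivrMr// mulrDl mulVf ?gt_eqF// -natr1 lerD2r.
by rewrite truncn_le// mulr_ge0// ltW.
Qed.

Definition right_continuous_but (f : R -> R) (tau : R) := forall t, 0 <= t < 1 ->
  t <> tau -> forall e, 0 < e -> exists2 del, 0 < del &
  forall r, t < r < t + del -> r <= 1 -> `|f r - f t| <= e.

Lemma dyadic_approx (f : R -> R) (tau a b x e : R) : right_continuous_but f tau ->
  0 <= a -> b <= 1 -> a <= x -> (x < b \/ x = 1 /\ b = 1) -> x <> tau -> 0 < e ->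
  exists n r, [/\ dyadic n r, a <= r <= b & `|f r - f x| <= e].
Proof.
move=> rc a0 b1 ax [xb|[x1 b1']] xtau e0.
  have [|del del0 H] := rc x _ xtau e e0; first by rewrite (le_trans a0)// (lt_le_trans xb).
  have [||n [r [dr /andP[xr rm]]]] := @dyadic_dense x (Num.min b (x + del)).
  - exact: le_trans ax.
  - by rewrite lt_min xb ltrDl.
  move: rm; rewrite lt_min => /andP[rb rd].
  exists n, r; split => //; first by rewrite (le_trans ax) ?ltW.
  by apply: H; rewrite ?xr// (le_trans (ltW rb)).
exists 0%N, 1; split; first by exists 1%N; rewrite expr0 divr1.
- by rewrite -x1 ax x1 b1' lexx.
- by rewrite x1 subrr normr0 ltW.
Qed.

(** A bound on the oscillation over dyadic points passes to their limits. *)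
Lemma oscillation_of_approx (f : R -> R) (Q : set R) (rho x y : R) :
  (forall e, 0 < e -> exists n r, [/\ dyadic n r, Q r & `|f r - f x| <= e]) ->
  (forall e, 0 < e -> exists n r, [/\ dyadic n r, Q r & `|f r - f y| <= e]) ->
  (forall n r r', dyadic n r -> dyadic n r' -> Q r -> Q r' -> `|f r' - f r| <= rho) ->
  `|f x - f y| <= rho.
Proof.
move=> Hx Hy H; apply/ler_addgt0Pr => e e0.
have e2 : 0 < e / 2 by rewrite divr_gt0.
have [n [r [dr Qr rx]]] := Hx _ e2; have [m [r' [dr' Qr' ry]]] := Hy _ e2.
have -> : f x - f y = (f r - f r') + ((f x - f r) + (f r' - f y)) by ring.
apply: le_trans (ler_normD _ _) _; apply: lerD.
  by apply: (H (maxn n m)) => //; [exact: dyadicS (leq_maxr _ _) dr'|exact: dyadicS (leq_maxl _ _) dr].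
apply: le_trans (ler_normD _ _) _; rewrite (splitr e); apply: lerD => //.
by rewrite distrC.
Qed.

End dyadic_density.

Section label.
Context {R : realType}.
Implicit Types (pts : seq R) (t u v : R).

(** The position of [t] among [pts]: it cuts the line into finitely many
   half-open intervals. *)
Definition label pts t := count (fun s : R => s <= t) pts.

Lemma label_add pts t u : t <= u ->
  label pts u = (label pts t + count (fun s : R => (t < s <= u)%R) pts)%N.
Proof.
move=> tu; elim: pts => //= s pts IH; rewrite /label /= in IH *; rewrite IH.
rewrite addnACA; congr (_ + _)%N.
have [st|ts] := leP s t; first by rewrite (le_trans st tu).
by rewrite add0n.
Qed.

Lemma label_between pts t v u : t <= v <= u -> label pts u = label pts t ->
  label pts v = label pts t.
Proof.
move=> /andP[tv vu] H; apply/eqP; rewrite eqn_leq -{1}H (label_add _ vu) leq_addr.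
by rewrite (label_add _ tv) leq_addr.
Qed.

Lemma label_notin pts t s u : s \in pts -> t < s <= u -> label pts u <> label pts t.
Proof.
move=> sp /andP[ts su]; rewrite (label_add _ (le_trans (ltW ts) su)).
move=> /eqP; rewrite -[X in _ == X]addn0 eqn_add2l => /eqP H.
by have : has (fun s : R => t < s <= u) pts; [apply/hasP; exists s; rewrite ?ts|rewrite has_count H].
Qed.

Lemma label_right pts t : exists2 del, 0 < del &
  forall r, t <= r < t + del -> label pts r = label pts t.
Proof.
elim: pts => [|s pts [del del0 IH]]; first by exists 1.
have [st|ts] := leP s t.
  exists del => // r /andP[tr rd]; rewrite /label/= st (le_trans st tr).
  by congr (_ + _)%N; apply: IH; rewrite tr.
exists (Num.min del (s - t)) => [|r /andP[tr]]; first by rewrite lt_min del0 subr_gt0.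
rewrite -ltrBlDl lt_min => /andP[rd rs]; rewrite /label/= (leNgt s t) ts/=.
rewrite leNgt (_ : r < s)/=; last by rewrite ltrBlDl addrC subrK in rs.
by apply: IH; rewrite tr -ltrBlDl.
Qed.

Lemma label_grid pts m t u : (forall k, (k <= m)%N -> k.+1%:R / m.+1%:R \in pts) ->
  0 <= t -> u <= 1 -> label pts u = label pts t -> u - t <= m.+1%:R^-1.
Proof.
move=> Hm t0 u1 H; rewrite leNgt; apply/negP => tu.
have m0 : 0 < m.+1%:R :> R by [].
pose k := Num.truncn (t * m.+1%:R).
have k1 : k%:R <= t * m.+1%:R by rewrite truncn_le// mulr_ge0.
have k2 : t * m.+1%:R < k.+1%:R by exact: truncnS_gt.
have ku : k.+1%:R / m.+1%:R < u.
  rewrite ltr_pdivrMr// -natr1; apply: (@le_lt_trans _ _ (t * m.+1%:R + 1)); first by rewrite lerD2r.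
  by rewrite -ltrBrDl -mulrBl -ltr_pdivrMr// mul1r.
apply: (@label_notin pts t (k.+1%:R / m.+1%:R) u _ _ H).
  apply: Hm; rewrite -ltnS -(ltr_nat R).
  have : k.+1%:R / m.+1%:R < 1 :> R by exact: lt_le_trans u1.
  by rewrite ltr_pdivrMr// mul1r; apply: le_lt_trans; rewrite ler_nat.
by rewrite (ltW ku) andbT ltr_pdivlMr.
Qed.

End label.

Section range_null.
Context {R : realType} {d : measure_display} {Omega : measurableType d}.
Variable P : probability Omega R.
Implicit Types (W : R -> Omega -> R) (Good : set Omega).

Definition oscillation_le W p a b w (M : \bar R) := forall n r r',
  dyadic n r -> dyadic n r' -> a <= r <= b -> a <= r' <= b ->
  ((`|W r' w - W r w| `^ p)%:E <= M)%E.

(** A majorant is asked for, rather than a bound on the mean of the oscillation,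
   so that nothing has to be said about the paths that are not good. *)
Definition cell_controlled Good W p s K a b := exists B : Omega -> \bar R,
  [/\ measurable_fun setT B, (forall w, (0 <= B w)%E),
    (\int[P]_w B w <= (K * (b - a) `^ s)%:E)%E &
    forall w, Good w -> oscillation_le W p a b w (B w)].

Lemma gauge_oscillation W p a b w (M : \bar R) tau (U : set R) : 0 < p -> (0 <= M)%E ->
  right_continuous_but (W ^~ w) tau -> 0 <= a -> b <= 1 ->
  oscillation_le W p a b w M ->
  (forall x, U x -> a <= x /\ (x < b \/ x = 1 /\ b = 1)) ->
  (gauge p [set W t w | t in U `\ tau] <= M)%E.
Proof.
move=> p0 + rc a0 b1 + HU; case: M => [M||] // M0 osc; last by rewrite leey.
rewrite lee_fin in M0.
have -> : M = (M `^ p^-1) `^ p by rewrite -powRrM mulVf ?gt_eqF// powRr1.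
apply: gauge_le_powR; rewrite ?powR_ge0 ?ltW//.
move=> _ _ [x [Ux xt] <-] [y [Uy yt] <-].
have [ax xb] := HU x Ux; have [ay yb] := HU y Uy.
apply: (@oscillation_of_approx _ (W ^~ w) [set r | a <= r <= b]) => [e e0|e e0|].
- exact: (dyadic_approx rc a0 b1 ax xb xt e0).
- exact: (dyadic_approx rc a0 b1 ay yb yt e0).
move=> n r r' dr dr' rab r'ab.
have := osc n r r' dr dr' rab r'ab; rewrite lee_fin => H.
have := ge0_ler_powR (_ : 0 <= p^-1) _ _ H.
rewrite -powRrM mulfV ?gt_eqF// powRr1//; apply; rewrite ?nnegrE ?powR_ge0//.
by rewrite invr_ge0 ltW.
Qed.

(** One cover of [E] by cells gives a cover of the range of every good path: the
   images of the cells, and the single value at the point [tau] where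
   right-continuity may fail. Its weight has a small mean. *)
Lemma cover_majorant W Good E p s K eta e : 0 < p -> 0 <= K -> s <= 1 ->
  0 < eta -> E `<=` `[0, 1]%classic -> (hausdorff_dim E < s%:E)%E ->
  (forall a b t, 0 <= a -> a < b -> b <= 1 -> b - a <= eta -> E t -> a <= t <= b ->
     cell_controlled Good W p s K a b) ->
  (forall w, Good w -> exists tau, right_continuous_but (W ^~ w) tau) -> 0 < e ->
  exists S : Omega -> \bar R, [/\ measurable_fun setT S, (forall w, (0 <= S w)%E),
    (\int[P]_w S w <= (K * e)%:E)%E &
    forall w, Good w -> exists2 U : nat -> set R,
      [set W t w | t in E] `<=` \bigcup_i U i &
      (\sum_(0 <= i <oo) gauge p (U i) <= S w)%E].
Proof.
move=> p0 K0 s1 eta0 E01 dimE HW rcW e0.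
have [U [a [b [EU Uab abE sum]]]] := cell_cover E01 dimE s1 eta0 e0.
pose wt j : \bar R := if U j == set0 then 0%E else ((b j - a j) `^ s)%:E.
have wt0 j : (0 <= wt j)%E by rewrite /wt; case: ifP => // _; rewrite lee_fin powR_ge0.
have /choice[B HB] j : exists B : Omega -> \bar R,
    [/\ measurable_fun setT B, (forall w, (0 <= B w)%E),
    (\int[P]_w B w <= K%:E * wt j)%E &
    U j !=set0 -> forall w, Good w -> oscillation_le W p (a j) (b j) w (B w)].
  have [U0|/set0P Uj] := eqVneq (U j) set0.
    exists (cst 0%E); split => //; last by rewrite U0 => -[].
    by rewrite integral0 mule_ge0.
  have [aj ab bj bae] := abE j Uj; have [x Ux] := Uj.
  have [Ex [ax xb]] := Uab j x Ux.
  have [|B [mB B0 IB HB]] := HW (a j) (b j) x aj ab bj bae Ex.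
    by rewrite ax/=; case: xb => [/ltW//|[-> ->]].
  exists B; split => //; apply: le_trans IB _; rewrite EFinM /wt.
  by have /set0P/negbTE -> := Uj.
exists (fun w => (\sum_(0 <= j <oo) B j w)%E); split.
- apply: ge0_emeasurable_sum => [j w _ _|j _]; by case: (HB j).
- by move=> w; apply: nneseries_ge0 => j _ _; case: (HB j).
- rewrite integral_nneseries//; last 2 first.
  + by move=> j; case: (HB j).
  + by move=> j w _; case: (HB j).
  apply: (@le_trans _ _ (\sum_(0 <= j <oo) K%:E * wt j)%E).
    apply: lee_nneseries => [j _ _|j _]; last by case: (HB j).
    by apply: integral_ge0 => w _; case: (HB j).
  rewrite nneseriesZl//; rewrite EFinM; exact: lee_wpmul2l.
move=> w Gw; have [tau rc] := rcW w Gw.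
exists (fun i => if i is j.+1 then [set W t w | t in U j `\ tau] else [set W tau w]).
  move=> _ [t Et <-]; have [->|/eqP ttau] := eqVneq t tau; first by exists 0%N.
  by have [j _ Ujt] := EU t Et; exists j.+1 => //; exists t.
apply: nneseries_le_bound => [i|n]; first exact: gauge_ge0.
case: n => [|n]; first by rewrite big_geq// nneseries_ge0// => j _ _; case: (HB j).
rewrite big_nat_recl//= [X in (X + _)%E](_ : _ = 0%E) ?add0e; last first.
  apply/eqP; rewrite eq_le gauge_ge0 andbT.
  have -> : 0%E = (0 `^ p)%:E :> \bar R by rewrite powR0// gt_eqF.
  by apply: gauge_le_powR; rewrite ?(ltW p0)// => x y -> ->; rewrite subrr normr0.
apply: (@le_trans _ _ (\sum_(0 <= j < n) B j w)%E); last first.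
  by apply: nneseries_lim_ge => j _ _; case: (HB j).
apply: lee_sum => j _; have [_ B0 _ osc] := HB j.
have [U0|/set0P Uj] := eqVneq (U j) set0.
  by rewrite U0 set0D image_set0 /gauge eqxx.
have [aj ab bj _] := abE j Uj.
apply: (@gauge_oscillation W p (a j) (b j)) => //; first exact: osc.
by move=> x /Uab[].
Qed.

(** The infimum of the weights of such covers has mean zero. *)
Lemma range_null W Good E p s K eta : 0 < p -> 0 <= K -> s <= 1 ->
  0 < eta -> E `<=` `[0, 1]%classic -> (hausdorff_dim E < s%:E)%E ->
  (forall a b t, 0 <= a -> a < b -> b <= 1 -> b - a <= eta -> E t -> a <= t <= b ->
     cell_controlled Good W p s K a b) ->
  (forall w, Good w -> exists tau, right_continuous_but (W ^~ w) tau) ->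
  {ae P, forall w, Good w -> hausdorff_measure p [set W t w | t in E] = 0%E}.
Proof.
move=> p0 K0 s1 eta0 E01 dimE HW rcW.
have ik0 k : 0 < k.+1%:R^-1 :> R by rewrite invr_gt0.
have /choice[S HS] := fun k => cover_majorant p0 K0 s1 eta0 E01 dimE HW rcW (ik0 k).
pose I w := einfs (S ^~ w) 0.
have mI : measurable_fun setT I by apply: measurable_fun_einfs => k; case: (HS k).
have I0 w : (0 <= I w)%E by apply: le_ereal_inf_tmp => _ [k _ <-]; case: (HS k).
have IS w k : (I w <= S k w)%E by apply: ereal_inf_lbound; exists k.
have II : (\int[P]_w `|I w| = 0)%E.
  apply/eqP; rewrite eq_le integral_ge0// andbT.
  apply/lee_addgt0Pr => e e0; rewrite add0e.
  have [k Kk] : exists k, K * k.+1%:R^-1 <= e.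
    exists (Num.truncn (K / e)); rewrite ler_pdivrMr// mulrC -ler_pdivrMr//.
    exact/ltW/truncnS_gt.
  have [mS S0 IntS _] := HS k.
  apply: (@le_trans _ _ (\int[P]_w S k w)%E); last exact: le_trans IntS _.
  apply: ge0_le_integral => //; first exact: measurableT_comp.
  by move=> w _; rewrite gee0_abs.
have /ae_eq_integral_abs : measurable_fun setT I by [].
move=> /(_ P measurableT)[/(_ II) + _]; apply: filterS => w /(_ Logic.I) Iw Gw.
apply: hausdorff_measure_eq0 => // e e0.
have : (ereal_inf [set S k w | k in [set k | (0 <= k)%N]] < e%:E)%E.
  by rewrite [X in (X < _)%E]Iw lte_fin.
move=> /ereal_inf_lt[_ [k _ <-] /ltW Se].
have [_ _ _ /(_ w Gw)[U WU Usum]] := HS k.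
by exists U => //; exact: le_trans Usum Se.
Qed.

End range_null.

(** * The dimension of the range *)

Section good_paths.
Context {R : realType} {d : measure_display} {Omega : measurableType d}.
Variable P : probability Omega R.
Variables (alpha : R -> R) (lo hi : R).
Variables (G V g : nat -> {RV P >-> R}) (X Z : R -> {RV P >-> R}).
Hypothesis alphaC1 : C1_on01 alpha.
Hypothesis lo0 : 0 < lo.
Hypothesis lohi : lo <= hi.
Hypothesis hi2 : hi < 2.
Hypothesis alpha_bnd : forall t, t \in `[0, 1] -> lo <= alpha t <= hi.
Hypothesis G_poisson : poisson_arrivals P G.
Hypothesis V_uniform : iid_uniform01 P V.
Hypothesis g_signs : iid_signs P g.
Hypothesis indep_g_GV : independent_sigma P (sigma_gen g)
  <<s sigma_gen G `|` sigma_gen V >>.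
Hypothesis Z_series : forall t, t \in `[0, 1] ->
  {ae P, forall w, series (Z_term alpha G V g t w) @ \oo --> Z t w}.
Hypothesis Z_cadlag : {ae P, forall w, cadlag01 (fun t => Z t w)}.
Hypothesis X_series : forall t, t \in `[0, 1] ->
  {ae P, forall w, series (X_term alpha G V g t w) @ \oo --> X t w}.
Hypothesis X_decomp : {ae P, forall w, forall t, t \in `[0, 1] ->
  X t w = Y alpha G V g t w + Z t w}.

(** Almost every path is good for some [c] of the form [1 / (m + 1)], so that
   countably many almost sure statements, one for each [c], suffice. *)
Record good_path (c : R) (w : Omega) : Prop := GoodPath {
  good_sign : forall i, `|g i w| <= 1;
  good_growth : forall i, c * i.+1%:R <= G i w;
  good_Z : forall n t, dyadic n t -> 0 <= t <= 1 ->
    series (Z_term alpha G V g t w) @ \oo --> Z t w;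
  good_X : forall n t, dyadic n t -> 0 <= t <= 1 ->
    series (X_term alpha G V g t w) @ \oo --> X t w;
  good_cadlag : cadlag01 (fun t => Z t w);
  good_decomp : forall t, t \in `[0, 1] -> X t w = Y alpha G V g t w + Z t w }.

(** The series converge almost surely at each time, hence at all dyadic times
   simultaneously; other times are reached by right-continuity. *)
Lemma ae_dyadic (S : R -> Omega -> Prop) :
  (forall t, t \in `[0, 1] -> {ae P, forall w, S t w}) ->
  {ae P, forall w n t, dyadic n t -> 0 <= t <= 1 -> S t w}.
Proof.
move=> H; have : {ae P, forall w n k, (k%:R / 2 ^+ n : R) \in `[0, 1] -> S (k%:R / 2 ^+ n) w}.
  apply: ae_foralln => n; apply: ae_foralln => k.
  have [kn|kn] := boolP ((k%:R / 2 ^+ n : R) \in `[0, 1]); last exact: aeW.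
  by apply: filterS (H _ kn) => w Sw _.
by apply: filterS => w Sw n t [k ->] H01; apply: Sw; rewrite in_itv.
Qed.

Lemma ae_good_path : {ae P, forall w, exists m, good_path m.+1%:R^-1 w}.
Proof.
have g1 := ae_sign g_signs; have Gg := ae_arrival_growth G_poisson.
apply: filterS2 (filterI Gg (filterI Z_cadlag X_decomp))
  (filterI g1 (filterI (ae_dyadic Z_series) (ae_dyadic X_series))).
move=> w [[c /andP[c0 c1] cG] [Zc Xd]] [gw [Zs Xs]].
exists (Num.truncn c^-1); split => //.
  by move=> i; case: (gw i) => ->; rewrite ?normrN1 ?normr1.
move=> i; apply: le_trans (cG i); rewrite ler_wpM2r// invf_ple ?posrE//.
exact/ltW/truncnS_gt.
Qed.

Section fixed_growth.
Variable c : R.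
Hypothesis c01 : 0 < c <= 1.

Let trunc1 i w : good_path c w -> trunc c i (G i w) = 1.
Proof.
by move=> Gw; rewrite /trunc indicE mem_set//= in_itv/= good_growth.
Qed.

Let Gpos i w : good_path c w -> 0 < G i w.
Proof.
move=> Gw; apply: lt_le_trans (good_growth Gw i).
by rewrite mulr_gt0//; case/andP: c01.
Qed.

Lemma Z_partialE n t w : good_path c w -> 0 <= t <= 1 ->
  Z_partial alpha c G V g n t w = series (Z_term alpha G V g t w) n.
Proof.
move=> Gw /andP[t0 t1]; rewrite /Z_partial signed_sum_nat; apply: eq_bigr => i _.
rewrite /z_coef /= trunc1// mul1r /Z_term indicE.
case: (boolP (_ \in _)) => [/set_mem/=|]; rewrite ?mulr0//.
rewrite in_itv/= => /andP[v0 vt]; rewrite jumpE ?Gpos//.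
by rewrite v0 (le_trans vt).
Qed.

Lemma Y_partialE n t w : good_path c w -> 0 <= t <= 1 ->
  Y_partial alpha c G V g n t w =
  series (X_term alpha G V g t w) n - series (Z_term alpha G V g t w) n.
Proof.
move=> Gw t01; have /andP[t0 t1] := t01.
rewrite /Y_partial signed_sum_nat -sumrB; apply: eq_bigr => i _.
rewrite /y_coef /= trunc1// mul1r /Z_term /X_term indicE.
case: (boolP (_ \in _)) => [/set_mem/=|]; last by rewrite !mulr0 subrr.
rewrite in_itv/= => /andP[v0 vt]; rewrite !jumpE ?Gpos//.
  by rewrite !mulr1 mulrBr.
by rewrite v0 (le_trans vt).
Qed.

Lemma cell_controlled_sym (W : R -> Omega -> R) (Good : set Omega) p s K a b
    (B : Omega -> \bar R) : measurable_fun setT B -> (forall w, (0 <= B w)%E) ->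
  (\int[P]_w B w <= (K * (b - a) `^ s)%:E)%E ->
  (forall w, Good w -> forall n r r', dyadic n r -> dyadic n r' ->
     a <= r -> r <= r' -> r' <= b -> ((`|W r' w - W r w| `^ p)%:E <= B w)%E) ->
  cell_controlled P Good W p s K a b.
Proof.
move=> mB B0 IB H; exists B; split => // w Gw n r r' dr dr' /andP[ar rb] /andP[ar' rb'].
have [rr|/ltW rr] := leP r r'; first exact: (H w Gw n).
by rewrite distrC; exact: (H w Gw n).
Qed.

Lemma Z_controlled (beta p : R) : 0 < p <= 1 -> p < beta -> beta < 2 ->
  exists2 K, 0 <= K & forall a b, 0 <= a -> a < b -> b <= 1 ->
  (forall v, a <= v <= b -> stable_index alpha v <= beta) ->
  cell_controlled P (good_path c) (fun t w => Z t w) p (p / beta) K a b.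
Proof.
move=> p01 pb b2.
have [K K0 HK] := Z_cell alphaC1 lo0 lohi hi2 alpha_bnd V_uniform g_signs indep_g_GV c01 p01 pb b2.
exists K => // a b a0 ab b1 ib; have [B [mB B0 IB HB]] := HK a b a0 ab b1 ib.
apply: cell_controlled_sym mB B0 IB _ => w Gw n r r' dr dr' ar rr rb.
have r01 : 0 <= r <= 1 by rewrite (le_trans a0)// (le_trans rr)// (le_trans rb).
have r01' : 0 <= r' <= 1 by rewrite (le_trans a0) ?(le_trans ar)// (le_trans rb).
apply: (HB w (good_sign Gw) n r r') => //.
  by under eq_fun do rewrite Z_partialE//; exact: good_Z Gw _ _ dr r01.
by under eq_fun do rewrite Z_partialE//; exact: good_Z Gw _ _ dr' r01'.
Qed.

(** The bound for [Y] is better than that for [Z], as [1 <= beta]. *)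
Lemma X_controlled (beta p : R) : 0 < p <= 1 -> 1 <= beta -> p < beta -> beta < 2 ->
  exists2 K, 0 <= K & forall a b, 0 <= a -> a < b -> b <= 1 ->
  (forall v, a <= v <= b -> stable_index alpha v <= beta) ->
  cell_controlled P (good_path c) (fun t w => X t w) p (p / beta) K a b.
Proof.
move=> p01 beta1 pb b2; have /andP[p0 p1] := p01.
have [K K0 HK] := Z_cell alphaC1 lo0 lohi hi2 alpha_bnd V_uniform g_signs indep_g_GV c01 p01 pb b2.
have [L L0 HL] := Y_cell alphaC1 lo0 lohi hi2 alpha_bnd g_signs indep_g_GV c01 p01.
exists (K + L) => [|a b a0 ab b1 ib]; first exact: addr_ge0.
have [B [mB B0 IB HB]] := HK a b a0 ab b1 ib.
have [C [mC C0 IC HC]] := HL a b a0 ab b1.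
apply: (@cell_controlled_sym _ _ _ _ _ _ _ (fun w => B w + C w)%E).
- exact: emeasurable_funD.
- by move=> w; exact: adde_ge0.
- rewrite ge0_integralD// mulrDl EFinD; apply: leeD => //.
  apply: le_trans IC _; rewrite lee_fin ler_wpM2l//.
  apply: ger_powR; first by rewrite subr_gt0 ab/= lerBlDr (le_trans b1)// lerDl.
  by rewrite ler_pdivrMr ?(lt_le_trans ltr01)// ler_peMr// ltW.
move=> w Gw n r r' dr dr' ar rr rb.
have r01 : 0 <= r <= 1 by rewrite (le_trans a0)// (le_trans rr)// (le_trans rb).
have r01' : 0 <= r' <= 1 by rewrite (le_trans a0) ?(le_trans ar)// (le_trans rb).
have Zr := good_Z Gw dr r01; have Zr' := good_Z Gw dr' r01'.
have Xr := good_X Gw dr r01; have Xr' := good_X Gw dr' r01'.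
have HZ : ((`|Z r' w - Z r w| `^ p)%:E <= B w)%E.
  by apply: (HB w (good_sign Gw) n r r') => //; under eq_fun do rewrite Z_partialE//.
have HY : ((`|(X r' w - Z r' w) - (X r w - Z r w)| `^ p)%:E <= C w)%E.
  apply: (HC w n r r') => //; under eq_fun do rewrite Y_partialE//; exact: cvgB.
apply: le_trans (leeD HZ HY); rewrite -EFinD lee_fin.
apply: le_trans (powR_subadditive p01 _ _) => //.
apply: ge0_ler_powR; rewrite ?nnegrE ?addr_ge0 ?(ltW p0)//.
apply: le_trans (ler_normD _ _); rewrite le_eqVlt; apply/orP; left; apply/eqP.
by congr `| _ |; ring.
Qed.

Lemma Z_right_continuous w : good_path c w -> forall tau, right_continuous_but (Z ^~ w) tau.
Proof.
move=> Gw tau t /andP[t0 t1] _ e e0.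
have [+ _] := good_cadlag Gw => /(_ t); rewrite in_itv/= t0 t1 => /(_ isT).
move=> /cvgrPdist_le/(_ e e0)[del /= del0 H]; exists del => // r /andP[tr rd] _.
rewrite distrC; apply: H => //=; rewrite distrC ger0_norm ?subr_ge0 ?ltW//.
by rewrite ltrBlDl.
Qed.

Lemma X_right_continuous w : good_path c w -> exists tau, right_continuous_but (X ^~ w) tau.
Proof.
move=> Gw; have [tau Htau] := right_continuous_Rintegral
  (fun u => lim (series (Y_term alpha G V g u w) @ \oo)).
exists tau => t t01 ttau e e0; have e2 : 0 < e / 2 by rewrite divr_gt0.
have /andP[t0 t1] := t01.
have [del del0 Hdel] := Htau t t01 ttau _ e2.
have [del' del0' Hdel'] := Z_right_continuous Gw t01 ttau e2.
exists (Num.min del del'); first by rewrite lt_min del0.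
move=> r /andP[tr]; rewrite -ltrBlDl lt_min !ltrBlDl => /andP[rd rd'] r1.
rewrite !(good_decomp Gw) ?in_itv/= ?t0 ?(ltW t1) ?r1 ?(le_trans t0 (ltW tr))//.
have -> : Y alpha G V g r w + Z r w - (Y alpha G V g t w + Z t w) =
  (Y alpha G V g r w - Y alpha G V g t w) + (Z r w - Z t w) by ring.
apply: le_trans (ler_normD _ _) _; rewrite (splitr e); apply: lerD.
  by apply: Hdel; rewrite ?tr.
by apply: Hdel'; rewrite ?tr.
Qed.

(** Exponents [s > dE] and [beta > A] with product [p <= q]: [s] is halfway between
   [dE] and the largest value allowed, and [beta] is as large as permitted by [q]
   unless that brings it close to 2. *)
Lemma choose_exponents (A dE q : R) : 0 < A < 2 -> 0 <= dE < 1 -> A * dE < q -> q < 1 ->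
  exists s beta p, [/\ dE < s, s <= 1, A < beta, beta < 2 &
    [/\ 0 < p, p <= q, p < beta & p / beta = s]].
Proof.
move=> /andP[A0 A2] /andP[d0 d1] Aq q1.
have qA : dE < q / A by rewrite ltr_pdivlMr// mulrC.
pose m := Num.min 1 (q / A); have dm : dE < m by rewrite lt_min d1.
pose s := (dE + m) / 2.
have ds : dE < s by rewrite /s; lra.
have sm : s < m by rewrite /s; lra.
have /andP[s1 sqA] : (s < 1) && (s < q / A) by rewrite -lt_min.
have s0 : 0 < s by exact: le_lt_trans d0 ds.
have Aqs : A < q / s by rewrite ltr_pdivlMr// mulrC -ltr_pdivlMr.
pose beta := Num.min ((A + 2) / 2) (q / s).
have Ab : A < beta by rewrite lt_min Aqs andbT; lra.
have b2 : beta < 2.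
  by apply: (@le_lt_trans _ _ ((A + 2) / 2)); [rewrite ge_min lexx|lra].
have b0 : 0 < beta by exact: lt_trans Ab.
exists s, beta, (s * beta); split => //; first exact: ltW.
split; first exact: mulr_gt0.
- by rewrite mulrC -ler_pdivlMr// ge_min lexx orbT.
- by rewrite gtr_pMl.
- by rewrite mulfK// gt_eqF.
Qed.

(** By continuity the indices near [E] exceed those on [E] by little. *)
Lemma index_locally_le (E : set R) (A beta : R) : E `<=` `[0, 1]%classic -> A < beta ->
  (forall t, E t -> alpha t <= A) ->
  exists2 eta, 0 < eta & forall t v, E t -> `|v - t| <= eta -> stable_index alpha v <= beta.
Proof.
move=> E01 Ab EA; have [L L0 HL] := index_lip alphaC1.
have b0 : 0 < beta - A by rewrite subr_gt0.
exists ((beta - A) / L) => [|t v Et vt]; first exact: divr_gt0.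
have t01 : 0 <= t <= 1 by have := E01 _ Et; rewrite /= in_itv.
have it : stable_index alpha t <= A by rewrite /stable_index clamp01_id//; exact: EA.
have H : stable_index alpha v - stable_index alpha t <= beta - A.
  apply: le_trans (ler_norm _) _; apply: le_trans (HL v t) _.
  by rewrite mulrC -ler_pdivlMr.
by lra.
Qed.

Lemma range_null_good (W : R -> Omega -> R) (E : set R) (A dE q : R) :
  (forall beta p, 0 < p <= 1 -> A < beta -> p < beta -> beta < 2 ->
    exists2 K, 0 <= K & forall a b, 0 <= a -> a < b -> b <= 1 ->
    (forall v, a <= v <= b -> stable_index alpha v <= beta) ->
    cell_controlled P (good_path c) W p (p / beta) K a b) ->
  (forall w, good_path c w -> exists tau, right_continuous_but (W ^~ w) tau) ->
  E `<=` `[0, 1]%classic -> (forall t, E t -> alpha t <= A) ->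
  0 < A < 2 -> hausdorff_dim E = dE%:E -> 0 <= dE < 1 -> A * dE < q -> q < 1 ->
  {ae P, forall w, good_path c w ->
    (hausdorff_dim [set W t w | t in E] <= q%:E)%E}.
Proof.
move=> HW rcW E01 EA A02 dimE dE01 Aq q1.
have [s [beta [p [ds s1 Ab b2 [p0 pq pb ps]]]]] := choose_exponents A02 dE01 Aq q1.
have p01 : 0 < p <= 1 by rewrite p0 (le_trans pq)// ltW.
have [K K0 HK] := HW beta p p01 Ab pb b2.
have [eta eta0 Heta] := index_locally_le E01 Ab EA.
have /(_ _ _ _) H := @range_null _ _ _ P W (good_path c) E p s K eta p0 K0 s1 eta0 E01.
apply: filterS (H _ _ rcW).
- move=> w Hw Gw; apply: le_trans (hausdorff_dim_le (ltW p0) (Hw Gw)) _.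
  by rewrite lee_fin.
- by rewrite dimE lte_fin.
- move=> a b t a0 ab b1 bae Et /andP[at_ tb]; rewrite -ps; apply: HK => // v /andP[av vb].
  apply: (Heta t) => //; apply: le_trans bae; rewrite ler_norml; apply/andP; split; lra.
Qed.

(** When all the indices met on [E] are below [q < 1] the jumps are
   q-summable: after cutting at finitely many of them, the q-th powers of the
   oscillations of a single path add up to an arbitrarily small total. *)
Lemma Z_range_null (E : set R) (A q : R) w : good_path c w ->
  E `<=` `[0, 1]%classic -> (forall t, E t -> alpha t <= A) -> 0 < A -> A < q -> q < 1 ->
  hausdorff_measure q [set Z t w | t in E] = 0%E.
Proof.
move=> Gw E01 EA A0 Aq q1; have q0 : 0 < q by exact: lt_trans Aq.
have q01 : 0 < q <= 1 by rewrite q0 ltW.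
pose beta := (A + q) / 2.
have Ab : A < beta by rewrite /beta; lra.
have bq : beta < q by rewrite /beta; lra.
have b0 : 0 < beta by exact: lt_trans Ab.
have [eta eta0 Heta] := index_locally_le E01 Ab EA.
have [kap [kap0 Hkap _]] := jump_bounds alphaC1 lo0 lohi hi2 alpha_bnd c01.
pose r := q / beta; have r1 : 1 < r by rewrite ltr_pdivlMr// mul1r.
have rr1 : 0 < r - 1 by rewrite subr_gt0.
apply: hausdorff_measure_eq0 => // e e0.
pose C := kap `^ q * (r - 1)^-1.
have C0 : 0 < C by rewrite mulr_gt0 ?powR_gt0// invr_gt0.
(* beyond [N] the jumps bounded by [kap * i.+1 `^ (- beta^-1)] weigh at most [e] *)
pose y := (C / e) `^ (r - 1)^-1; have y0 : 0 < y by rewrite powR_gt0// divr_gt0.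
pose N := (Num.truncn y).+1.
have yN : y <= N%:R by apply/ltW/truncnS_gt.
have CN : C * N%:R `^ (1 - r) <= e.
  rewrite mulrC -ler_pdivlMr// -(opprB r 1) powRN -(invf_div C e).
  have Ce : 0 < C / e by exact: divr_gt0.
  rewrite lef_pV2 ?posrE ?powR_gt0//.
  have -> : C / e = y `^ (r - 1) by rewrite -powRrM mulVf ?gt_eqF// powRr1// divr_ge0// ltW.
  by apply: ge0_ler_powR; rewrite ?nnegrE ?(ltW rr1) ?(ltW y0) ?ler0n.
pose m := Num.truncn eta^-1.
have meta : m.+1%:R^-1 <= eta by rewrite invf_ple ?posrE//; exact/ltW/truncnS_gt.
(* Cutting also at the multiples of [1 / m.+1] keeps the pieces near [E]. *)
pose pts := [seq V i w | i <- iota 0 N] ++ [seq k.+1%:R / m.+1%:R | k <- iota 0 m.+1].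
have Vpts i : (i < N)%N -> V i w \in pts.
  by move=> iN; rewrite mem_cat; apply/orP; left; apply: (map_f (fun i => V i w)); rewrite mem_iota.
have gpts k : (k <= m)%N -> k.+1%:R / m.+1%:R \in pts.
  move=> km; rewrite mem_cat; apply/orP; right.
  by apply: (map_f (fun k => k.+1%:R / m.+1%:R)); rewrite mem_iota.
pose bnd i : R := kap `^ q * i.+1%:R `^ (- r).
have bnd0 i : 0 <= bnd i by rewrite mulr_ge0 ?powR_ge0.
pose el i j : R := if (N <= i)%N && (label pts (V i w) == j) then bnd i else 0.
have el0 i j : 0 <= el i j by rewrite /el; case: ifP.
pose D j := (\sum_(0 <= i <oo) (el i j)%:E)%E.
pose U j := [set Z t w | t in E `&` [set t | label pts t = j]].
have key j t n u v : E t -> label pts t = j -> dyadic n u -> dyadic n v ->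
    0 <= u -> u <= v -> v <= 1 -> label pts u = j -> label pts v = j ->
    ((`|Z v w - Z u w| `^ q)%:E <= D j)%E.
  move=> Et tj du dv u0 uv v1 uj vj.
  have [->|zz] := eqVneq (Z v w - Z u w) 0.
    rewrite normr0 powR0 ?gt_eqF//; apply: nneseries_ge0 => i _ _; by rewrite lee_fin.
  have D0 : (0 <= D j)%E by apply: nneseries_ge0 => i _ _; rewrite lee_fin.
  case ED : (D j) D0 => [M||] // _; last by rewrite leey.
  rewrite lee_fin.
  have u01 : 0 <= u <= 1 by rewrite u0 (le_trans uv).
  have v01 : 0 <= v <= 1 by rewrite v1 (le_trans u0).
  have cvz : (Z_partial alpha c G V g n v w - Z_partial alpha c G V g n u w)
      @[n --> \oo] --> Z v w - Z u w.
    by apply: cvgB; under eq_fun do rewrite Z_partialE//; [exact: good_Z Gw _ _ dv v01|exact: good_Z Gw _ _ du u01].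
  apply: (cvgr_to_le (norm_powR_cvg (p := q) zz cvz)); apply: nearW => k.
  rewrite -lee_fin -ED.
  apply: (@le_trans _ _ (\sum_(0 <= i < k) (el i j)%:E)%E); last first.
    by apply: nneseries_lim_ge => i _ _; rewrite lee_fin.
  rewrite sumEFin lee_fin /Z_partial !signed_sum_nat -sumrB.
  apply: le_trans (ge0_ler_powR (ltW q0) _ _ (ler_norm_sum _ _ _)) _.
  - by rewrite nnegrE.
  - by rewrite nnegrE sumr_ge0.
  apply: (@le_trans _ _ (\sum_(0 <= i < k) `|g i w * z_coef alpha c i (G i w, V i w) *
      \1_(`[0, v]%classic) (V i w) - g i w * z_coef alpha c i (G i w, V i w) *
      \1_(`[0, u]%classic) (V i w)| `^ q)); first exact: powR_sum_le.
  apply: ler_sum => i _; rewrite -mulrBr (indic_itv_diff _ u0 (lexx u) uv).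
  have := norm_half_open (V i w) (lexx v) (lexx u) uv.
  rewrite [X in _ <= X -> _]indicE; case: (boolP (_ \in _)) => [/set_mem/= Vuv|_]; last first.
    by rewrite normr_le0 => /eqP ->; rewrite mulr0 normr0 powR0 ?gt_eqF.
  rewrite in_itv/= in Vuv; have /andP[uV Vv] := Vuv => H1.
  have Ni : (N <= i)%N.
    rewrite leqNgt; apply/negP => /Vpts Vi.
    by apply: (label_notin Vi Vuv); rewrite vj uj.
  have Vj : label pts (V i w) = j.
    by rewrite -uj; apply: (@label_between _ _ _ _ v); rewrite ?(ltW uV)// vj uj.
  have iV : stable_index alpha (V i w) <= beta.
    have /andP[t0 t1] : 0 <= t <= 1 by have := E01 _ Et; rewrite /= in_itv.
    apply: (Heta t) => //; apply: le_trans meta; rewrite ler_norml; apply/andP; split.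
      rewrite lerNl opprB; apply: (label_grid gpts _ t1); last by rewrite tj Vj.
      exact: le_trans u0 (ltW uV).
    by apply: (label_grid gpts t0); [exact: le_trans v1|rewrite tj Vj].
  rewrite /el Ni Vj eqxx /=.
  have -> : bnd i = (kap * i.+1%:R `^ (- beta^-1)) `^ q.
    by rewrite powRM ?powR_ge0 ?(ltW kap0)// -powRrM mulNr /bnd /r (mulrC q).
  apply: ge0_ler_powR; rewrite ?nnegrE ?(ltW q0) ?mulr_ge0 ?powR_ge0 ?(ltW kap0)//.
  rewrite normrM (normrM (g i w)) -[leRHS]mulr1 -[leRHS](mul1r (_ * 1)) -mulrA.
  apply: ler_pM => //; first exact: (good_sign Gw).
  apply: ler_pM => //; rewrite /z_coef trunc1// mul1r.
  by apply: Hkap => //; exact: (good_growth Gw).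
have gU j : (gauge q (U j) <= D j)%E.
  have D0 : (0 <= D j)%E by apply: nneseries_ge0 => i _ _; rewrite lee_fin.
  case ED : (D j) D0 => [M||] //; rewrite ?leey// lee_fin => M0.
  have -> : M = (M `^ q^-1) `^ q by rewrite -powRrM mulVf ?gt_eqF// powRr1.
  apply: gauge_le_powR; rewrite ?powR_ge0 ?(ltW q0)//.
  have approx x : E x -> label pts x = j -> forall e', 0 < e' -> exists n u,
      [/\ dyadic n u, 0 <= u <= 1 /\ label pts u = j & `|Z u w - Z x w| <= e'].
    move=> Ex xj e' e'0; have /andP[x0 x1] : 0 <= x <= 1.
      by have := E01 _ Ex; rewrite /= in_itv.
    have [del del0 Hdel] := label_right pts x.
    have rc : right_continuous_but (Z ^~ w) (- 1) by exact: Z_right_continuous Gw _.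
    have [|||n [u [du /andP[xu ub] Zu]]] := @dyadic_approx _ (Z ^~ w) (- 1) x
      (Num.min 1 (x + del / 2)) x e' rc x0 _ (lexx x) _ _ e'0.
    - by rewrite ge_min lexx.
    - have [x1'|x1'] := ltP x 1; first by left; rewrite lt_min x1' ltrDl divr_gt0.
      have {}x1 : x = 1 by apply/eqP; rewrite eq_le x1.
      by right; split => //; rewrite min_l// x1 lerDl divr_ge0// ltW.
    - by move=> x_; move: x0; rewrite x_; lra.
    move: ub; rewrite le_min => /andP[u1 ud].
    exists n, u; split => //; split; first by rewrite (le_trans x0).
    by rewrite Hdel// xu; lra.
  move=> _ _ [x [Ex xj] <-] [x' [Ex' xj'] <-].
  apply: (@oscillation_of_approx _ (Z ^~ w) [set u | 0 <= u <= 1 /\ label pts u = j]).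
  - exact: approx.
  - exact: approx.
  move=> n u v du dv [/andP[u0 u1] uj] [/andP[v0 v1] vj].
  have H : `|Z v w - Z u w| `^ q <= M.
    rewrite -lee_fin -ED; have [uv|/ltW vu] := leP u v; first exact: (key j x n).
    by rewrite distrC; exact: (key j x n).
  have := ge0_ler_powR (_ : 0 <= q^-1) _ _ H.
  rewrite -powRrM mulfV ?gt_eqF// powRr1//; apply; rewrite ?nnegrE ?powR_ge0//.
  by rewrite invr_ge0 ltW.
exists U.
  by move=> _ [t Et <-]; exists (label pts t) => //; exists t.
apply: nneseries_le_bound => [j|n]; first exact: gauge_ge0.
apply: (@le_trans _ _ (\sum_(0 <= j < n) D j)%E); first by apply: lee_sum => j _.
rewrite /D -nneseries_sum_nat; last by move=> j i; rewrite lee_fin.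
apply: nneseries_le_bound => [i|k]; first by apply: sume_ge0 => j _; rewrite lee_fin.
apply: (@le_trans _ _ (\sum_(0 <= i < k) (if (N <= i)%N then bnd i else 0)%:E)%E).
  apply: lee_sum => i _; rewrite sumEFin lee_fin /el.
  case: (N <= i)%N => /=; last by rewrite big1.
  rewrite -big_mkcond/= (eq_bigl (fun j => j == label pts (V i w))); last by move=> j; rewrite eq_sym.
  by rewrite big_nat1_eq; case: ifP.
rewrite sumEFin lee_fin; apply: le_trans CN.
have [kN|Nk] := leqP k N.
  rewrite big_nat big1 => [|i /andP[_ ik]]; last by rewrite leqNgt (leq_trans ik kN).
  exact: mulr_ge0 (ltW C0) (powR_ge0 _ _).
rewrite (big_cat_nat (n := N))//=; last exact: ltnW.
rewrite big_nat big1 ?add0r => [|i /andP[_ iN]]; last by rewrite leqNgt iN.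
rewrite big_nat; under eq_bigr => i /andP[-> _] do [].
rewrite -big_nat -mulr_sumr -mulrA ler_wpM2l ?powR_ge0//.
exact: sum_powR_gt1.
Qed.

(** As the dimension is at most 1, only bounds below 1 require an argument. *)
Lemma ae_dim_le (S : set Omega) (F : Omega -> set R) (a : R) :
  (a < 1 -> forall q, a < q -> q < 1 ->
     {ae P, forall w, S w -> (hausdorff_dim (F w) <= q%:E)%E}) ->
  {ae P, forall w, S w -> (hausdorff_dim (F w) <= a%:E)%E}.
Proof.
move=> H; have [a1|a1] := leP 1 a.
  by apply: aeW => w _; apply: le_trans (hausdorff_dim_le1 _) _; rewrite lee_fin.
have a1' : 0 < 1 - a by rewrite subr_gt0.
pose q n := a + (1 - a) / n.+2%:R.
have /ae_foralln : forall n, {ae P, forall w, S w -> (hausdorff_dim (F w) <= (q n)%:E)%E}.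
  move=> n; apply: H => //; first by rewrite ltrDl divr_gt0.
  by rewrite /q -ltrBrDl ltr_pdivrMr// ltr_pMr// ltr1n.
apply: filterS => w Hw Sw; apply/lee_addgt0Pr => e e0.
apply: le_trans (Hw (Num.truncn ((1 - a) / e)) Sw) _; rewrite -EFinD lee_fin lerD2l.
rewrite ler_pdivrMr// mulrC -ler_pdivrMr//; apply/ltW.
by apply: lt_trans (truncnS_gt _) _; rewrite ltr_nat.
Qed.

(** When [dE = 1] the first moments over cells give nothing below the exponent 1,
   and the range is treated path by path. *)
Lemma Z_dim_le (E : set R) (A dE : R) : E `<=` `[0, 1]%classic ->
  (forall t, E t -> alpha t <= A) -> 0 < A < 2 -> hausdorff_dim E = dE%:E ->
  {ae P, forall w, good_path c w ->
    (hausdorff_dim [set Z t w | t in E] <= (A * dE)%:E)%E}.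
Proof.
move=> E01 EA A02 dimE; have /andP[A0 A2] := A02.
have d0 : 0 <= dE by rewrite -lee_fin -dimE hausdorff_dim_ge0.
have d1 : dE <= 1 by rewrite -lee_fin -dimE hausdorff_dim_le1.
apply: ae_dim_le => _ q Aq q1; have [dE1|dE1] := ltP dE 1.
  apply: (@range_null_good (fun t w => Z t w) E A dE) => //; last by rewrite d0.
    by move=> beta p p01 _ pb b2; exact: Z_controlled.
  by move=> w Gw; exists 0; exact: Z_right_continuous Gw _.
have {}Aq : A < q by move: Aq; rewrite (_ : dE = 1) ?mulr1//; apply/eqP; rewrite eq_le d1.
apply: aeW => w Gw; apply: hausdorff_dim_le; first exact/ltW/(lt_trans A0).
exact: Z_range_null Gw E01 EA A0 Aq q1.
Qed.

Lemma X_dim_le (E : set R) (A dE : R) : E `<=` `[0, 1]%classic ->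
  (forall t, E t -> alpha t <= A) -> 1 <= A < 2 -> hausdorff_dim E = dE%:E ->
  {ae P, forall w, good_path c w ->
    (hausdorff_dim [set X t w | t in E] <= (A * dE)%:E)%E}.
Proof.
move=> E01 EA /andP[A1 A2] dimE; have A0 : 0 < A by exact: lt_le_trans A1.
have d0 : 0 <= dE by rewrite -lee_fin -dimE hausdorff_dim_ge0.
apply: ae_dim_le => AdE q Aq q1.
have dE1 : dE < 1 by apply: le_lt_trans AdE; rewrite ler_peMl.
apply: (@range_null_good (fun t w => X t w) E A dE) => //.
- move=> beta p p01 Ab pb b2; apply: X_controlled => //.
  exact/ltW/(le_lt_trans A1).
- exact: X_right_continuous.
- by rewrite A0.
- by rewrite d0.
Qed.

End fixed_growth.
End good_paths.

Lemma hausdorff_dim_set0 (R : realType) : hausdorff_dim (set0 : set R) = 0%E.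
Proof.
apply/eqP; rewrite eq_le hausdorff_dim_ge0 andbT; apply/lee_addgt0Pr => e e0.
rewrite add0e; apply: hausdorff_dim_le; first exact: ltW.
apply: hausdorff_measure_eq0 => // e' e'0; exists (fun=> set0) => //.
by rewrite eseries0 ?lee_fin ?ltW// => i _ _; rewrite /gauge eqxx.
Qed.

Theorem theorem3p2 (R : realType) (d : measure_display)
    (Omega : measurableType d) (P : probability Omega R)
    (alpha : R -> R) (alpha_lo alpha_hi : R)
    (G V g : nat -> {RV P >-> R}) (X Z : R -> {RV P >-> R}) (E : set R)
    (alphaC1 : C1_on01 alpha)
    (alpha_lo_gt0 : 0 < alpha_lo) (alpha_lo_hi : alpha_lo <= alpha_hi)
    (alpha_hi_lt2 : alpha_hi < 2)
    (alpha_bnd : forall t, t \in `[0, 1] -> alpha_lo <= alpha t <= alpha_hi)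
    (G_poisson : poisson_arrivals P G)
    (V_uniform : iid_uniform01 P V)
    (g_signs : iid_signs P g)
    (indep_V_G : independent_sigma P (sigma_gen V) (sigma_gen G))
    (indep_g_GV : independent_sigma P (sigma_gen g)
                    <<s sigma_gen G `|` sigma_gen V >>)
    (Z_series : forall t, t \in `[0, 1] ->
       {ae P, forall w, series (Z_term alpha G V g t w) @ \oo --> Z t w})
    (Z_cadlag : {ae P, forall w, cadlag01 (fun t => Z t w)})
    (X_series : forall t, t \in `[0, 1] ->
       {ae P, forall w, series (X_term alpha G V g t w) @ \oo --> X t w})
    (X_decomp : {ae P, forall w, forall t, t \in `[0, 1] ->
       X t w = Y alpha G V g t w + Z t w})
    (E01 : E `<=` `[0, 1]) :
  {ae P, forall w,
    (hausdorff_dim [set Z t w | t in E] <=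
       (sup_index alpha E)%:E * hausdorff_dim E)%E /\
    (hausdorff_dim [set X t w | t in E] <= dstar alpha E)%E}.
Proof.
have [->|/set0P[t0 Et0]] := eqVneq E set0.
  apply: aeW => w; rewrite !image_set0 /dstar hausdorff_dim_set0 !mule0.
  by split.
pose A := sup_index alpha E.
have al t : E t -> alpha_lo <= alpha t <= alpha_hi by move=> /E01; exact: alpha_bnd.
have ubA : has_ubound (alpha @` E).
  by exists alpha_hi => _ [t /al/andP[_ ?] <-].
have EA t : E t -> alpha t <= A by move=> Et; apply: ub_le_sup => //; exists t.
have A0 : 0 < A.
  by have /andP[l _] := al _ Et0; apply: lt_le_trans (EA _ Et0); exact: lt_le_trans l.
have A2 : A < 2.
  apply: le_lt_trans alpha_hi_lt2; apply: ge_sup; first by exists (alpha t0), t0.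
  by move=> _ [t /al/andP[_ ?] <-].
pose dE := fine (hausdorff_dim E).
have dimE : hausdorff_dim E = dE%:E.
  rewrite /dE fineK// ge0_fin_numE ?hausdorff_dim_ge0//.
  exact: le_lt_trans (hausdorff_dim_le1 E) (ltry _).
pose c m : R := m.+1%:R^-1.
have c01 m : 0 < c m <= 1 by rewrite invr_gt0 ltr0n/= invf_le1// ler1n.
pose good m w := good_path alpha G V g X Z (c m) w.
have HZ : {ae P, forall w m, good m w ->
    (hausdorff_dim [set Z t w | t in E] <= (A * dE)%:E)%E}.
  apply: ae_foralln => m; apply: (Z_dim_le (lo := alpha_lo) (hi := alpha_hi)) => //.
  by rewrite A0.
have HX : {ae P, forall w m, good m w ->
    (hausdorff_dim [set X t w | t in E] <= (Num.max 1 A * dE)%:E)%E}.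
  apply: ae_foralln => m; apply: (X_dim_le (lo := alpha_lo) (hi := alpha_hi)) => //.
    by move=> t Et; rewrite le_max EA ?orbT.
  by rewrite le_max lexx/= gt_max A2 ltr1n.
have HG := ae_good_path G_poisson g_signs Z_series Z_cadlag X_series X_decomp.
apply: filterS2 HG (filterI HZ HX) => w [m Gw] [HZw HXw].
by rewrite /dstar dimE -!EFinM; split; [exact: HZw Gw|exact: HXw Gw].
Qed.
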